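(* Let $S$ be a CSP with parameters $w,\ell,W,q,s$ and type $\mathcal R$, and let $m$ be the number of constraints of the instances. (a) If $\bigcup\mathrm{E}(S)$ is solvable in time $T$, then $\mathrm{H}(S)_{\emptyset}$ is solvable in time $O\big((T+s\cdot|[\ell]^{(q)}|\cdot\mathrm{comp}(\mathcal R))\cdot m\cdot\dim(\bigcup\mathrm{E}(\mathcal R))\big)$. (b) If $\mathrm{H}(S)_{\emptyset}$ is solvable in time $T$, then $\bigcup\mathrm{E}(S)$ is solvable in time $O\big(T\cdot m\cdot\mathrm{comp}(\bigcup\mathrm{E}(\mathcal R))\big)$.
   Context: Notation: $[k]=\{1,\dots,k\}$, $\langle k\rangle=\{0,1,\dots,k-1\}$. A constraint satisfaction problem (CSP) $S$ is specified, for every positive integer $n$, by parameters: alphabet size $w=w(n)$, assignment length $\ell=\ell(n)$, a symmetric (closed under permuting coordinates) set of admissible assignments $W\subseteq\langle w\rangle^{\ell}$, arity $q=q(n)$, number of relations $s=s(n)$; and by its type $\mathcal R=\{R_1,\dots,R_s\}$, $q$-ary relations $R_k\subseteq W_q$, where $W_q=\{u\in\langle w\rangle^q: uv\in W\text{ for some }v\}$. $[\ell]^{(q)}$ is the set of $q$-tuples of pairwise distinct elements of $[\ell]$. An instance is a set $\mathcal C=\{C_1,\dots,C_m\}$ of constraints $R_k(x_{j_1},\dots,x_{j_q})$ ($k\in[s]$, $(j_1,\dots,j_q)\in[\ell]^{(q)}$) over variables $x_1,\dots,x_\ell$; $a\in W$ satisfies such a constraint if $(a_{j_1},\dots,a_{j_q})\in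 R_k$, and satisfies $\mathcal C$ if it satisfies all. Solving: output a satisfying assignment in $W$ if one exists, ''no'' otherwise. Hidden CSP: $\mathrm{H}(S)_{\emptyset}$ has the parameters and type of $S$, but the algorithm is given only $n$ and $m$; the instance is accessible only through an $\emptyset$-revealing oracle which on a query $a\in W$ answers ''yes'' if $a$ satisfies $\mathcal C$, and otherwise returns only the index $j$ of some (arbitrarily chosen) constraint $C_j$ violated by $a$. An algorithm solves it if for every instance and every such oracle it outputs a satisfying assignment if one exists and ''no'' otherwise; complexity is the worst-case number of steps, each query counting one step. $\mathrm{comp}(R)$ is the time to decide membership in $R$, $\mathrm{comp}(\mathcal R)=\max_{R\in\mathcal R}\mathrm{comp}(R)$; $\dim(\mathcal R)$ is the length of the longest inclusion chain in $\mathcal R$. $\bigcup\mathcal R=\{\bigcup_{R\in\mathcal R'}R:\mathcal R'\subseteq\mathcal R\}$ and for a CSP $S'$, $\bigcup S'$ has the same parameters as $S'$ and type the union closure of the type of $S'$. For $R\in\mathcal R$, $(j_1,\dots,j_q)\in[\ell]^{(q)}$: $R^{(j_1,\dots,j_q)}=\{a\in W:(a_{j_1},\dots,a_{j_q})\in R\}$; for $I\subseteq[\ell]^{(q)}$, $R^I=\bigcup_{(j_1,\dots,j_q)\in I}R^{(j_1,\dots,j_q)}$. $\mathrm{E}(\mathcal R)=\bigcup_{R\in\mathcal R}\{R^I:I\subseteq[\ell]^{(q)}\}$, and $\mathrm{E}(S)$ is the CSP with the parameters of $S$ except arity $\ell$, and type $\mathrm{E}(\mathcal R)$. *)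

(* Defs.v *)
From mathcomp Require Import all_boot.
Set Implicit Arguments.
Unset Strict Implicit.
Unset Printing Implicit Defensive.

(** * Constraint satisfaction problems *)

Definition assignment (w l : nat) := l.-tuple 'I_w.

(* [l]^(q), with variables numbered from 0. *)
Definition scope (l q : nat) := {t : q.-tuple 'I_l | uniq t}.

Definition project w l q (a : assignment w l) (t : scope l q) : q.-tuple 'I_w :=
  [tuple tnth a (tnth (val t) i) | i < q].

Definition permute w l (p : 'I_l -> 'I_l) (a : assignment w l) : assignment w l :=
  [tuple tnth a (p i) | i < l].

(* W_q, the set of u in <w>^q such that uv is in W for some v. *)
Definition prefixes w l q (W : {set assignment w l}) : {set q.-tuple 'I_w} :=
  [set u : q.-tuple 'I_w | [exists a in W, prefix u a]].

Record csp := Csp {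
  alph : nat -> nat;
  alph_gt0 : forall n, 0 < n -> 0 < alph n;
  len : nat -> nat;
  adm : forall n, {set assignment (alph n) (len n)};
  adm_sym : forall n (p : 'I_(len n) -> 'I_(len n)) a,
    injective p -> a \in adm n -> permute p a \in adm n;
  arity : nat -> nat;
  nrel : nat -> nat;
  rel : forall n, 'I_(nrel n) -> {set (arity n).-tuple 'I_(alph n)};
  rel_inj : forall n, injective (@rel n);
  rel_adm : forall n k, @rel n k \subset prefixes (arity n) (adm n) }.

Definition asg (S : csp) n := assignment (alph S n) (len S n).
Definition tup (S : csp) n := (arity S n).-tuple 'I_(alph S n).
Definition scopes (S : csp) n := scope (len S n) (arity S n).

Definition ctype (S : csp) n : {set {set tup S n}} :=
  [set rel k | k : 'I_(nrel S n)].

Definition constraint (S : csp) n := ('I_(nrel S n) * scopes S n)%type.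

(* An indexed family: the index j is what a hidden oracle reveals, and
   repetitions are allowed. *)
Definition instance (S : csp) n m := m.-tuple (constraint S n).

Definition sat1 (S : csp) n (c : constraint S n) (a : asg S n) : bool :=
  project a c.2 \in rel c.1.

Definition sat (S : csp) n m (C : instance S n m) (a : asg S n) : bool :=
  (a \in adm S n) && [forall j, sat1 (tnth C j) a].

(** * The operators E and union closure, and the dimension *)

Definition rel_at (S : csp) n (R : {set tup S n}) (t : scopes S n) :
    {set asg S n} :=
  [set a in adm S n | project a t \in R].

Definition rel_on (S : csp) n (R : {set tup S n}) (I : {set scopes S n}) :
    {set asg S n} :=
  \bigcup_(t in I) rel_at R t.

Definition E_type (S : csp) n : {set {set asg S n}} :=
  \bigcup_(R in ctype S n) [set rel_on R I | I : {set scopes S n}].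

Definition union_closure (T : finType) (RR : {set {set T}}) : {set {set T}} :=
  [set cover F | F in powerset RR].

Definition chain (T : finType) (F : {set {set T}}) : bool :=
  [forall A in F, forall B in F, (A \subset B) || (B \subset A)].

(* Number of members of a longest chain. *)
Definition dim (T : finType) (RR : {set {set T}}) : nat :=
  \max_(F : {set {set T}} | (F \subset RR) && chain F) #|F|.

Lemma E_type_adm (S : csp) n (X : {set asg S n}) :
  X \in E_type S n -> X \subset prefixes (len S n) (adm S n).
Proof.
case/bigcupP=> R _ /imsetP[I _ ->]; apply/bigcupsP => t _.
apply/subsetP => a; rewrite !inE => /andP[aW _].
by apply/existsP; exists a; rewrite aW prefix_refl.
Qed.

Lemma union_closure_sub (T : finType) (RR : {set {set T}}) (B : {set T}) X :
  (forall R, R \in RR -> R \subset B) -> X \in union_closure RR -> X \subset B.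
Proof.
move=> sB /imsetP[F]; rewrite powersetE => /subsetP sF ->.
by apply/bigcupsP => R /sF; apply: sB.
Qed.

Lemma rel_in_type (S : csp) n (R : {set tup S n}) :
  R \in ctype S n -> R \subset prefixes (arity S n) (adm S n).
Proof. by case/imsetP=> k _ ->; apply: rel_adm. Qed.

(* Only the set of relations matters for Ecsp S and Ucsp S; their numbering by
   enum_val is never shown to an algorithm (see the presentations below). *)
Definition Ecsp (S : csp) : csp :=
  @Csp (alph S) (@alph_gt0 S) (len S) (adm S) (@adm_sym S) (len S)
    (fun n => #|E_type S n|) (fun n => @enum_val _ (mem (E_type S n)))
    (fun n => @enum_val_inj _ (mem (E_type S n)))
    (fun n k => E_type_adm (enum_valP k)).

Definition Ucsp (S : csp) : csp :=
  @Csp (alph S) (@alph_gt0 S) (len S) (adm S) (@adm_sym S) (arity S)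
    (fun n => #|union_closure (ctype S n)|)
    (fun n => @enum_val _ (mem (union_closure (ctype S n))))
    (fun n => @enum_val_inj _ (mem (union_closure (ctype S n))))
    (fun n k => union_closure_sub (@rel_in_type S n) (enum_valP k)).

Lemma type_E (S : csp) n : ctype (Ecsp S) n = E_type S n.
Proof.
apply/setP => X; apply/imsetP/idP => [[k _ ->]|XE]; first exact: enum_valP.
by exists (enum_rank_in XE X); rewrite //= enum_rankK_in.
Qed.

Lemma type_U (S : csp) n : ctype (Ucsp S) n = union_closure (ctype S n).
Proof.
apply/setP => X; apply/imsetP/idP => [[k _ ->]|XU]; first exact: enum_valP.
by exists (enum_rank_in XU X); rewrite //= enum_rankK_in.
Qed.

(** * Machine model

   Unit-cost random access computation: while-programs with finitely many
   natural-number registers and arrays, additive arithmetic and oracle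
   queries.  Each elementary instruction, loop or branch test and query is
   one step. *)

Inductive prog :=
| Skip
| Const (x v : nat)                 (* x := v, a literal *)
| Add (x y z : nat)                 (* x := y + z *)
| Sub (x y z : nat)                 (* x := y - z, truncated *)
| Fetch (x a y : nat)                (* x := a[y] *)
| Store (a x y : nat)               (* a[x] := y *)
| Query (x a y : nat)               (* x := oracle answer to a[0..y-1] *)
| Seq (p1 p2 : prog)
| If (x : nat) (p1 p2 : prog)       (* p1 if x <> 0, else p2 *)
| While (x : nat) (p : prog).       (* while x <> 0 *)

Record state := State {
  reg : nat -> nat;
  arr : nat -> nat -> nat;
  hist : seq (seq nat) }.           (* past queries, most recent first *)

(* Answer to a query as a function of the past queries and the current one, so
   that the answer to a repeated query may change; None: query not allowed. *)
Definition oracle := seq (seq nat) -> seq nat -> option nat.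

Definition no_oracle : oracle := fun _ _ => None.

Definition set_reg (st : state) x v :=
  State (fun y => if y == x then v else reg st y) (arr st) (hist st).

Definition set_arr (st : state) a i v :=
  State (reg st)
    (fun b j => if (b == a) && (j == i) then v else arr st b j) (hist st).

Definition set_hist (st : state) h := State (reg st) (arr st) h.

Definition read (st : state) a l : seq nat := mkseq (arr st a) l.

(* exec O p st k st' : p halts from st in k steps, in state st'.  Execution is
   deterministic; a query which is not allowed has no successor. *)
Inductive exec (O : oracle) : prog -> state -> nat -> state -> Prop :=
| ExSkip st : exec O Skip st 1 st
| ExConst st x v : exec O (Const x v) st 1 (set_reg st x v)
| ExAdd st x y z :
    exec O (Add x y z) st 1 (set_reg st x (reg st y + reg st z))
| ExSub st x y z :
    exec O (Sub x y z) st 1 (set_reg st x (reg st y - reg st z))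
| ExFetch st x a y :
    exec O (Fetch x a y) st 1 (set_reg st x (arr st a (reg st y)))
| ExStore st a x y :
    exec O (Store a x y) st 1 (set_arr st a (reg st x) (reg st y))
| ExQuery st x a y v :
    O (hist st) (read st a (reg st y)) = Some v ->
    exec O (Query x a y) st 1
      (set_hist (set_reg st x v) (read st a (reg st y) :: hist st))
| ExSeq p1 p2 st k1 st1 k2 st2 :
    exec O p1 st k1 st1 -> exec O p2 st1 k2 st2 ->
    exec O (Seq p1 p2) st (k1 + k2) st2
| ExIfT x p1 p2 st k st' :
    reg st x != 0 -> exec O p1 st k st' -> exec O (If x p1 p2) st k.+1 st'
| ExIfF x p1 p2 st k st' :
    reg st x = 0 -> exec O p2 st k st' -> exec O (If x p1 p2) st k.+1 st'
| ExWhileF x p st : reg st x = 0 -> exec O (While x p) st 1 st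
| ExWhileT x p st k1 st1 k2 st2 :
    reg st x != 0 -> exec O p st k1 st1 -> exec O (While x p) st1 k2 st2 ->
    exec O (While x p) st (k1 + k2).+1 st2.

(* The input occupies an initial segment of array 0.  The registers and all
   other cells are uninitialised: their initial contents are arbitrary. *)
Definition initial (x : seq nat) (st : state) : Prop :=
  read st 0 (size x) = x /\ hist st = [::].

(* Running time counts one unit for each input word, plus the steps. *)
Definition runs_in (O : oracle) (p : prog) (x : seq nat) (t : nat)
    (post : state -> Prop) : Prop :=
  forall st, initial x st ->
    exists k st', [/\ exec O p st k st', size x + k <= t & post st'].

(** * Presentation of instances to algorithms *)

Definition word w l (a : l.-tuple 'I_w) : seq nat := [seq val i | i <- a].

(* header n: the numerical parameters at size n.  names k x: the word x is
   one of the words denoting the k-th relation. *)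
Record presentation (S : csp) := Presentation {
  header : nat -> seq nat;
  names : forall n, 'I_(nrel S n) -> seq nat -> Prop }.

Definition std_header (S : csp) n : seq nat :=
  [:: n; alph S n; len S n; arity S n; nrel S n].

Definition std_pres (S : csp) : presentation S :=
  Presentation (std_header S) (fun n k x => x = [:: val k]).

(* A relation of Ucsp (Ecsp S) is a union of relations R_k^(t).  It is denoted by any
   duplicate-free list of pairs (k, t) with that union, preceded by the length
   of the list.  The header consists of the parameters of S. *)
Definition basics (S : csp) n := seq ('I_(nrel S n) * scopes S n).

Definition basics_word (S : csp) n (l : basics S n) : seq nat :=
  size l :: flatten [seq val kt.1 :: word (val kt.2) | kt <- l].

Definition basics_union (S : csp) n (l : basics S n) : {set asg S n} :=
  \bigcup_(kt <- l) rel_at (rel kt.1) kt.2.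

Definition UE_pres (S : csp) : presentation (Ucsp (Ecsp S)) :=
  @Presentation (Ucsp (Ecsp S)) (std_header S)
    (fun n (k : 'I_(nrel (Ucsp (Ecsp S)) n)) x =>
       exists l : basics S n,
         [/\ uniq l, basics_union l = rel k & x = basics_word l]).

Definition presents (S : csp) (P : presentation S) n m (C : instance S n m)
    (x : seq nat) : Prop :=
  exists2 ws : 'I_m -> seq nat,
    forall j, names P (tnth C j).1 (ws j) &
    x = header P n ++ m ::
        flatten [seq ws j ++ word (val (tnth C j).2) | j <- enum 'I_m].

(** * Complexity *)

(* comp n k bounds the time of one algorithm, uniform in n and k, deciding
   membership in the k-th relation. *)
Definition decidable_in (S : csp) (P : presentation S)
    (comp : forall n, 'I_(nrel S n) -> nat) : Prop :=
  exists p : prog, forall n (k : 'I_(nrel S n)) x (u : tup S n),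
    0 < n -> names P k x ->
    runs_in no_oracle p (header P n ++ x ++ word u) (comp n k)
      (fun st => (reg st 0 != 0) = (u \in rel k)).

Definition max_comp (S : csp) (comp : forall n, 'I_(nrel S n) -> nat) n : nat :=
  \max_(k < nrel S n) comp n k.

(* Register 0 is 0 for the answer "no", and 1 if array 1 holds a solution. *)
Definition solved (S : csp) n m (C : instance S n m) (st : state) : Prop :=
  (reg st 0 = 0 /\ forall a, ~~ sat C a) \/
  (reg st 0 = 1 /\ exists2 a, sat C a & read st 1 (len S n) = word a).

Definition positive (T : nat -> nat -> nat) : Prop :=
  forall n m, 0 < n -> 0 < m -> 0 < T n m.

(* Positivity of the bound only matters for hidden problems with no instance
   at some size (no relation, or arity exceeding the number of variables). *)
Definition solvable (S : csp) (P : presentation S) (T : nat -> nat -> nat) :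
    Prop :=
  positive T /\ exists p : prog, forall n m (C : instance S n m) x,
    0 < n -> 0 < m -> presents P C x ->
    runs_in no_oracle p x (T n m) (solved C).

(* Answer 0 is "yes"; answer j.+1 names a violated constraint, the constraints
   being numbered from j = 0.  Only admissible assignments may be queried. *)
Definition revealing (S : csp) n m (C : instance S n m) (O : oracle) : Prop :=
  (forall h (a : asg S n), a \in adm S n ->
     if sat C a then O h (word a) = Some 0
     else exists2 j : 'I_m, ~~ sat1 (tnth C j) a & O h (word a) = Some j.+1) /\
  (forall h x, (forall a, a \in adm S n -> x <> word a) -> O h x = None).

(* H(S) with the oracle revealing only the index of a violated constraint. *)
Definition hidden_solvable (S : csp) (T : nat -> nat -> nat) : Prop :=
  positive T /\ exists p : prog, forall n m (C : instance S n m) (O : oracle),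
    0 < n -> 0 < m -> revealing C O ->
    runs_in O p (std_header S n ++ [:: m]) (T n m) (solved C).

Definition bigO (f g : nat -> nat -> nat) : Prop :=
  exists c, forall n m, 0 < n -> 0 < m -> f n m <= c * g n m.

Definition solvable_O (S : csp) (P : presentation S) g : Prop :=
  exists2 f, bigO f g & solvable P f.

Definition hidden_solvable_O (S : csp) g : Prop :=
  exists2 f, bigO f g & hidden_solvable S f.

(* Main.v *)
(* (a) For every constraint C_j keep a list of the pairs (k, t) it may still be;
   initially all of them.  Solve the instance of the union problem whose j-th
   relation is the union of the R_k^(t) on the j-th list.  If it has no solution,
   neither has the hidden instance.  Otherwise query the solution a: if C_j is
   returned as violated, delete from the j-th list every pair satisfied by a, so
   that the j-th union strictly shrinks.  Along a chain each union can shrink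
   less than dim times.
   (b) Simulate the hidden solver.  A query a is answered by the first relation of
   the given instance C that a violates.  If a satisfies C, it is recorded, and
   the answer comes from the hidden instance H formed by the first pair of every
   list.  The solver thus runs on H, within its time bound.  If no solution of C
   was ever queried, the answers are equally those of any other hidden instance H'
   with one pair from each list; so if the solver reports "no", no such H' has a
   solution, hence neither has C.

   Programs use registers and arrays below 40 for themselves: 1 and 2 are scratch,
   registers 3 to 8 hold n, w, l, q, s, m, register 9 holds q + 1.  The cells of
   the given solver and decider are moved to the even and odd numbers from 40 on,
   so that 40 (resp. 41) is both the input array and the answer register of the
   solver (resp. the decider), and 42 is the array of the solver's solution. *)
Require Import Defs.
From mathcomp Require Import all_boot.
From mathcomp Require Import zify.zify_ssreflect.
Set Implicit Arguments.
Unset Strict Implicit.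
Unset Printing Implicit Defensive.

(** * Executions within a step budget *)

Definition wp (O : oracle) p st c (Q : state -> Prop) :=
  exists k st', [/\ exec O p st k st', k <= c & Q st'].

Lemma wp_mono O p st c c' (Q Q' : state -> Prop) :
  wp O p st c Q -> c <= c' -> (forall st', Q st' -> Q' st') -> wp O p st c' Q'.
Proof.
move=> [k [st' [ex le_k q]]] le_c qq'; exists k, st'; split=> //; last exact: qq'.
exact: leq_trans le_c.
Qed.

Lemma wp_seq O p1 p2 st c1 c2 c Q :
  wp O p1 st c1 (fun st1 => wp O p2 st1 c2 Q) -> c1 + c2 <= c ->
  wp O (Seq p1 p2) st c Q.
Proof.
move=> [k1 [st1 [ex1 le1 [k2 [st2 [ex2 le2 q]]]]]] le_c.
exists (k1 + k2), st2; split=> //; first exact: ExSeq ex1 ex2.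
exact: leq_trans (leq_add le1 le2) le_c.
Qed.

Lemma wp_if O x p1 p2 st c (Q : state -> Prop) :
  (reg st x != 0 -> wp O p1 st c Q) -> (reg st x = 0 -> wp O p2 st c Q) ->
  wp O (If x p1 p2) st c.+1 Q.
Proof.
move=> h1 h2; have [x0|x0] := eqVneq (reg st x) 0.
  have [k [st' [ex le_k q]]] := h2 x0; exists k.+1, st'; split=> //.
  exact: ExIfF.
have [k [st' [ex le_k q]]] := h1 x0; exists k.+1, st'; split=> //.
exact: ExIfT.
Qed.

(** * Straight-line code, frames and loops *)

Fixpoint straight p :=
  match p with
  | Query _ _ _ | If _ _ _ | While _ _ => false
  | Seq p1 p2 => straight p1 && straight p2
  | _ => true
  end.

Fixpoint steps p := if p is Seq p1 p2 then steps p1 + steps p2 else 1.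

Fixpoint step p st :=
  match p with
  | Const x v => set_reg st x v
  | Add x y z => set_reg st x (reg st y + reg st z)
  | Defs.Sub x y z => set_reg st x (reg st y - reg st z)
  | Fetch x a y => set_reg st x (arr st a (reg st y))
  | Store a x y => set_arr st a (reg st x) (reg st y)
  | Seq p1 p2 => step p2 (step p1 st)
  | _ => st
  end.

Lemma exec_straight O p st : straight p -> exec O p st (steps p) (step p st).
Proof.
elim: p st => //=; try by move=> *; constructor.
by move=> p1 h1 p2 h2 st /andP[l1 l2]; apply: ExSeq (h1 _ l1) (h2 _ l2).
Qed.

(** Such code is run by computation: [step] reduces to nested updates, on which postconditions are
    settled by simplification. *)
Lemma wp_straight O p st c (Q : state -> Prop) :
  straight p -> steps p <= c -> Q (step p st) -> wp O p st c Q.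
Proof. by move=> lp le_c q; exists (steps p), (step p st); split=> //; apply: exec_straight. Qed.

Definition same (R B : pred nat) st st' :=
  [/\ forall r, ~~ R r -> reg st' r = reg st r,
      forall b, ~~ B b -> forall i, arr st' b i = arr st b i &
      hist st' = hist st].

Lemma same_trans R B st1 st2 st3 :
  same R B st1 st2 -> same R B st2 st3 -> same R B st1 st3.
Proof.
move=> [r1 a1 h1] [r2 a2 h2]; split=> [r nr | b nb i |].
- by rewrite r2 // r1.
- by rewrite a2 // a1.
- by rewrite h2.
Qed.

Lemma same_sub (R B R' B' : pred nat) st st' :
  same R B st st' -> subpred R R' -> subpred B B' -> same R' B' st st'.
Proof.
move=> [r a h] sR sB; split=> // [x nx | b nb].
  by apply: r; apply: contra nx => /sR.
by apply: a; apply: contra nb => /sB.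
Qed.

Fixpoint query_free p :=
  match p with
  | Query _ _ _ => false
  | If _ p1 p2 | Seq p1 p2 => query_free p1 && query_free p2
  | While _ p1 => query_free p1
  | _ => true
  end.

Fixpoint writes_reg p r :=
  match p with
  | Const x _ | Add x _ _ | Defs.Sub x _ _ | Fetch x _ _ | Query x _ _ => r == x
  | If _ p1 p2 | Seq p1 p2 => writes_reg p1 r || writes_reg p2 r
  | While _ p1 => writes_reg p1 r
  | _ => false
  end.

Fixpoint writes_arr p b :=
  match p with
  | Store a _ _ => b == a
  | If _ p1 p2 | Seq p1 p2 => writes_arr p1 b || writes_arr p2 b
  | While _ p1 => writes_arr p1 b
  | _ => false
  end.

Lemma same_reg R B st st' r : same R B st st' -> ~~ R r -> reg st' r = reg st r.
Proof. by case=> h _ _; apply: h. Qed.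

Lemma same_arr R B st st' b i :
  same R B st st' -> ~~ B b -> arr st' b i = arr st b i.
Proof. by case=> _ h _ nb; apply: h. Qed.

(** The frame is read off the syntax, so a specification does not have to list what it preserves:
    that a cell is untouched is decided by evaluating [writes_reg] and [writes_arr]. *)
Lemma exec_same O p st k st' :
  query_free p -> exec O p st k st' -> same (writes_reg p) (writes_arr p) st st'.
Proof.
move=> nq ex; elim: ex nq => {p st k st'} //=.
- by move=> st x v _; split=> //= r /negbTE ->.
- by move=> st x y z _; split=> //= r /negbTE ->.
- by move=> st x y z _; split=> //= r /negbTE ->.
- by move=> st x a y _; split=> //= r /negbTE ->.
- by move=> st a x y _; split=> //= b /negbTE ->.
- move=> p1 p2 st k1 st1 k2 st2 _ h1 _ h2 /andP[/h1 s1 /h2 s2].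
  by apply: same_trans (same_sub s1 _ _) (same_sub s2 _ _) => x /= ->; rewrite ?orbT.
- move=> x p1 p2 st k st' _ _ h /andP[/h s _].
  by apply: same_sub s _ _ => y /= ->.
- move=> x p1 p2 st k st' _ _ h /andP[_ /h s].
  by apply: same_sub s _ _ => y /= ->; rewrite orbT.
- by move=> x p st k1 st1 k2 st2 _ _ h1 _ h2 nq; apply: same_trans (h1 nq) (h2 nq).
Qed.

Lemma wp_seqf O p1 p2 st c1 c2 c (Q1 Q : state -> Prop) :
  query_free p1 -> wp O p1 st c1 Q1 ->
  (forall st1, same (writes_reg p1) (writes_arr p1) st st1 -> Q1 st1 -> wp O p2 st1 c2 Q) ->
  c1 + c2 <= c -> wp O (Seq p1 p2) st c Q.
Proof.
move=> nq [k1 [st1 [ex1 le1 q1]]] h; apply: wp_seq.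
by exists k1, st1; split=> //; apply: h q1; apply: exec_same ex1.
Qed.

(** Register [r] counts down over the entries of [xs], and the invariant sees the processed and the
    remaining entries, so that the cost may vary from entry to entry. The successor of each cost
    pays for the loop test, the strict inequality for the last, failing test. *)
Lemma wp_loop O (A : Type) r body (cost : A -> nat)
    (Inv : seq A -> seq A -> state -> Prop) xs st c (Q : state -> Prop) :
  query_free body ->
  (forall done todo st, Inv done todo st -> reg st r = size todo) ->
  (forall done x todo st1, done ++ x :: todo = xs ->
     same (writes_reg body) (writes_arr body) st st1 -> Inv done (x :: todo) st1 ->
     wp O body st1 (cost x) (Inv (rcons done x) todo)) ->
  Inv [::] xs st -> \sum_(x <- xs) (cost x).+1 < c ->
  (forall st', same (writes_reg body) (writes_arr body) st st' -> Inv xs [::] st' -> Q st') ->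
  wp O (While r body) st c Q.
Proof.
move=> nq hr hb inv lec post.
suff gen todo : forall done st1, done ++ todo = xs ->
    same (writes_reg body) (writes_arr body) st st1 -> Inv done todo st1 ->
    wp O (While r body) st1 (\sum_(x <- todo) (cost x).+1).+1
      (fun st' => same (writes_reg body) (writes_arr body) st st' /\ Inv xs [::] st').
  by apply: wp_mono (gen xs [::] st _ _ _) lec _ => // st' [? ?]; apply: post.
elim: todo => [|x todo IH] done st1 eq_xs sm inv1.
  exists 1, st1; rewrite big_nil; split=> //.
    by apply: ExWhileF; rewrite (hr _ _ _ inv1).
  by rewrite -eq_xs cats0.
have [k1 [st2 [ex1 le1 inv2]]] := hb _ _ _ _ eq_xs sm inv1.
have [||k2 [st3 [ex2 le2 q]]] := IH _ _ _ _ inv2; first by rewrite cat_rcons.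
  by apply: same_trans sm (exec_same nq ex1).
exists (k1 + k2).+1, st3; split=> //.
  by apply: ExWhileT ex1 ex2; rewrite (hr _ _ _ inv1).
by rewrite big_cons ltnS addSn -addnS leq_add.
Qed.

(** * Words stored in arrays *)

Definition holds st A o (xs : seq nat) :=
  forall i, i < size xs -> arr st A (o + i) = nth 0 xs i.

Lemma holds_read st A xs : holds st A 0 xs <-> read st A (size xs) = xs.
Proof.
split=> [h | <-]; last by move=> i; rewrite size_mkseq => lti; rewrite nth_mkseq.
apply: (@eq_from_nth _ 0); rewrite size_mkseq // => i lti.
by rewrite nth_mkseq // -[i in LHS]add0n h.
Qed.

Lemma holds_cat st A o xs ys :
  holds st A o (xs ++ ys) <-> holds st A o xs /\ holds st A (o + size xs) ys.
Proof.
split=> [h | [h1 h2] i].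
  split=> i lti; first by rewrite h ?nth_cat ?lti // size_cat ltn_addr.
  rewrite -addnA h ?nth_cat ?size_cat ?ltn_add2l //.
  by rewrite ltnNge leq_addr addKn.
rewrite size_cat nth_cat; case: (ltnP i (size xs)) => [lti _ | le_i lti]; first by rewrite h1.
by rewrite -h2 -?addnA ?subnKC // ltn_subLR.
Qed.

Lemma holds_cons st A o x xs :
  holds st A o (x :: xs) <-> arr st A o = x /\ holds st A o.+1 xs.
Proof.
rewrite -cat1s holds_cat addn1; split=> -[h1 h2]; split=> //.
  by have := h1 0 isT; rewrite addn0.
by case=> // _; rewrite addn0.
Qed.

Lemma holds_ext st st' A o xs :
  (forall i, arr st' A i = arr st A i) -> holds st A o xs -> holds st' A o xs.
Proof. by move=> e h i lti; rewrite e h. Qed.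

(** An output buffer: [w] is the next free cell of [B]. The cells from there on are unconstrained,
    so setting [w] to 0 empties the buffer. *)
Definition out st B w ys := reg st w = size ys /\ holds st B 0 ys.

Definition Inc r := Seq (Const 1 1) (Add r r 1).
Definition Dec r := Seq (Const 1 1) (Defs.Sub r r 1).
Definition Mov x y := Seq (Const 1 0) (Add x y 1).

Notation "p1 ;; p2" := (Seq p1 p2) (at level 60, right associativity).

Definition Copy A p B w r :=
  While r (Fetch 1 A p ;; Store B w 1 ;; Inc p ;; Inc w ;; Dec r).

Lemma sum_const_cost (A : Type) (xs : seq A) c : \sum_(x <- xs) c = size xs * c.
Proof. by rewrite big_const_seq count_predT iter_addn_0 mulnC. Qed.

Lemma out_push st st' B w ys x :
  out st B w ys -> reg st' w = (reg st w).+1 ->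
  (forall i, arr st' B i = if i == reg st w then x else arr st B i) ->
  out st' B w (rcons ys x).
Proof.
move=> [ew h] ew' ea; split; first by rewrite size_rcons ew' ew.
move=> i; rewrite size_rcons ltnS nth_rcons ea ew add0n leq_eqVlt => /orP[/eqP ->|lti].
  by rewrite eqxx ltnn.
by rewrite lti (ltn_eqF lti) -h.
Qed.

Lemma copy_spec O st (A p B w r : nat) xs ys :
  uniq [:: 1; p; w; r] -> A != B -> reg st r = size xs ->
  holds st A (reg st p) xs -> out st B w ys ->
  wp O (Copy A p B w r) st (9 * size xs).+1 (fun st' =>
    [/\ reg st' p = reg st p + size xs, reg st' r = 0 &
        out st' B w (ys ++ xs)]).
Proof.
rewrite /= !inE !negb_or -!andbA => /and5P[n1p n1w n1r npw /andP[npr /andP[nwr _]]] nAB er hx oy.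
have e := (negbTE n1p, negbTE n1w, negbTE n1r, negbTE npw, negbTE npr, negbTE nwr).
have e1 : ((p == 1) = false) * ((w == 1) = false) * ((r == 1) = false) *
   ((w == p) = false) * ((r == p) = false) * ((r == w) = false) * ((A == B) = false).
  by rewrite (eq_sym p 1) (eq_sym w 1) (eq_sym r 1) (eq_sym w p) (eq_sym r p) (eq_sym r w) !e
    (negbTE nAB).
pose Inv (done todo : seq nat) st' := [/\ reg st' p = reg st p + size done,
  reg st' r = size todo & out st' B w (ys ++ done)].
apply: (wp_loop (xs := xs) (Inv := Inv) (cost := fun=> 8)) => //.
- by move=> ? ? ? [].
- move=> done x todo st1 eq_xs sm [ep er1 o1].
  apply: wp_straight => //.
  have ex : arr st1 A (reg st1 p) = x.
    rewrite (same_arr _ sm) /= ?e1 ?orbF // ep hx -eq_xs ?nth_cat ?ltnn ?subnn //.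
    by rewrite size_cat /= -addSnnS leq_addr.
  split; rewrite /= !(e, e1, eqxx) /=.
  + by rewrite ep size_rcons; lia.
  + by rewrite er1 subn1.
  + rewrite -rcons_cat; apply: out_push o1 _ _; rewrite /= !(e, e1, eqxx) /= ?addn1 //.
    by move=> i; rewrite ex.
- by split; rewrite ?addn0 ?cats0.
by rewrite sum_const_cost; lia.
Qed.

(** One indirection more than [Copy]: with a scope in [A] and an assignment in [G], it writes the
    projection of the assignment to the scope. *)
Definition Gather A p G B w r :=
  While r (Fetch 1 A p ;; Fetch 1 G 1 ;; Store B w 1 ;; Inc p ;; Inc w ;; Dec r).

Lemma gather_spec O st (A p G B w r : nat) xs ys :
  uniq [:: 1; p; w; r] -> A != B -> G != B -> reg st r = size xs ->
  holds st A (reg st p) xs -> out st B w ys ->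
  wp O (Gather A p G B w r) st (10 * size xs).+1 (fun st' =>
    [/\ reg st' p = reg st p + size xs, reg st' r = 0 &
        out st' B w (ys ++ [seq arr st G i | i <- xs])]).
Proof.
rewrite /= !inE !negb_or -!andbA => /and5P[n1p n1w n1r npw /andP[npr /andP[nwr _]]] nAB nGB er hx
  oy.
have e := (negbTE n1p, negbTE n1w, negbTE n1r, negbTE npw, negbTE npr, negbTE nwr).
have e1 : ((p == 1) = false) * ((w == 1) = false) * ((r == 1) = false) *
   ((w == p) = false) * ((r == p) = false) * ((r == w) = false) * ((A == B) = false).
  by rewrite (eq_sym p 1) (eq_sym w 1) (eq_sym r 1) (eq_sym w p) (eq_sym r p) (eq_sym r w) !e
    (negbTE nAB).
pose Inv (done todo : seq nat) st' := [/\ reg st' p = reg st p + size done,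
  reg st' r = size todo & out st' B w (ys ++ [seq arr st G i | i <- done])].
apply: (wp_loop (xs := xs) (Inv := Inv) (cost := fun=> 9)) => //.
- by move=> ? ? ? [].
- move=> done x todo st1 eq_xs sm [ep er1 o1].
  apply: wp_straight => //.
  have ex : arr st1 G (arr st1 A (reg st1 p)) = arr st G x.
    rewrite (same_arr _ sm) /= ?(negbTE nGB) ?orbF //; congr (arr _ _ _).
    rewrite (same_arr _ sm) /= ?e1 ?orbF // ep hx -eq_xs ?nth_cat ?ltnn ?subnn //.
    by rewrite size_cat /= -addSnnS leq_addr.
  split; rewrite /= !(e, e1, eqxx) /=.
  + by rewrite ep size_rcons; lia.
  + by rewrite er1 subn1.
  + rewrite map_rcons -rcons_cat; apply: out_push o1 _ _; rewrite /= !(e, e1, eqxx) /= ?addn1 //.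
    by move=> i; rewrite ex.
- by split; rewrite ?addn0 ?cats0.
by rewrite sum_const_cost; lia.
Qed.

(* Cells are moved by f, and the query instruction is replaced by the code Qp. *)
Fixpoint translate (Qp : nat -> nat -> nat -> prog) (f : nat -> nat) p :=
  match p with
  | Skip => Skip
  | Const x v => Const (f x) v
  | Add x y z => Add (f x) (f y) (f z)
  | Defs.Sub x y z => Defs.Sub (f x) (f y) (f z)
  | Fetch x a y => Fetch (f x) (f a) (f y)
  | Store a x y => Store (f a) (f x) (f y)
  | Query x a y => Qp (f x) (f a) (f y)
  | Seq p1 p2 => Seq (translate Qp f p1) (translate Qp f p2)
  | If x p1 p2 => If (f x) (translate Qp f p1) (translate Qp f p2)
  | While x p => While (f x) (translate Qp f p)
  end.

Definition agree (f : nat -> nat) st s :=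
  (forall r, reg st (f r) = reg s r) /\
  (forall b i, arr st (f b) i = arr s b i).

(** The history of the simulated run is a ghost value: the host does not store it, and [sim_inv]
    ties it to host cells outside the range of [f], which elementary instructions leave alone. Every
    simulated step is charged [cq], the cost of a query, which yields the product [k * cq]. *)
Lemma wp_translate O O' f Qp (sim_inv : seq (seq nat) -> state -> Prop) cq p s k s' :
  injective f -> 0 < cq ->
  (forall h st st', sim_inv h st -> (forall r, (forall x, r <> f x) -> reg st' r = reg st r) ->
     (forall b, (forall x, b <> f x) -> forall i, arr st' b i = arr st b i) ->
     hist st' = hist st -> sim_inv h st') ->
  (forall x a y h st v, sim_inv h st -> O' h (read st (f a) (reg st (f y))) = Some v ->
     wp O (Qp (f x) (f a) (f y)) st cq (fun st' =>
       [/\ sim_inv (read st (f a) (reg st (f y)) :: h) st', reg st' (f x) = v,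
           forall r, r <> x -> reg st' (f r) = reg st (f r) &
           forall b i, arr st' (f b) i = arr st (f b) i])) ->
  exec O' p s k s' -> forall st, agree f st s -> sim_inv (hist s) st ->
  wp O (translate Qp f p) st (k * cq) (fun st' => agree f st' s' /\ sim_inv (hist s') st').
Proof.
move=> injf cq0 Jst Jq; elim=> {p s k s'} /=.
- move=> s st ag j; exists 1, st; split=> //; first exact: ExSkip.
  by rewrite mul1n.
- move=> s x v st [ar aa] j; apply: wp_straight => //=; first by rewrite mul1n.
  split; first by split=> //= r; rewrite (inj_eq injf) ar.
  by apply: Jst j _ _ _ => //= r /(_ x) /eqP/negbTE ->.
- move=> s x y z st [ar aa] j; apply: wp_straight => //=; first by rewrite mul1n.
  split; first by split=> //= r; rewrite (inj_eq injf) !ar.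
  by apply: Jst j _ _ _ => //= r /(_ x) /eqP/negbTE ->.
- move=> s x y z st [ar aa] j; apply: wp_straight => //=; first by rewrite mul1n.
  split; first by split=> //= r; rewrite (inj_eq injf) !ar.
  by apply: Jst j _ _ _ => //= r /(_ x) /eqP/negbTE ->.
- move=> s x a y st [ar aa] j; apply: wp_straight => //=; first by rewrite mul1n.
  split; first by split=> //= r; rewrite (inj_eq injf) !ar aa.
  by apply: Jst j _ _ _ => //= r /(_ x) /eqP/negbTE ->.
- move=> s a x y st [ar aa] j; apply: wp_straight => //=; first by rewrite mul1n.
  split; first by split=> //= b i; rewrite (inj_eq injf) !ar aa.
  by apply: Jst j _ _ _ => //= b /(_ a) /eqP/negbTE ->.
- move=> s x a y v hO st [ar aa] j; rewrite mul1n.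
  have er : read st (f a) (reg st (f y)) = read s a (reg s y).
    by rewrite ar; apply: eq_mkseq => i; rewrite aa.
  rewrite -er in hO *; apply: wp_mono (Jq _ _ _ _ _ _ j hO) _ _ => //.
  move=> st' [j' ex eo ea]; split=> //; split=> [r | b i] /=; last by rewrite ea.
  by case: eqP => [-> // | nr]; rewrite eo.
- move=> p1 p2 s k1 s1 k2 s2 _ h1 _ h2 st ag j; rewrite mulnDl.
  apply: wp_seq (leqnn _); apply: wp_mono (h1 _ ag j) _ _ => // st1 [ag1 j1].
  exact: h2.
- move=> x p1 p2 s k s' x0 _ h st ag j.
  have [k1 [st1 [ex le1 q]]] := h _ ag j; exists k1.+1, st1; split=> //.
    by apply: ExIfT ex; rewrite ag.1.
  by rewrite mulSn -addn1 addnC leq_add.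
- move=> x p1 p2 s k s' x0 _ h st ag j.
  have [k1 [st1 [ex le1 q]]] := h _ ag j; exists k1.+1, st1; split=> //.
    by apply: ExIfF ex; rewrite ag.1.
  by rewrite mulSn -addn1 addnC leq_add.
- move=> x p s x0 st ag j; exists 1, st; split; rewrite ?mul1n //.
  by apply: ExWhileF; rewrite ag.1.
- move=> x p s k1 s1 k2 s2 x0 _ h1 _ h2 st ag j.
  have [k3 [st1 [ex1 le1 [ag1 j1]]]] := h1 _ ag j.
  have [k4 [st2 [ex2 le2 q]]] := h2 _ ag1 j1.
  exists (k3 + k4).+1, st2; split=> //; first by apply: ExWhileT ex1 ex2; rewrite ag.1.
  by rewrite mulSn mulnDl -addn1 addnC leq_add // leq_add.
Qed.

(** A halting run under [no_oracle] executes no query, so the [Skip] put in place of a query is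
    never reached. *)
Definition relocate := translate (fun _ _ _ => Skip).

Lemma query_free_relocate f p : query_free (relocate f p).
Proof. by elim: p => //= [p1 -> p2 -> | _ p1 -> p2 ->]. Qed.

Lemma writes_reg_relocate f p r : writes_reg (relocate f p) r -> exists x, r = f x.
Proof.
elim: p => //=; try by [move=> x *; exists x; apply/eqP; eassumption].
- by move=> p1 h1 p2 h2 /orP[].
- by move=> _ p1 h1 p2 h2 /orP[].
Qed.

Lemma writes_arr_relocate f p r : writes_arr (relocate f p) r -> exists x, r = f x.
Proof.
elim: p => //=; try by [move=> x *; exists x; apply/eqP; eassumption].
- by move=> p1 h1 p2 h2 /orP[].
- by move=> _ p1 h1 p2 h2 /orP[].
Qed.

(** [runs_in] allows arbitrary contents outside the input, so the moved program can be called again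
    and again without clearing its cells. *)
Lemma call_spec O f p x t (post : state -> Prop) st :
  injective f -> runs_in no_oracle p x t post -> holds st (f 0) 0 x ->
  wp O (relocate f p) st t (fun st' => exists2 s, agree f st' s & post s).
Proof.
move=> injf run hx.
pose s := State (fun r => reg st (f r)) (fun b i => arr st (f b) i) [::].
have [|k [s' [ex lek q]]] := run s; first by split=> //; apply/holds_read.
have ag : agree f st s by [].
have := @wp_translate O no_oracle f (fun _ _ _ => Skip) (fun _ _ => True) 1 p s k s' injf isT
  _ _ ex st ag I.
move=> h; apply: wp_mono (h _ _) _ _ => //; last by move=> st' [? _]; exists s'.
by rewrite muln1; lia.
Qed.

(** * Listing all pairs (k, t) *)

Lemma iota_split n done x todo : done ++ x :: todo = iota 0 n -> x = size done.
Proof.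
move=> e; have lt : size done < n.
  by rewrite -(size_iota 0 n) -e size_cat /= -addSnnS leq_addr.
have := congr1 (fun s => nth 0 s (size done)) e.
by rewrite nth_cat ltnn subnn nth_iota.
Qed.

(** Array 12 is the characteristic vector of the variables in the current word. It reduces the test
    whether a candidate already occurs to one fetch. *)
Definition ZeroMarks :=
  (Const 20 0 ;; Mov 21 5) ;;
  While 21 (Const 1 0 ;; Store 12 20 1 ;; Inc 20 ;; Dec 21).

Definition SetMarks :=
  ((Mov 22 11 ;; Inc 22) ;; (Const 1 1 ;; Defs.Sub 21 15 1)) ;;
  While 21 (Fetch 1 10 22 ;; Const 2 1 ;; Store 12 1 2 ;; Inc 22 ;; Dec 21).

Lemma zero_marks_spec O st l : reg st 5 = l ->
  wp O ZeroMarks st (10 * l + 10) (fun st' => forall v, v < l -> arr st' 12 v = 0).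
Proof.
move=> el; apply: (@wp_seqf _ _ _ _ 3 (7 * l + 1) _ (fun st1 => reg st1 20 = 0 /\ reg st1 21 =
  l)) => //.
- by apply: wp_straight => //=; rewrite addn0.
- move=> st1 sm [e20 e21].
  pose Inv (done todo : seq nat) st' := [/\ reg st' 20 = size done,
    reg st' 21 = size todo & forall v, v < size done -> arr st' 12 v = 0].
  apply: (wp_loop (xs := iota 0 l) (Inv := Inv) (cost := fun=> 6)) => //.
  + by move=> ? ? ? [].
  + move=> done x todo st2 eq_xs sm2 [e20' e21' h].
    apply: wp_straight => //=; split; rewrite /= ?size_rcons ?e20' ?e21' //= ?addn1 ?subn1 //.
    by move=> v; rewrite ltnS leq_eqVlt; case: eqP => //= _; apply: h.
  + by split; rewrite ?size_iota.
  + by rewrite sum_const_cost size_iota; lia.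
  by move=> st' _ [_ _]; rewrite size_iota.
by lia.
Qed.

Lemma set_marks_spec O st l k ts :
  holds st 10 (reg st 11) (k :: ts) -> reg st 15 = (size ts).+1 ->
  all (fun v => v < l) ts -> (forall v, v < l -> arr st 12 v = 0) ->
  wp O SetMarks st (8 * size ts + 10)
    (fun st' => forall v, v < l -> arr st' 12 v = (v \in ts)).
Proof.
move=> /holds_cons[_ hw] e15 lt_ts hz.
apply: (@wp_seqf _ _ _ _ 6 (8 * size ts + 1) _ (fun st1 =>
  reg st1 22 = (reg st 11).+1 /\ reg st1 21 = size ts)) => //.
- by apply: wp_straight => //=; rewrite e15 subn1 addn0 addn1.
- move=> st1 sm [e22 e21].
  pose Inv (done todo : seq nat) st' := [/\ reg st' 22 = (reg st 11).+1 + size done,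
    reg st' 21 = size todo & forall v, v < l -> arr st' 12 v = (v \in done)].
  apply: (wp_loop (xs := ts) (Inv := Inv) (cost := fun=> 7)) => //.
  + by move=> ? ? ? [].
  + move=> done x todo st2 eq_xs sm2 [e22' e21' h].
    have ex : arr st2 10 (reg st2 22) = x.
      rewrite (same_arr _ sm2) // (same_arr _ sm) // e22' hw -eq_xs ?nth_cat ?ltnn ?subnn //.
      by rewrite size_cat /= -addSnnS leq_addr.
    apply: wp_straight => //=; rewrite /= ex.
    split; rewrite /= ?e22' ?e21' ?size_rcons ?subn1 ?addn1 ?addnS //.
    by move=> v lv; rewrite mem_rcons inE; case: eqP => //= _; apply: h.
  + by split; rewrite ?addn0 // => v lv; rewrite (same_arr _ sm) // hz.
  + by rewrite sum_const_cost; lia.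
  by move=> st' _ [].
by lia.
Qed.

Definition Scan :=
  (Const 20 0 ;; Mov 21 5) ;;
  While 21
    (Fetch 2 12 20 ;;
     (If 2 Skip
       ((Mov 22 11 ;; Mov 23 15) ;;
        (Copy 10 22 11 17 23 ;; (Store 11 17 20 ;; Inc 17 ;; Inc 18))) ;;
      (Inc 20 ;; Dec 21))).

(** A rejected candidate costs a constant; copying [word] is charged only to the words produced. *)
Lemma scan_spec O st l word (mk : nat -> bool) ys c :
  reg st 5 = l -> holds st 10 (reg st 11) word -> reg st 15 = size word ->
  (forall v, v < l -> arr st 12 v = mk v) -> out st 11 17 ys -> reg st 18 = c ->
  let new := [seq rcons word v | v <- iota 0 l & ~~ mk v] in
  wp O Scan st (10 * l + 10 + size new * (9 * size word + 20)) (fun st' =>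
    out st' 11 17 (ys ++ flatten new) /\ reg st' 18 = c + size new).
Proof.
move=> el hw e15 hm oy ec new.
pose new' done := [seq rcons word v | v <- done & ~~ mk v].
apply: (@wp_seqf _ _ _ _ 3 (10 * l + 1 + size new * (9 * size word + 20)) _ (fun st1 =>
   [/\ reg st1 20 = 0, reg st1 21 = l & out st1 11 17 ys])) => //.
- by apply: wp_straight => //=; rewrite addn0.
- move=> st1 sm [e20 e21 oy1].
  pose Inv (done todo : seq nat) st' := [/\ reg st' 20 = size done,
    reg st' 21 = size todo, out st' 11 17 (ys ++ flatten (new' done)) &
    reg st' 18 = c + size (new' done)].
  apply: (wp_loop (xs := iota 0 l) (Inv := Inv)
    (cost := fun v => 9 + if mk v then 0 else 9 * size word + 20)) => //.
  + by move=> ? ? ? [].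
  + move=> done x todo st2 eq_xs sm2 [e20' e21' oy2 ec2].
    have ex := iota_split eq_xs; have lx : x < l.
      by rewrite -(size_iota 0 l) -eq_xs size_cat /= ex -addSnnS leq_addr.
    have hmx : arr st2 12 x = mk x by rewrite (same_arr _ sm2) // (same_arr _ sm) // hm.
    have hw2 : holds st2 10 (reg st2 11) word.
      rewrite (same_reg sm2) // (same_reg sm) //.
      by apply: holds_ext hw => i; rewrite (same_arr _ sm2) // (same_arr _ sm).
    have e15' : reg st2 15 = size word by rewrite (same_reg sm2) // (same_reg sm).
    apply: (@wp_seqf _ _ _ _ 1 (8 + if mk x then 0 else 9 * size word + 20) _ (fun st3 => reg st3
      2 = mk x /\ out st3 11 17 (ys ++ flatten (new' done)))) => //.
      by apply: wp_straight => //=; rewrite e20' -ex hmx.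
    move=> st3 sm3 [e2 oy3].
    apply: (@wp_seqf _ _ _ _ (4 + if mk x then 0 else 9 * size word + 20) 4 _ (fun st4 => out st4
      11 17 (ys ++ flatten (new' (rcons done x))) /\ reg st4 18 = c + size (new' (rcons done
        x)))) => //.
      rewrite addSn; apply: wp_if => e2'.
        have mx : mk x by move: e2'; rewrite e2; case: (mk x).
        apply: wp_straight => //; rewrite /new' filter_rcons mx /=.
        by split=> //; rewrite (same_reg sm3).
      have mx : mk x = false by move: e2'; rewrite e2; case: (mk x).
      rewrite mx /new' filter_rcons mx /= map_rcons flatten_rcons size_rcons.
      apply: (@wp_seqf _ _ _ _ 4 (9 * size word + 19) _ (fun st4 => 
         [/\ reg st4 22 = reg st 11, reg st4 23 = size word &
          out st4 11 17 (ys ++ flatten (new' done))])) => //.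
        apply: wp_straight => //=; rewrite !addn0 (same_reg sm3) // (same_reg sm3) // e15'.
        by rewrite (same_reg sm2) // (same_reg sm).
      move=> st4 sm4 [e22 e23 oy4].
      have hw4 : holds st4 10 (reg st4 22) word.
        rewrite e22 -(same_reg sm (r := 11)) // -(same_reg sm2 (r := 11)) //.
        by apply: holds_ext hw2 => i; rewrite (same_arr _ sm4) // (same_arr _ sm3).
      apply: (wp_seqf (c2 := 5) _ (copy_spec _ (B := 11) _ _ e23 hw4 oy4)) => //; last by lia.
      move=> st5 sm5 [_ _ oy5]; apply: wp_straight => //=; split; last first.
        rewrite /= (same_reg sm5) // (same_reg sm4) // (same_reg sm3) // ec2.
        by rewrite addn1 addnS.
      rewrite -!rcons_cat catA.
      apply: out_push oy5 _ _; rewrite /= ?addn1 // => i.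
      by rewrite (same_reg sm5 (r := 20)) // (same_reg sm4) // (same_reg sm3) // e20' ex.
      by lia.
    move=> st4 sm4 [oy4 ec4]; apply: wp_straight => //=; split=> //=; rewrite ?size_rcons.
    + by rewrite (same_reg sm4) // (same_reg sm3) // e20' addn1.
    + by rewrite (same_reg sm4) // (same_reg sm3) // e21' subn1.
    by case: (mk x); lia.
  + by split; rewrite ?size_iota ?cats0 ?addn0 // (same_reg sm).
  + rewrite -/(_ <= _) /=.
    have -> : \sum_(x <- iota 0 l) (9 + (if mk x then 0 else 9 * size word + 20)).+1 = 10 * l +
      size new * (9 * size word + 20).
      rewrite /new size_map -{2}(size_iota 0 l); elim: (iota 0 l) => [|v vs IH]; rewrite ?big_nil
        // big_cons IH /=.
      by case: (mk v) => /=; lia.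
    by lia.
  by move=> st' _ [].
by lia.
Qed.

(** * Words formed by a relation index and distinct variables *)

Definition extensions l (w : seq nat) :=
  [seq rcons w v | v <- iota 0 l & v \notin behead w].

(** The enumeration proceeds by levels rather than by q nested loops, because one program text has
    to serve every q. *)
Fixpoint pair_words l s i :=
  if i is i'.+1 then flatten [seq extensions l w | w <- pair_words l s i']
  else [seq [:: k] | k <- iota 0 s].

Definition pair_word l i (w : seq nat) :=
  [&& size w == i.+1, uniq (behead w) & all (fun v => v < l) (behead w)].

Lemma extensions_pair_word l i w : pair_word l i w -> all (pair_word l i.+1) (extensions l w).
Proof.
case: w => [|k ts] //= /and3P[/eqP[si] u lt]; apply/allP => x /mapP[v].
rewrite mem_filter mem_iota /= add0n => /andP[nv lv] ->.
by rewrite /pair_word /= size_rcons si eqxx rcons_uniq nv u all_rcons lv.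
Qed.

Lemma all_pair_words l s i : all (pair_word l i) (pair_words l s i).
Proof.
elim: i => [|i IH] /=; first by apply/allP => x /mapP[k _ ->].
apply/allP => x /flattenP[ws /mapP[w ww ->]]; move: x; apply/allP.
exact: extensions_pair_word (allP IH w ww).
Qed.

(** The entries after the relation index are distinct and in range, so they exclude exactly i of the
    l candidates. *)
Lemma size_extensions l i w : pair_word l i w -> size (extensions l w) = l - i.
Proof.
case/and3P=> /eqP sw u /allP lt; rewrite size_map size_filter.
have := count_predC (mem (behead w)) (iota 0 l); rewrite size_iota.
have -> : count (mem (behead w)) (iota 0 l) = i.
  have -> : i = size (behead w) by rewrite size_behead sw.
  rewrite -size_filter; apply/perm_size/uniq_perm => //.
    by rewrite filter_uniq ?iota_uniq.
  move=> x; rewrite mem_filter mem_iota /= add0n andbC.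
  by case: (boolP (x \in behead w)) => xw; rewrite ?andbF // lt.
by move=> e; rewrite -[X in _ = X - _]e addKn; apply: eq_count.
Qed.

Lemma size_pair_words l s i : size (pair_words l s i.+1) = size (pair_words l s i) * (l - i).
Proof.
rewrite /= size_flatten /shape -map_comp sumnE big_map.
elim: (pair_words l s i) (all_pair_words l s i) => [|w ws IH] /=; first by rewrite big_nil.
by case/andP=> ww /IH e; rewrite big_cons e mulSn (size_extensions ww).
Qed.

Lemma pair_words_head l s i w : w \in pair_words l s i -> head 0 w < s.
Proof.
elim: i w => [|i IH] w; first by case/mapP=> k; rewrite mem_iota => /= + ->.
case/flattenP=> ws /mapP[x xl ->] /mapP[v _ ->].
by case: x xl => [/(allP (all_pair_words _ _ _)) // | k x /IH].
Qed.

Lemma uniq_pair_words l s i : uniq (pair_words l s i).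
Proof.
elim: i => [|i IH]; first by rewrite map_inj_uniq ?iota_uniq // => x y [].
apply: (allpairs_uniq_dep IH) => [w _|]; first by rewrite filter_uniq ?iota_uniq.
by move=> [w v] [w' v'] _ _ /= /rcons_inj[-> ->].
Qed.

Lemma mem_pair_words l s i k ts : k < s -> size ts = i -> uniq ts ->
  all (fun v => v < l) ts -> k :: ts \in pair_words l s i.
Proof.
move=> ks; elim: i ts => [|i IH] ts.
  by move/size0nil=> -> _ _; apply/mapP; exists k; rewrite ?mem_iota.
case/lastP: ts => // ts v; rewrite size_rcons rcons_uniq all_rcons => -[sz] /andP[vts u] /andP[vl
  lts].
apply/flattenP; exists (extensions l (k :: ts)); first by apply: map_f; apply: IH.
by apply/mapP; exists v; rewrite // mem_filter mem_iota vts.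
Qed.

#[local] Arguments pair_words : simpl never.

(** A level is at least twice as large as the previous one while two variables are free, so the
    levels up to [i < l] sum to at most twice the last. Only the step to a scope of length l may
    fail to double, and it adds the third copy. *)
Lemma pair_words_sum l s q : 0 < s -> q <= l ->
  \sum_(0 <= i < q) size (pair_words l s i.+1) <= 3 * size (pair_words l s q).
Proof.
move=> s0; suff h i : i < l -> \sum_(0 <= j < i) size (pair_words l s j.+1) <= 2 * size
  (pair_words l s i).
  case: q => [|q] ql; first by rewrite big_geq.
  rewrite big_nat_recr //=; have := h q ql.
  have : size (pair_words l s q) <= size (pair_words l s q.+1).
    by rewrite size_pair_words leq_pmulr // subn_gt0.
  lia.
elim: i => [|i IH] il; first by rewrite big_geq.
rewrite big_nat_recr //; have := IH (ltnW il); rewrite size_pair_words.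
rewrite /=.
have : size (pair_words l s i) * 2 <= size (pair_words l s i) * (l - i) by rewrite leq_mul2l; lia.
by rewrite /=; lia.
Qed.

Lemma pair_words_gt0 l s i : 0 < s -> i <= l -> 0 < size (pair_words l s i).
Proof.
move=> s0; elim: i => [|i IH] il; first by rewrite size_map size_iota.
by rewrite size_pair_words muln_gt0 IH ?subn_gt0 // ltnW.
Qed.

Definition Level :=
  (Const 11 0 ;; Const 17 0 ;; Const 18 0 ;; Mov 19 14) ;;
  (While 19 (ZeroMarks ;; (SetMarks ;; (Scan ;; (Add 11 11 15 ;; Dec 19)))) ;;
   ((Const 10 0 ;; Const 22 0 ;; Mov 23 17) ;;
    (Copy 11 22 10 10 23 ;; (Mov 14 18 ;; Inc 15 ;; Dec 16)))).

Lemma flatten_split (T : Type) (s1 s2 : seq (seq T)) x :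
  flatten (s1 ++ x :: s2) = flatten s1 ++ x ++ flatten s2.
Proof. by rewrite flatten_cat. Qed.

(** Every old word pays for clearing the marks and scanning all variables; every new word pays for
    being written twice, to array 11 and back to array 10. *)
Lemma level_spec O st l i ws :
  reg st 5 = l -> out st 10 10 (flatten ws) -> reg st 14 = size ws ->
  reg st 15 = i.+1 -> all (pair_word l i) ws ->
  let new := flatten [seq extensions l w | w <- ws] in
  wp O Level st (size ws * (20 * l + 8 * i + 40) + size new * (18 * i + 50) + 30)
    (fun st' => [/\ out st' 10 10 (flatten new), reg st' 14 = size new,
       reg st' 15 = i.+2 & reg st' 16 = reg st 16 - 1]).
Proof.
move=> el oX e14 e15 aw new.
pose nx done := flatten [seq extensions l w | w <- done].
apply: (@wp_seqf _ _ _ _ 5 (size ws * (20 * l + 8 * i + 40) + size new * (18 * i + 50) + 25) _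
  (fun st1 =>
   [/\ reg st1 11 = 0, reg st1 18 = 0, reg st1 19 = size ws & out st1 11 17 [::]])) => //; last
     by lia.
  by apply: wp_straight => //=; rewrite e14 addn0.
move=> st1 sm [e11 e18 e19 oY].
pose Inv (done todo : seq (seq nat)) st' := [/\ reg st' 11 = size (flatten done),
  reg st' 19 = size todo, out st' 11 17 (flatten (nx done)) &
  reg st' 18 = size (nx done)].
apply: (@wp_seqf _ _ _ _ (size ws * (20 * l + 8 * i + 40) + size new * (9 * i + 30) + 1) (size
  new * (9 * i + 20) + 20) _ (fun st2 =>
   out st2 11 17 (flatten new) /\ reg st2 18 = size new)) => //; last by lia.
  apply: (wp_loop (xs := ws) (Inv := Inv)
    (cost := fun w => 20 * l + 8 * i + 39 + size (extensions l w) * (9 * i + 30))) => //.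
  + by move=> ? ? ? [].
  + move=> done w todo st2 eq_ws sm2 [e11' e19' oy2 e18'].
    have /and3P[/eqP sw uw lw] : pair_word l i w.
      by apply: (allP aw); rewrite -eq_ws mem_cat inE eqxx orbT.
    case: w sw uw lw eq_ws e19' => // k ts [st_i] u_ts lt_ts eq_ws e19'.
    have e15' : reg st2 15 = i.+1 by rewrite (same_reg sm2) // (same_reg sm).
    have e5' : reg st2 5 = l by rewrite (same_reg sm2) // (same_reg sm).
    have hw2 : holds st2 10 (reg st2 11) (k :: ts).
      case: oX => _; rewrite -eq_ws flatten_split !holds_cat => -[_ [h _]].
      rewrite e11'; apply: holds_ext h => j.
      by rewrite (same_arr _ sm2) // (same_arr _ sm).
    apply: (wp_seqf (c2 := 10 * l + 8 * i + 29 + size (extensions l (k :: ts)) * (9 * i + 30)) _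
      (zero_marks_spec _ e5')) => //; last by lia.
    move=> st3 sm3 hz.
    apply: (wp_seqf (c2 := 10 * l + 19 + size (extensions l (k :: ts)) * (9 * i + 30)) (Q1 := fun
      st' => forall v, v < l -> arr st' 12 v = (v \in ts)) (c1 := 8 * size ts + 10) _ _) => //;
        last by lia.
      apply: (@set_marks_spec _ _ _ k) => //; last by rewrite (same_reg sm3) // e15' st_i.
      by rewrite (same_reg sm3) //; apply: holds_ext hw2 => j; rewrite (same_arr _ sm3).
    move=> st4 sm4 hm.
    have r4 r : r \in [:: 5; 11; 15; 18; 19] -> reg st4 r = reg st2 r.
      by rewrite !inE => /or4P[|||/orP[|]] /eqP ->; rewrite (same_reg sm4) // (same_reg sm3).
    have a4 b j : b != 12 -> arr st4 b j = arr st2 b j.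
      by move=> nb; rewrite (same_arr _ sm4) ?(same_arr _ sm3) //= (negbTE nb).
    apply: (wp_seqf (c2 := 3) _ (@scan_spec _ _ l (k :: ts) (fun v => v \in ts) (flatten (nx
      done)) (size (nx done)) _ _ _ hm _ _)) => //.
    - by rewrite r4.
    - by rewrite r4 //; apply: holds_ext hw2 => j; rewrite a4.
    - by rewrite r4 // e15' /= st_i.
    - by case: oy2 => o1 o2; split; rewrite ?(same_reg sm4) ?(same_reg sm3) //; apply: holds_ext
      o2 => j; rewrite a4.
    - by rewrite r4.
    - move=> st5 sm5 [oy5 e18'']; apply: wp_straight => //=; split=> /=.
      + rewrite (same_reg sm5) // (same_reg sm5) // !r4 // e11' e15' -cats1 flatten_cat size_cat
        /= cats0.
        by rewrite /= st_i.
      + by rewrite (same_reg sm5) // r4 // e19' /= subn1.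
      + by rewrite /nx map_rcons -cats1 !flatten_cat /= cats0.
      + by rewrite /nx map_rcons -cats1 flatten_cat size_cat /= cats0.
    - by rewrite -/(size (extensions l (k :: ts))) /= st_i; rewrite /extensions /=; set z := size
      _; nia.
  + rewrite -/(_ <= _) /new /=.
    suff -> : \sum_(w <- ws) (20 * l + 8 * i + 39 + size (extensions l w) * (9 * i + 30)).+1 =
      size ws * (20 * l + 8 * i + 40) + size (nx ws) * (9 * i + 30) by rewrite addn1.
    elim: (ws) => [|w ws' IH]; rewrite ?big_nil // big_cons IH /nx /= size_cat.
    by nia.
  by move=> st' _ [_ _].
move=> st2 sm2 [oY2 e18'].
have e15' : reg st2 15 = i.+1 by rewrite (same_reg sm2) // (same_reg sm).
have snew : size (flatten new) = size new * i.+2.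
  have: all (pair_word l i.+1) new.
    apply/allP => x /flattenP[ws' /mapP[w ww ->]]; move: x; apply/allP.
    exact: extensions_pair_word (allP aw w ww).
  elim: (new) => //= x xs IH /andP[/and3P[/eqP sx _ _] /IH e].
  by rewrite size_cat e sx mulSn.
apply: (@wp_seqf _ _ _ _ 4 (size new * (9 * i + 20) + 16) _ (fun st3 =>
  [/\ reg st3 22 = 0, reg st3 23 = size (flatten new), out st3 10 10 [::] & out st3 11 17
    (flatten new)])) => //; last by lia.
  by apply: wp_straight => //=; split=> //=; case: oY2 => ->; rewrite addn0.
move=> st3 sm3 [e22 e23 oX3 oY3].
apply: (wp_seqf (c2 := 6) _ (copy_spec _ (A := 11) _ _ e23 _ oX3)) => //.
- by rewrite e22; case: oY3.
- move=> st4 sm4 [_ _ oX4]; apply: wp_straight => //=; split=> //=.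
  + by rewrite (same_reg sm4) // (same_reg sm3) // e18' addn0.
  + by rewrite (same_reg sm4) // (same_reg sm3) // e15' addn1.
  by rewrite (same_reg sm4) // (same_reg sm3) // (same_reg sm2) // (same_reg sm).
by rewrite snew; nia.
Qed.

(** Charges the initial list of the s relation indices to the final number of words. *)
Lemma pair_words_ge l s i : i <= l -> s <= size (pair_words l s i).
Proof.
elim: i => [|i IH] il; first by rewrite size_map size_iota.
by rewrite size_pair_words (leq_trans (IH (ltnW il))) // leq_pmulr // subn_gt0.
Qed.

Definition Levels :=
  (Const 10 0 ;; Const 13 0 ;; Mov 12 7) ;;
  (While 12 (Store 10 10 13 ;; Inc 10 ;; Inc 13 ;; Dec 12) ;;
   ((Mov 14 7 ;; Const 15 1 ;; Mov 16 6) ;; While 16 Level)).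

(* Since l <= (l - i) * (i + 1) for i < l, scanning all l candidates costs O(i + 1) per word
   produced. *)
Lemma level_cost l i n1 n2 q : i < q -> q <= l -> n2 = n1 * (l - i) -> 0 < n2 ->
  n1 * (20 * l + 8 * i + 40) + n2 * (18 * i + 50) + 30 < 161 * q * n2.
Proof.
move=> iq ql e2 n20.
have h1 : n1 * l.+1 <= n2 * i.+2.
  have : l.+1 <= (l - i) * i.+2 by nia.
  by rewrite e2 -mulnA => h; rewrite leq_mul2l h orbT.
have h2 : n1 * (20 * l + 8 * i + 40) <= 40 * (n1 * l.+1) by nia.
have h3 : i.+1 * n2 <= q * n2 by rewrite leq_mul2r iq orbT.
by nia.
Qed.

Lemma levels_spec O st l q s :
  reg st 5 = l -> reg st 6 = q -> reg st 7 = s -> 0 < s -> q <= l ->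
  wp O Levels st (600 * (q.+1 * size (pair_words l s q))) (fun st' =>
    out st' 10 10 (flatten (pair_words l s q)) /\ reg st' 14 = size (pair_words l s q)).
Proof.
move=> el eq es s0 ql; set N := size (pair_words l s q).
have sN : s <= N := pair_words_ge s ql.
apply: (@wp_seqf _ _ _ _ 4 (9 * s + 10 + 483 * q * N) _ (fun st1 =>
   [/\ reg st1 13 = 0, reg st1 12 = s & out st1 10 10 [::]])) => //; last by nia.
  by apply: wp_straight => //=; rewrite addn0.
move=> st1 sm1 [e13 e12 oX].
pose Inv (done todo : seq nat) st' := [/\ reg st' 13 = size done,
  reg st' 12 = size todo & out st' 10 10 done].
apply: (@wp_seqf _ _ _ _ (9 * s + 1) (483 * q * N + 9) _ (fun st2 =>
   out st2 10 10 (iota 0 s))) => //; last by lia.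
  apply: (wp_loop (xs := iota 0 s) (Inv := Inv) (cost := fun=> 7)) => //.
  + by move=> ? ? ? [].
  + move=> done x todo st2 eq_xs sm2 [e13' e12' oX2].
    apply: wp_straight => //=; split; rewrite /= ?size_rcons ?e12' ?e13' //= ?addn1 ?subn1 //.
    by apply: out_push oX2 _ _ => /= [|j]; rewrite ?addn1 ?e13' // (iota_split eq_xs).
  + by split; rewrite ?size_iota.
  + by rewrite sum_const_cost size_iota; lia.
  by move=> st' _ [].
move=> st2 sm2 oX2.
pose Inv2 (done todo : seq nat) st' := let i := size done in
  [/\ out st' 10 10 (flatten (pair_words l s i)), reg st' 14 = size (pair_words l s i),
    reg st' 15 = i.+1, reg st' 16 = size todo & reg st' 5 = l].
apply: (@wp_seqf _ _ _ _ 5 (483 * q * N + 1) _ (Inv2 [::] (iota 0 q))) => //; last by lia.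
  apply: wp_straight => //; rewrite /Inv2 /=.
  rewrite !(same_reg sm2) // !(same_reg sm1) // es eq el !size_iota size_map size_iota !addn0.
  split=> //.
  have -> : flatten (pair_words l s 0) = iota 0 s; last by case: oX2.
  by rewrite /pair_words; elim: (iota 0 s) => //= x xs ->.
move=> st3 sm3 inv3.
(* The predecessor leaves room for the loop test that [wp_loop] adds to each cost; [level_cost] is
   strict for this reason. *)
apply: (wp_loop (xs := iota 0 q) (Inv := Inv2)
    (cost := fun i => (161 * q * size (pair_words l s i.+1)).-1)) => //.
+ by move=> ? ? ? [].
+ move=> done x todo st4 eq_xs sm4 [oX4 e14 e15 e16 e5].
  have ex := iota_split eq_xs; have xq : x < q.
    by rewrite -(size_iota 0 q) -eq_xs size_cat /= ex -addSnnS leq_addr.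
  have il : x < l by apply: leq_trans ql.
  have nq0 : query_free Level by [].
  have [k [st5 [ex5 lek [oX5 e14' e15' e16']]]] :=
    level_spec O e5 oX4 e14 e15 (all_pair_words _ _ _).
  exists k, st5; split=> //.
    have := level_cost xq ql (size_pair_words l s x) (pair_words_gt0 s0 il).
    by rewrite -ex /= in lek *; move: lek; rewrite -/(pair_words l s x.+1); lia.
  have sm5 := exec_same nq0 ex5.
  rewrite /Inv2 size_rcons; split=> //.
    by rewrite e16' e16 /= subn1.
  by rewrite (same_reg sm5).
+ have -> : \sum_(i <- iota 0 q) (161 * q * size (pair_words l s i.+1)).-1.+1 =
    161 * q * \sum_(0 <= i < q) size (pair_words l s i.+1).
    rewrite big_distrr /= /index_iota subn0 big_seq [RHS]big_seq; apply: eq_bigr => i.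
    rewrite mem_iota add0n => /andP[_ iq]; rewrite prednK // !muln_gt0 /=.
    by rewrite (leq_ltn_trans (leq0n i) iq) pair_words_gt0 // (leq_trans iq).
  have := pair_words_sum s0 ql; rewrite -/N; set S := \sum_(_ <= _ < _) _ => hS.
  have : q * S <= q * (3 * N) by rewrite leq_mul2l hS orbT.
  by nia.
by move=> st' _; rewrite /Inv2 size_iota => -[].
Qed.

(* The presentation by UE_pres of one constraint: the words of its pairs and its scope. *)
Definition enc (b : seq (seq nat) * seq nat) := size b.1 :: flatten b.1 ++ b.2.

Definition encs hdr bl := hdr ++ flatten (map enc bl).

(** * Writing the instance whose lists contain all pairs *)

Definition Params :=
  (Const 1 0 ;; Fetch 3 0 1) ;; ((Const 1 1 ;; Fetch 4 0 1) ;;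
  ((Const 1 2 ;; Fetch 5 0 1) ;; ((Const 1 3 ;; Fetch 6 0 1) ;;
  ((Const 1 4 ;; Fetch 7 0 1) ;; ((Const 1 5 ;; Fetch 8 0 1) ;;
   (Const 1 1 ;; Add 9 6 1)))))).

Definition Build :=
  (Const 17 0 ;; Const 22 0 ;; Const 23 6) ;;
  (Copy 0 22 11 17 23 ;;
   (Mov 19 8 ;;
    While 19
     ((Store 11 17 14 ;; Inc 17 ;; Const 22 0 ;; Mov 23 10) ;;
      (Copy 10 22 11 17 23 ;;
       ((Const 20 0 ;; Mov 21 5) ;;
        (While 21 (Store 11 17 20 ;; Inc 17 ;; Inc 20 ;; Dec 21) ;; Dec 19)))))).

(** The scope of each block is [iota 0 l]: relations of the union problem have arity l, and the
    identity scope applies them to the assignment itself. *)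
Lemma build_spec O st l m hdr ws :
  size hdr = 6 -> holds st 0 0 hdr -> reg st 5 = l -> reg st 8 = m ->
  out st 10 10 (flatten ws) -> reg st 14 = size ws ->
  let Y := encs hdr (nseq m (ws, iota 0 l)) in
  wp O Build st (100 * size Y) (fun st' => out st' 11 17 Y).
Proof.
move=> sh hh el em oX e14 Y.
have sY : size Y = 6 + m * (1 + size (flatten ws) + l).
  rewrite size_cat sh map_nseq; congr (_ + _); elim: (m) => //= m' IH.
  by rewrite size_cat IH size_cat size_iota; lia.
apply: (@wp_seqf _ _ _ _ 3 (9 * 6 + 5 + m * (9 * size (flatten ws) + 8 * l + 30)) _ (fun st1 =>
   [/\ reg st1 22 = 0, reg st1 23 = size hdr & out st1 11 17 [::]])) => //; last by nia.
  by apply: wp_straight => //=; rewrite sh.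
move=> st1 sm1 [e22 e23 oY].
have hh1 : holds st1 0 (reg st1 22) hdr.
  by rewrite e22; apply: holds_ext hh => i; rewrite (same_arr _ sm1).
apply: (wp_seqf (c2 := 4 + m * (9 * size (flatten ws) + 8 * l + 30)) _ (copy_spec _ (B := 11) _ _
  e23 hh1 oY)) => //; last by lia.
move=> st2 sm2 [_ _ oY2].
apply: (@wp_seqf _ _ _ _ 2 (1 + m * (9 * size (flatten ws) + 8 * l + 30)) _ (fun st3 => reg st3
  19 = m /\ out st3 11 17 hdr)) => //.
  by apply: wp_straight => //=; rewrite addn0 (same_reg sm2) // (same_reg sm1).
move=> st3 sm3 [e19 oY3].
pose Inv (done todo : seq nat) st' :=
  reg st' 19 = size todo /\ out st' 11 17 (encs hdr (nseq (size done) (ws, iota 0 l))).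
apply: (wp_loop (xs := iota 0 m) (Inv := Inv)
    (cost := fun i => 9 * size (flatten ws) + 8 * l + 29)) => //.
+ by move=> ? ? ? [].
+ move=> done x todo st4 eq_xs sm4 [e19' oY4].
  have r4 r : r \in [:: 5; 10; 14] -> reg st4 r = reg st r.
    by rewrite !inE => /or3P[] /eqP ->; rewrite (same_reg sm4) // (same_reg sm3) // (same_reg
      sm2) // (same_reg sm1).
  have a4 i : arr st4 10 i = arr st 10 i.
    by rewrite (same_arr _ sm4) // (same_arr _ sm3) // (same_arr _ sm2) // (same_arr _ sm1).
  set ys := encs _ _ in oY4.
  apply: (@wp_seqf _ _ _ _ 6 (9 * size (flatten ws) + 8 * l + 23) _ (fun st5 =>
   [/\ reg st5 22 = 0, reg st5 23 = size (flatten ws) & out st5 11 17 (rcons ys (size ws))])) =>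
     //; last by lia.
    apply: wp_straight => //=; split; rewrite /= ?addn0 //; first by rewrite r4 //; case: oX.
    by apply: out_push oY4 _ _ => /= [|i]; rewrite ?addn1 ?(r4 14) ?e14.
  move=> st5 sm5 [e22' e23' oY5].
  apply: (wp_seqf (c2 := 8 * l + 22) _ (copy_spec _ (A := 10) (B := 11) _ _ e23' _ oY5)) => //;
    last by lia.
    rewrite e22'; case: oX => _ h; apply: holds_ext h => i.
    by rewrite (same_arr _ sm5).
  move=> st6 sm6 [_ _ oY6].
  apply: (@wp_seqf _ _ _ _ 3 (8 * l + 19) _ (fun st7 =>
   [/\ reg st7 20 = 0, reg st7 21 = l & out st7 11 17 (rcons ys (size ws) ++ flatten ws)])) =>
     //; last by lia.
    by apply: wp_straight => //=; rewrite addn0 (same_reg sm6) // (same_reg sm5) // r4.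
  move=> st7 sm7 [e20 e21 oY7].
  apply: (@wp_seqf _ _ _ _ (8 * l + 1) 2 _ (fun st8 =>
     out st8 11 17 ((rcons ys (size ws) ++ flatten ws) ++ iota 0 l))) => //; last by lia.
    pose Inv2 (done todo : seq nat) st' := [/\ reg st' 20 = size done,
     reg st' 21 = size todo & out st' 11 17 ((rcons ys (size ws) ++ flatten ws) ++ done)].
    apply: (wp_loop (xs := iota 0 l) (Inv := Inv2) (cost := fun=> 7)) => //.
    * by move=> ? ? ? [].
    * move=> done2 x2 todo2 st8 eq_xs2 sm8 [e20' e21' oY8].
      apply: wp_straight => //=; split; rewrite /= ?size_rcons ?e20' ?e21' //= ?addn1 ?subn1 //.
      by rewrite -rcons_cat; apply: out_push oY8 _ _ => /= [|j]; rewrite ?addn1 ?e20' //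
        (iota_split eq_xs2).
    * by split; rewrite ?cats0 ?size_iota.
    * by rewrite sum_const_cost size_iota; lia.
    by move=> st' _ [].
  move=> st8 sm8 oY8; apply: wp_straight => //=; split=> /=.
    rewrite (same_reg sm8) // (same_reg sm7) // (same_reg sm6) // (same_reg sm5) //.
    by rewrite e19' subn1.
  rewrite size_rcons.
  suff -> : encs hdr (nseq (size done).+1 (ws, iota 0 l)) = (rcons ys (size ws) ++ flatten ws) ++
    iota 0 l by [].
  by rewrite -addn1 nseqD /encs map_cat flatten_cat /= cats0 cat_rcons /ys /encs -!catA /=.
+ by split; rewrite ?size_iota // /encs /= cats0.
+ by rewrite sum_const_cost size_iota; lia.
by move=> st' _ []; rewrite size_iota.
Qed.

(** * Deleting pairs from the list of one constraint *)

Definition solver_cell r := 40 + r.*2.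
Definition decider_cell r := 41 + r.*2.

Lemma solver_cell_inj : injective solver_cell. Proof. by move=> x y; rewrite /solver_cell; lia. Qed.
Lemma decider_cell_inj : injective decider_cell. Proof. by move=> x y; rewrite /decider_cell;
  lia. Qed.

Lemma runs_in_mono O p x t t' post :
  runs_in O p x t post -> t <= t' -> runs_in O p x t' post.
Proof.
move=> h le_t st /h[k [st' [ex le_k q]]]; exists k, st'; split=> //.
exact: leq_trans le_t.
Qed.

Lemma holds_set st B i x o xs :
  i < o -> holds st B o xs -> holds (set_arr st B i x) B o xs.
Proof.
move=> io h j lj /=; rewrite eqxx /= ifN ?h //.
by apply/eqP => e; move: io; rewrite -e ltnNge leq_addr.
Qed.

(** Back-patching: the length of a filtered list stands in front of the list, but is known only
    after the list has been scanned. *)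
Lemma out_set st B w i x y ys zs :
  i = size ys -> out st B w (ys ++ y :: zs) ->
  out (set_arr st B i x) B w (ys ++ x :: zs).
Proof.
move=> -> [ew]; rewrite !size_cat /= in ew *; move=> /holds_cat[h1 /holds_cons[_ h2]].
split=> /=; first by rewrite ew size_cat.
apply/holds_cat; split.
  move=> j lj /=; rewrite ifN ?h1 // add0n andbC ltn_eqF //.
apply/holds_cons; split; first by rewrite /= add0n !eqxx.
by apply: holds_set h2; rewrite add0n.
Qed.

(** The answer of the decider may be any nonzero number; the truncated difference [1 - answer] is 1
    exactly for a pair that the assignment violates, that is, for a pair to be kept. *)
Definition Test D :=
  (Const 28 0 ;; Const 22 0 ;; Const 23 5) ;;
  (Copy 10 22 41 28 23 ;;
   ((Fetch 1 10 11 ;; Store 41 28 1 ;; Inc 28 ;; Mov 22 11 ;; Inc 22 ;; Mov 23 6) ;;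
    (Gather 10 22 1 41 28 23 ;; (relocate decider_cell D ;; (Const 1 1 ;; Defs.Sub 26 1 41))))).

Definition Pair D :=
  If 27 (Const 26 1) (Test D) ;;
  (If 26 ((Mov 22 11 ;; Mov 23 9) ;; (Copy 10 22 11 17 23 ;; Inc 18)) Skip ;;
   (Add 11 11 9 ;; Dec 12)).

(** [writes_reg] does not evaluate on the unknown decider [D], so these frames are explicit
    predicates that cover its cells by the bound 40. *)
Definition WT : pred nat := fun r => (r \in [:: 1; 22; 23; 26; 28]) || (40 <= r).
Definition AT : pred nat := fun r => 40 <= r.
Definition WPair : pred nat := fun r =>
  (r \in [:: 1; 11; 12; 17; 18; 22; 23; 26; 28]) || (40 <= r).
Definition APair : pred nat := fun r => (r == 11) || (40 <= r).

Lemma writes_reg_decider D r : writes_reg (relocate decider_cell D) r -> 40 <= r.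
Proof. by case/writes_reg_relocate=> x ->; rewrite /decider_cell; lia. Qed.

Lemma writes_arr_decider D r : writes_arr (relocate decider_cell D) r -> 40 <= r.
Proof. by case/writes_arr_relocate=> x ->; rewrite /decider_cell; lia. Qed.

Ltac sub_writes := move=> r /=; rewrite ?orbF;
  repeat (case/orP); try (by move/eqP=> ->); try (by move=> ->; rewrite ?orbT);
  try (by move/writes_reg_decider; rewrite /WT /WPair /AT /APair => ->; rewrite ?orbT);
  try (by move/writes_arr_decider; rewrite /WT /WPair /AT /APair => ->; rewrite ?orbT).

Lemma WTP D : subpred (writes_reg (Test D)) WT. Proof. sub_writes. Qed.
Lemma ATP D : subpred (writes_arr (Test D)) AT. Proof. sub_writes. Qed.
Lemma WPairP D : subpred (writes_reg (Pair D)) WPair. Proof. sub_writes. Qed.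
Lemma APairP D : subpred (writes_arr (Pair D)) APair. Proof. sub_writes. Qed.

Lemma query_free_Pair D : query_free (Pair D). Proof. by rewrite /= query_free_relocate. Qed.

Lemma test_spec O D st hdr k ts q c b :
  size hdr = 5 -> holds st 10 0 hdr -> holds st 10 (reg st 11) (k :: ts) ->
  reg st 6 = q -> size ts = q -> q + 6 <= c ->
  runs_in no_oracle D (hdr ++ k :: [seq arr st 1 i | i <- ts]) c
    (fun s => (reg s 0 != 0) = b) ->
  wp O (Test D) st (12 * c) (fun st' => (reg st' 26 != 0) = ~~ b).
Proof.
move=> sh hh hw e6 sts qc run.
apply: (@wp_seqf _ _ _ _ 3 (12 * c - 3) _ (fun st1 =>
  [/\ reg st1 22 = 0, reg st1 23 = size hdr & out st1 41 28 [::]])) => //; last by lia.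
  by apply: wp_straight => //=; rewrite sh.
move=> st1 sm1 [e22 e23 oD].
have hh1 : holds st1 10 (reg st1 22) hdr.
  by rewrite e22; apply: holds_ext hh => i; rewrite (same_arr _ sm1).
apply: (wp_seqf (c2 := 12 * c - 49) _ (copy_spec _ (B := 41) _ _ e23 hh1 oD)) => //; last by lia.
move=> st2 sm2 [_ _ oD2].
apply: (@wp_seqf _ _ _ _ 10 (10 * q + 3 + c) _ (fun st3 =>
  [/\ reg st3 22 = (reg st 11).+1, reg st3 23 = size ts & out st3 41 28 (rcons hdr k)])) => //;
    last by lia.
  apply: wp_straight => //; rewrite /= (same_reg sm2) // (same_reg sm1) // !addn0 (same_reg sm2)
    // (same_reg sm1) //.
  rewrite e6 sts addn1; split=> //.
  apply: out_push oD2 _ _ => /= [|i]; rewrite ?addn1 //.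
  have /holds_cons[<- _] := hw.
  by rewrite (same_arr _ sm2) // (same_arr _ sm1).
move=> st3 sm3 [e22' e23' oD3].
have hw3 : holds st3 10 (reg st3 22) ts.
  rewrite e22'; case/holds_cons: hw => _ h; apply: holds_ext h => i.
  by rewrite (same_arr _ sm3) // (same_arr _ sm2) // (same_arr _ sm1).
apply: (wp_seqf (c2 := 2 + c) _ (gather_spec _ (G := 1) (B := 41) _ _ _ e23' hw3 oD3)) => //;
  last by lia.
move=> st4 sm4 [_ _ [_ oD4]].
have in4 : holds st4 (decider_cell 0) 0 (hdr ++ k :: [seq arr st 1 i | i <- ts]).
  rewrite -cat_rcons; congr (holds _ _ _ (_ ++ _)): oD4; apply: eq_map => i.
  by rewrite (same_arr _ sm3) // (same_arr _ sm2) // (same_arr _ sm1).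
apply: (wp_seqf (c2 := 2) _ (call_spec O decider_cell_inj run in4)) => //; first exact:
  query_free_relocate.
  move=> st5 sm5 [s ag es]; apply: wp_straight => //=.
  have -> : reg st5 41 = reg s 0 by apply: (ag.1 0).
  by rewrite -es; case: (reg s 0).
by lia.
Qed.

(** The decider is charged only if [isv], in the block of the violated constraint; elsewhere a pair
    is merely copied. One update thus pays for the membership tests of a single list. *)
Lemma pair_spec O D st hdr x q c b ys (isv : bool) :
  size hdr = 5 -> holds st 10 0 hdr -> holds st 10 (reg st 11) x ->
  reg st 6 = q -> reg st 9 = q.+1 -> size x = q.+1 -> q + 6 <= c ->
  (reg st 27 != 0) = ~~ isv ->
  (isv -> runs_in no_oracle D (hdr ++ head 0 x :: [seq arr st 1 i | i <- behead x]) c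
    (fun s => (reg s 0 != 0) = b)) ->
  out st 11 17 ys ->
  let keep := isv ==> ~~ b in
  wp O (Pair D) st (30 * q.+1 + isv * (12 * c)) (fun st' =>
    [/\ out st' 11 17 (ys ++ if keep then x else [::]),
        reg st' 18 = reg st 18 + keep, reg st' 11 = reg st 11 + q.+1 &
        reg st' 12 = reg st 12 - 1]).
Proof.
move=> sh hh hw e6 e9 sx qc e27 run oY keep.
apply: (@wp_seqf _ _ _ _ (isv * (12 * c)).+2 (30 * q.+1 - 2) _ (fun st1 =>
  (reg st1 26 != 0) = keep)) => //; last by lia.
- by rewrite /= query_free_relocate.
- apply: wp_if => [i27 | i27].
    apply: wp_straight => //=; rewrite /keep.
    by have -> : isv = false by apply: negbTE; rewrite -e27.
  have iv : isv by move: e27; rewrite i27; case: (isv).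
  case: x sx hw run {oY} => // k ts [sts] hw run.
  have := test_spec O sh hh hw e6 sts qc (run iv).
  by move=> h; apply: wp_mono h _ _; [rewrite iv mul1n leqnSn | rewrite /keep iv].
move=> st1 sm1 e26.
have {}sm1 : same WT AT st st1.
  apply: same_sub sm1 _ _ => r /=; first by case/orP=> [/eqP -> //|/WTP].
  by move/ATP.
have oY1 : out st1 11 17 ys.
  case: oY => o1 o2; split; first by rewrite (same_reg sm1).
  by apply: holds_ext o2 => i; rewrite (same_arr _ sm1).
apply: (@wp_seqf _ _ _ _ (30 * q.+1 - 6) 4 _ (fun st2 =>
   out st2 11 17 (ys ++ if keep then x else [::]) /\ reg st2 18 = reg st 18 + keep)) => //.
- have -> : 30 * q.+1 - 6 = (30 * q.+1 - 7).+1 by lia.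
  apply: wp_if => i26; last first.
    have -> : keep = false by rewrite -e26 i26.
    by apply: wp_straight => //=; rewrite ?cats0 ?addn0 ?(same_reg sm1) //; lia.
  rewrite -e26 i26.
  apply: (@wp_seqf _ _ _ _ 4 (30 * q.+1 - 11) _ (fun st2 =>
    [/\ reg st2 22 = reg st 11, reg st2 23 = size x & out st2 11 17 ys])) => //; last by lia.
    by apply: wp_straight => //=; rewrite !(same_reg sm1) // !addn0 e9.
  move=> st2 sm2 [e22 e23 oY2].
  have hw2 : holds st2 10 (reg st2 22) x.
    rewrite e22; apply: holds_ext hw => i.
    by rewrite (same_arr _ sm2) // (same_arr _ sm1).
  apply: (wp_seqf (c2 := 2) _ (copy_spec _ (B := 11) _ _ e23 hw2 oY2)) => //; last by lia.
  move=> st3 sm3 [_ _ oY3]; apply: wp_straight => //; split=> //=.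
  by rewrite (same_reg sm3) // (same_reg sm2) // (same_reg sm1).
- move=> st2 sm2 [oY2 e18]; apply: wp_straight => //; split=> //=.
    by rewrite !(same_reg sm2) // !(same_reg sm1) // e9.
  by rewrite !(same_reg sm2) // !(same_reg sm1).
by lia.
Qed.

Lemma size_flatten_words q (ws : seq (seq nat)) :
  all (fun x => size x == q) ws -> size (flatten ws) = size ws * q.
Proof. by elim: ws => //= x xs IH /andP[/eqP e /IH e']; rewrite size_cat e e' mulSn. Qed.

(** Register 24 holds the answer [j.+1] and register 25 is incremented before the comparison, so the
    sum of their two truncated differences vanishes exactly in block j. [Inc 17] reserves the cell
    for the new length, whose position is kept in register 13. *)
Definition Block D :=
  (Fetch 12 10 11 ;; Inc 11 ;; Mov 13 17 ;; Const 18 0 ;; Inc 17 ;;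
   Inc 25 ;; Defs.Sub 27 25 24 ;; Defs.Sub 2 24 25 ;; Add 27 27 2) ;;
  (While 12 (Pair D) ;;
   ((Store 11 13 18 ;; Mov 23 5) ;; (Copy 10 11 11 17 23 ;; Dec 19))).

Definition WBlock : pred nat := fun r =>
  (r \in [:: 1; 2; 11; 12; 13; 17; 18; 19; 22; 23; 25; 26; 27; 28]) || (40 <= r).

Lemma WBlockP D : subpred (writes_reg (Block D)) WBlock.
Proof.
move=> r; rewrite /Block /= -/(writes_reg (Pair D) r).
repeat (case/orP); try (by move/eqP=> ->); try by [].
all: try by move/writes_reg_decider; rewrite /WBlock => ->; rewrite orbT.
Qed.

Lemma ABlockP D : subpred (writes_arr (Block D)) APair.
Proof.
move=> r; rewrite /Block /=.
repeat (case/orP); try (by move/eqP=> ->); try by [].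
all: try by move/writes_arr_decider; rewrite /APair => ->; rewrite orbT.
Qed.

Lemma query_free_Block D : query_free (Block D). Proof. by rewrite /= query_free_relocate. Qed.

Lemma block_spec O D st hdr ws sc q l m c b ys v jj :
  size hdr = 5 -> holds st 10 0 hdr -> holds st 10 (reg st 11) (enc (ws, sc)) ->
  reg st 5 = l -> size sc = l ->
  reg st 6 = q -> reg st 9 = q.+1 -> all (fun x => size x == q.+1) ws -> q + 6 <= c ->
  reg st 24 = v -> reg st 25 = jj -> reg st 19 = m.+1 ->
  (jj.+1 = v -> forall x, x \in ws ->
    runs_in no_oracle D (hdr ++ head 0 x :: [seq arr st 1 i | i <- behead x]) c
    (fun s => (reg s 0 != 0) = b x)) ->
  out st 11 17 ys ->
  let isv := jj.+1 == v in
  let ws' := [seq x <- ws | isv ==> ~~ b x] in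
  wp O (Block D) st (31 * size (enc (ws, sc)) + isv * (size ws * (12 * c))) (fun st' =>
    [/\ out st' 11 17 (ys ++ enc (ws', sc)),
        reg st' 11 = reg st 11 + size (enc (ws, sc)),
        reg st' 25 = jj.+1 & reg st' 19 = m]).
Proof.
move=> sh hh /holds_cons[hc /holds_cat[hws hsc]] el ssc eq e9 sws qc ev ejj em run oY isv ws'.
rewrite /= in hc hws hsc.
(* The reserved cell holds an arbitrary old value until the new length overwrites it. *)
set y := arr st 11 (reg st 17).
apply: (@wp_seqf _ _ _ _ 15 (31 * (size ws * q.+1 + l) + 16 + isv * (size ws * (12 * c))) _ (fun
  st1 =>
  [/\ reg st1 12 = size ws, reg st1 11 = (reg st 11).+1 /\ reg st1 13 = size ys,
      reg st1 18 = 0 /\ reg st1 25 = jj.+1, (reg st1 27 != 0) = ~~ isv & out st1 11 17 (rcons ys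
        y)])) => //.
- apply: wp_straight => //; split=> //=.
  + by case: oY => -> _; rewrite addn0 addn1.
  + by rewrite ejj addn1.
  + by rewrite ejj ev addn1 /isv; case: (eqVneq jj.+1 v); lia.
  + by apply: (out_push oY) => //=; rewrite ?addn1 // => i; case: eqP => // ->.
- move=> st1 sm1 [e12 [e11 e13] [e18 e25] e27 oY1].
  pose kp done := [seq x <- done | isv ==> ~~ b x].
  pose Inv (done todo : seq (seq nat)) st' :=
    [/\ reg st' 12 = size todo, reg st' 11 = (reg st 11).+1 + size (flatten done),
        reg st' 18 = size (kp done) & out st' 11 17 (rcons ys y ++ flatten (kp done))].
  apply: (@wp_seqf _ _ _ _ (size ws * (30 * q.+1 + 1 + isv * (12 * c)) + 1) (9 * l + 6) _ (fun
    st2 =>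
     same WPair APair st1 st2 /\ Inv ws [::] st2)); first exact: query_free_Pair.
  + apply: (wp_loop (xs := ws) (Inv := Inv) (cost := fun=> 30 * q.+1 + isv * (12 * c))).
    * exact: query_free_Pair.
    * by move=> ? ? ? [].
    * move=> done x todo st2 eq_ws /(fun h => same_sub h (@WPairP D) (@APairP D)) sm2 [e12' e11'
      e18' oY2].
      have xw : x \in ws by rewrite -eq_ws mem_cat inE eqxx orbT.
      have sx : size x = q.+1 by apply/eqP/(allP sws).
      have a2 i : arr st2 10 i = arr st 10 i by rewrite (same_arr _ sm2) // (same_arr _ sm1).
      have hh2 : holds st2 10 0 hdr by apply: holds_ext hh.
      have hw2 : holds st2 10 (reg st2 11) x.
        rewrite e11'; move: hws; rewrite -eq_ws flatten_split !holds_cat => -[_ [h _]].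
        exact: holds_ext h.
      have := @pair_spec O D st2 hdr x q c (b x) (rcons ys y ++ flatten (kp done)) isv sh hh2 hw2.
      rewrite (same_reg sm2 (r := 6)) // (same_reg sm2 (r := 9)) // (same_reg sm2 (r := 27)) //.
      rewrite (same_reg sm1 (r := 6)) // (same_reg sm1 (r := 9)) // => /(_ eq e9 sx qc e27) h.
      apply: wp_mono (h _ oY2) _ _ => //.
        move=> /eqP iv; have := run iv _ xw; congr (runs_in _ _ (_ ++ _ :: _) _ _).
        by apply: eq_map => i; rewrite (same_arr _ sm2) // (same_arr _ sm1).
      move=> st3 [oY3 e18'' e11'' e12'']; split.
      - by rewrite e12'' e12' subn1.
      - by rewrite e11'' e11' -cats1 flatten_cat size_cat /= cats0 sx addnA.
      - by rewrite e18'' e18' /kp filter_rcons; case: ifP; rewrite ?size_rcons ?addn1 ?addn0.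
      - rewrite /kp filter_rcons; case: ifP oY3 => _ oY3; last by rewrite cats0 in oY3.
        by rewrite flatten_rcons catA.
    * by split; rewrite ?addn0 ?cats0.
    * by rewrite sum_const_cost; lia.
    * by move=> st' /(fun h => same_sub h (@WPairP D) (@APairP D)).
  + move=> st2 _ [sm2 [_ e11' e18' oY2]].
    apply: (@wp_seqf _ _ _ _ 3 (9 * l + 3) _ (fun st3 =>
      reg st3 23 = size sc /\ out st3 11 17 (ys ++ size ws' :: flatten ws'))) => //; last by lia.
      apply: wp_straight => //=; split=> /=.
        by rewrite (same_reg sm2) // (same_reg sm1) // ssc el addn0.
      rewrite (same_reg sm2) // e13 e18' in oY2 *.
      have := @out_set st2 11 17 (size ys) (size ws') y ys (flatten (kp ws)) erefl.
      by rewrite -cat_rcons => /(_ oY2) [].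
    move=> st3 sm3 [e23 oY3].
    have hsc3 : holds st3 10 (reg st3 11) sc.
      rewrite (same_reg sm3) // e11'; apply: holds_ext hsc => i.
      by rewrite (same_arr _ sm3) // (same_arr _ sm2) // (same_arr _ sm1).
    apply: (wp_seqf (c2 := 2) _ (copy_spec _ (A := 10) (B := 11) _ _ e23 hsc3 oY3)) => //; last
      by lia.
    move=> st4 sm4 [e11'' _ oY4]; apply: wp_straight => //; split.
    + by rewrite /enc /= -cat_cons catA.
    + rewrite /= e11'' (same_reg sm3) // e11' size_cat; lia.
    + by rewrite /= (same_reg sm4) // (same_reg sm3) // (same_reg sm2).
    + by rewrite /= (same_reg sm4) // (same_reg sm3) // (same_reg sm2) // (same_reg sm1) // em
      subn1.
  + by nia.
by rewrite /enc /= size_cat (size_flatten_words sws) ssc; lia.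
Qed.

Arguments enc : simpl never.

Lemma enum_split m (done : seq 'I_m) x todo :
  done ++ x :: todo = enum 'I_m -> size done = x.
Proof.
move=> e; have := congr1 (map val) e; rewrite val_enum_ord map_cat /=.
by move/iota_split; rewrite size_map.
Qed.

Definition Filter D :=
  (Const 11 0 ;; Const 17 0 ;; Const 23 6) ;;
  (Copy 10 11 11 17 23 ;;
   ((Mov 19 8 ;; Const 25 0) ;; While 19 (Block D))).

Lemma WFilterP D : subpred (writes_reg (Filter D)) WBlock.
Proof.
move=> r; rewrite /Filter /Block /=.
repeat (case/orP); try (by move/eqP=> ->); try by [].
all: try by move/writes_reg_decider; rewrite /WBlock => ->; rewrite orbT.
Qed.

Lemma query_free_Filter D : query_free (Filter D). Proof. by rewrite /= query_free_relocate. Qed.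

Lemma filter_spec O D st hdr m (F : 'I_m -> seq (seq nat) * seq nat) q l c b (j : 'I_m) :
  let X := encs hdr [seq F i | i <- enum 'I_m] in
  size hdr = 6 -> holds st 10 0 X ->
  reg st 5 = l -> reg st 6 = q -> reg st 8 = m -> reg st 9 = q.+1 ->
  (forall i, size (F i).2 = l) ->
  (forall i, all (fun x => size x == q.+1) (F i).1) -> q + 6 <= c ->
  reg st 24 = j.+1 ->
  (forall x, x \in (F j).1 ->
    runs_in no_oracle D (take 5 hdr ++ head 0 x :: [seq arr st 1 i | i <- behead x]) c
    (fun s => (reg s 0 != 0) = b x)) ->
  let F' i := ([seq x <- (F i).1 | (i == j) ==> ~~ b x], (F i).2) in
  wp O (Filter D) st (40 * size X + 30 + size (F j).1 * (12 * c)) (fun st' =>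
    out st' 11 17 (encs hdr [seq F' i | i <- enum 'I_m])).
Proof.
move=> X sh hX e5 e6 e8 e9 sF2 sF1 qc e24 run F'.
have /holds_cat[hh hbl] : holds st 10 0 X by [].
(* The header of an instance ends with m, which is not part of the input of the decider. *)
have hh5 : holds st 10 0 (take 5 hdr).
  by move: hh; rewrite -{1}(cat_take_drop 5 hdr) holds_cat => -[].
have sh5 : size (take 5 hdr) = 5 by rewrite size_take sh.
set S := size (flatten [seq enc (F i) | i <- enum 'I_m]).
have sX : size X = 6 + S by rewrite /X /encs size_cat sh -map_comp.
apply: (@wp_seqf _ _ _ _ 3 (40 * S + 100 + size (F j).1 * (12 * c)) _ (fun st1 =>
  [/\ reg st1 11 = 0, reg st1 23 = size hdr & out st1 11 17 [::]])) => //; last by lia.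
  by apply: wp_straight => //=; rewrite sh.
move=> st1 sm1 [e11 e23 oY].
have hh1 : holds st1 10 (reg st1 11) hdr.
  by rewrite e11; apply: holds_ext hh => i; rewrite (same_arr _ sm1).
apply: (wp_seqf (c2 := 40 * S + 40 + size (F j).1 * (12 * c)) _ (copy_spec _ (B := 11) _ _ e23
  hh1 oY)) => //; last by lia.
move=> st2 sm2 [e11' _ oY2].
apply: (@wp_seqf _ _ _ _ 3 (40 * S + 37 + size (F j).1 * (12 * c)) _ (fun st3 =>
  [/\ reg st3 11 = 6, reg st3 19 = m, reg st3 25 = 0 & out st3 11 17 hdr])) => //; last by lia.
  apply: wp_straight => //=; split=> //=; first by rewrite e11' e11 sh.
  by rewrite (same_reg sm2) // (same_reg sm1) // e8 addn0.
move=> st3 sm3 [e11'' e19 e25 oY3].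
pose enF done := flatten [seq enc (F i) | i <- done].
pose enF' done := flatten [seq enc (F' i) | i <- done].
pose Inv (done todo : seq 'I_m) st' :=
  [/\ reg st' 19 = size todo, reg st' 25 = size done,
      reg st' 11 = 6 + size (enF done) & out st' 11 17 (hdr ++ enF' done)].
apply: (wp_loop (xs := enum 'I_m) (Inv := Inv)
  (cost := fun i => 31 * size (enc (F i)) + (i == j) * (size (F j).1 * (12 * c)))) => //.
- exact: query_free_Block.
- by move=> ? ? ? [].
- move=> done i todo st4 eq_e /(fun h => same_sub h (@WBlockP D) (@ABlockP D)) sm4 [e19' e25'
  e11d oY4].
  have r4 r : r \in [:: 5; 6; 9; 24] -> reg st4 r = reg st r.
    by rewrite !inE => /or4P[] /eqP ->; rewrite (same_reg sm4) // (same_reg sm3) // (same_reg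
      sm2) // (same_reg sm1).
  have a4 b' k : b' \in [:: 1; 10] -> arr st4 b' k = arr st b' k.
    by rewrite !inE => /orP[] /eqP ->; rewrite (same_arr _ sm4) // (same_arr _ sm3) // (same_arr
      _ sm2) // (same_arr _ sm1).
  have hw4 : holds st4 10 (reg st4 11) (enc (F i)).
    have : holds st 10 6 (enF (enum 'I_m)).
      by move: hbl; rewrite sh -map_comp.
    rewrite e11d -eq_e /enF map_cat map_cons flatten_split !holds_cat => -[_ [h _]].
    by apply: holds_ext h => k; rewrite a4.
  have hh4 : holds st4 10 0 (take 5 hdr) by apply: holds_ext hh5 => k; rewrite a4.
  have ei := enum_split eq_e.
  have eFi : F' i = ([seq x <- (F i).1 | (i == j) ==> ~~ b x], (F i).2) by [].
  move: hw4 (sF1 i) (sF2 i) (run); case eF: (F i) eFi => [ws sc] /= eFi hw4 si1 si2 run'.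
  have := block_spec O (D := D) (b := b) (ys := hdr ++ enF' done) sh5 hh4 hw4 (r4 5 isT) _ _ _
    si1 qc (r4 24 isT) erefl e19'.
  rewrite (r4 6) // (r4 9) // e5 e24 e25' ei si2 eqSS (_ : (val i == val j) = (i == j)) // => /(_
    erefl e6 e9) h.
  apply: wp_mono (h _ oY4) _ _ => [ij x xi||st5 [oY5 e11e e25e e19e]].
  + have ij' : i = j by apply: val_inj; case: ij.
    have := run' x; rewrite -ij' eF => /(_ xi); congr (runs_in _ _ (_ ++ _ :: _) _ _).
    by apply: eq_map => k; rewrite a4.
  + by rewrite leq_add2l; case: (eqVneq i j) => [ij|] //; rewrite -ij eF.
  + split=> //.
    * by rewrite size_rcons ei.
    * by rewrite e11e e11d /enF map_rcons flatten_rcons size_cat addnA eF.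
    * by rewrite /enF' map_rcons flatten_rcons catA eFi.
- by split; rewrite ?size_enum_ord // ?cats0.
(* The copying costs add up to the length of the instance, and the decider term survives for the
   single index [j]. *)
- rewrite (eq_bigr (fun i => (31 * size (enc (F i))).+1 + (i == j) * (size (F j).1 * (12 * c))))
  => [|i _]; last by rewrite addSn.
  rewrite big_split /= -big_distrl /=.
  have -> : \sum_(i <- enum 'I_m) (i == j) = 1.
    by rewrite big_enum /= (bigD1 j) //= eqxx big1 // => i /negbTE ->.
  rewrite mul1n; set Z := size (F j).1 * (12 * c); suff : \sum_(i <- enum 'I_m) (31 * (size
    (flatten (F i).1 ++ (F i).2)).+1).+1 <= 40 * S.
    by move=> hS; apply: leq_ltn_trans (leq_add hS (leqnn _)) _; lia.
  rewrite /S size_flatten /shape -map_comp sumnE big_map big_distrr /=.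
  by apply: leq_sum => i _; set z := size (_ ++ _); rewrite -/z; lia.
by move=> st' _ [_ _ _]; rewrite /encs -map_comp.
Qed.

(** * Solving a hidden problem through the union problem *)

Lemma writes_reg_solver P r : writes_reg (relocate solver_cell P) r -> 40 <= r.
Proof. by case/writes_reg_relocate=> x ->; rewrite /solver_cell; lia. Qed.

Lemma writes_arr_solver P r : writes_arr (relocate solver_cell P) r -> 40 <= r.
Proof. by case/writes_arr_relocate=> x ->; rewrite /solver_cell; lia. Qed.

(** Two copies are made: the solver may overwrite its input in array 40, and [Filter] reads the old
    instance from array 10 while it writes the new one to array 11. *)
Definition Solve P :=
  (Const 10 0 ;; Const 22 0 ;; Mov 23 17) ;;
  (Copy 11 22 10 10 23 ;;
   ((Const 22 0 ;; Const 28 0 ;; Mov 23 17) ;;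
    (Copy 11 22 40 28 23 ;; relocate solver_cell P))).

Definition WSolve : pred nat := fun r => (r \in [:: 1; 10; 22; 23; 28]) || (40 <= r).
Definition ASolve : pred nat := fun r => (r == 10) || (40 <= r).

Lemma solve_spec O P st X t post :
  out st 11 17 X -> runs_in no_oracle P X t post -> size X <= t ->
  wp O (Solve P) st (30 * t + 20) (fun st' =>
    [/\ same WSolve ASolve st st', out st' 10 10 X, out st' 11 17 X &
        exists2 s, agree solver_cell st' s & post s]).
Proof.
move=> oY run Xt.
have nq : query_free (Solve P) by rewrite /= query_free_relocate.
suff [k [st' [ex lek [? ? ?]]]] : wp O (Solve P) st (30 * t + 20) (fun st' =>
    [/\ out st' 10 10 X, out st' 11 17 X & exists2 s, agree solver_cell st' s & post s]).
  exists k, st'; split=> //; split=> //.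
  apply: same_sub (exec_same nq ex) _ _ => r /=.
    repeat (case/orP); try (by move/eqP=> ->); try by [].
    by move/writes_reg_solver; rewrite /WSolve => ->; rewrite orbT.
  repeat (case/orP); try (by move/eqP=> ->); try by [].
  by move/writes_arr_solver; rewrite /ASolve => ->; rewrite orbT.
apply: (@wp_seqf _ _ _ _ 4 (30 * t + 16) _ (fun st1 =>
  [/\ reg st1 22 = 0, reg st1 23 = size X, out st1 10 10 [::] & out st1 11 17 X])) => //; last by
    lia.
  by apply: wp_straight => //=; split=> //=; case: oY => ->; rewrite addn0.
move=> st1 sm1 [e22 e23 oX1 oY1].
have hY1 : holds st1 11 (reg st1 22) X by rewrite e22; case: oY1.
apply: (wp_seqf (c2 := 20 * t + 15) _ (copy_spec _ (B := 10) _ _ e23 hY1 oX1)) => //; last by lia.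
move=> st2 sm2 [_ _ oX2].
have oY2 : out st2 11 17 X.
  case: oY1 => o1 o2; split; first by rewrite (same_reg sm2).
  by apply: holds_ext o2 => i; rewrite (same_arr _ sm2).
apply: (@wp_seqf _ _ _ _ 4 (20 * t + 11) _ (fun st3 =>
  [/\ reg st3 22 = 0, reg st3 23 = size X, out st3 10 10 X, out st3 11 17 X & out st3 40 28
    [::]])) => //; last by lia.
  by apply: wp_straight => //=; split=> //=; case: oY2 => ->; rewrite addn0.
move=> st3 sm3 [e22' e23' oX3 oY3 oP3].
have hY3 : holds st3 11 (reg st3 22) X by rewrite e22'; case: oY3.
apply: (wp_seqf (c2 := t) _ (copy_spec _ (B := 40) _ _ e23' hY3 oP3)) => //; last by lia.
move=> st4 sm4 [_ _ [_ oP4]].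
have [k [st5 [ex lek q]]] := call_spec O solver_cell_inj run oP4.
have sm5 := exec_same (query_free_relocate solver_cell P) ex.
have {}sm5 : same (leq 40) (leq 40) st4 st5.
  by apply: same_sub sm5 _ _ => r; [apply: writes_reg_solver | apply: writes_arr_solver].
exists k, st5; split=> //; split=> //.
  case: oX3 => o1 o2; split; first by rewrite (same_reg sm5) // (same_reg sm4).
  by apply: holds_ext o2 => i; rewrite (same_arr _ sm5) // (same_arr _ sm4).
case: oY3 => o1 o2; split; first by rewrite (same_reg sm5) // (same_reg sm4).
by apply: holds_ext o2 => i; rewrite (same_arr _ sm5) // (same_arr _ sm4).
Qed.

(** * Unions of pairs as relations of the union problem *)

Section Unions.
Variables (S : csp) (n : nat).
Local Notation US := (Ucsp (Ecsp S)).

(** A single pair denotes the member of E(R) given by a one-element index set, so a list of pairs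
    denotes a union of members. *)
Lemma basics_union_mem (L : basics S n) : basics_union L \in ctype US n.
Proof.
rewrite type_U; apply/imsetP.
exists [set rel_at (Defs.rel kt.1) kt.2 | kt : constraint S n in L].
  rewrite powersetE; apply/subsetP => X /imsetP[kt _ ->].
  rewrite type_E; apply/bigcupP; exists (Defs.rel kt.1); first exact: imset_f.
  by apply/imsetP; exists [set kt.2]; rewrite // /rel_on big_set1.
apply/setP => a; rewrite /basics_union /cover; apply/idP/bigcupP.
  rewrite -(big_map _ xpredT id) /=.
  elim: L => [|kt L IH]; rewrite ?big_nil ?inE // big_cons inE.
  case/orP => [h|/IH[X /imsetP[kt' k' ->] h]].
    by exists (rel_at (Defs.rel kt.1) kt.2) => //; apply: imset_f; rewrite inE eqxx.
  by exists (rel_at (Defs.rel kt'.1) kt'.2) => //; apply: imset_f; rewrite inE k' orbT.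
case=> X /imsetP[kt kL ->] h.
elim: L kL => // kt' L IH; rewrite inE big_cons inE => /orP[/eqP <-|/IH ->].
  by rewrite h.
by rewrite orbT.
Qed.

Lemma in_basics_union (L : basics S n) (a : asg S n) :
  (a \in basics_union L) = (a \in adm S n) && has (fun kt => sat1 kt a) L.
Proof.
rewrite /basics_union; elim: L => [|kt L IH].
  by rewrite big_nil inE andbF.
by rewrite big_cons inE IH inE -andb_orr.
Qed.

Lemma uniq_ord_tuple l : uniq (ord_tuple l).
Proof. by rewrite /= enum_uniq. Qed.

(** On this scope a constraint holds for exactly the assignments in its relation, by
    [project_id]. *)
Definition id_scope : scopes US n := exist _ (ord_tuple (len S n)) (uniq_ord_tuple _).

Lemma project_id (a : asg S n) : project a id_scope = a.
Proof. by apply: eq_from_tnth => i; rewrite tnth_mktuple tnth_ord_tuple. Qed.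

Lemma word_id : word (val id_scope) = iota 0 (len S n).
Proof. by rewrite /word /= val_enum_ord. Qed.

Definition enc_pair (kt : constraint S n) := val kt.1 :: word (val kt.2).

Lemma word_inj w l : injective (@word w l).
Proof. by move=> a b /(inj_map val_inj)/val_inj. Qed.

Lemma enc_pair_inj : injective enc_pair.
Proof.
by move=> [k t] [k' t'] [/val_inj -> /word_inj/val_inj ->].
Qed.

Lemma size_word w l (a : l.-tuple 'I_w) : size (word a) = l.
Proof. by rewrite size_map size_tuple. Qed.

Lemma nth_word w l (a : l.-tuple 'I_w) (i : 'I_l) : nth 0 (word a) i = tnth a i.
Proof.
by rewrite (nth_map (tnth a i)) ?size_tuple // -tnth_nth.
Qed.

End Unions.

(** * Longest chains inside a set *)

Section Height.
Variables (T : finType) (RR : {set {set T}}).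

Definition below (U : {set T}) (F : {set {set T}}) :=
  (F \subset RR) && chain F && [forall A in F, A \subset U].

(** A local form of [dim]: it turns the number of times that a union can shrink into a quantity
    depending only on the present union, which can be summed over the constraints. *)
Definition height (U : {set T}) := \max_(F | below U F) #|F|.

Lemma leq_height U F : below U F -> #|F| <= height U.
Proof. exact: (@leq_bigmax_cond _ (below U) (fun F : {set {set T}} => #|F|)). Qed.

Lemma height_dim U : height U <= dim RR.
Proof.
apply/bigmax_leqP => F /andP[h _].
exact: (@leq_bigmax_cond _ (fun F : {set {set T}} => (F \subset RR) && chain F) (fun F : {set
  {set T}} => #|F|)).
Qed.

(** Every chain inside [U] can be extended by [V] on top; [V] is not yet a member, since it is not
    contained in [U]. *)
Lemma height_lt (U V : {set T}) : V \in RR -> U \proper V -> height U < height V.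
Proof.
move=> VR /andP[sUV nVU].
have lt (F : {set {set T}}) :
    below U F -> #|F| < height V.
  move=> /andP[/andP[sF cF] /forall_inP uF].
  have VF : V \notin F by apply: contra nVU => /uF.
  have uV A : A \in V |: F -> A \subset V.
    by case/setU1P=> [-> // | /uF h]; apply: subset_trans sUV.
  have -> : #|F|.+1 = #|V |: F| by rewrite cardsU1 VF add1n.
  apply: leq_height; apply/andP; split; last by apply/forall_inP.
  apply/andP; split; first by rewrite subUset sub1set VR.
  apply/forall_inP => A AF; apply/forall_inP => B BF.
  case/setU1P: (AF) => [-> | AF']; first by rewrite uV // orbT.
  case/setU1P: (BF) => [-> | BF']; first by rewrite uV.
  exact: (forall_inP (forall_inP cF _ AF')).
(* The empty chain gives positivity, so that the predecessor of [height V] can bound all chains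
   below [U]. *)
have pos : 0 < height V.
  apply: leq_ltn_trans (lt set0 _) => //; rewrite /below sub0set /=.
  by apply/andP; split; apply/forall_inP => A; rewrite inE.
by rewrite -(prednK pos) ltnS; apply/bigmax_leqP => F /lt h; rewrite -ltnS (prednK pos).
Qed.

Lemma height_gt0 U : U \in RR -> 0 < height U.
Proof.
move=> UR; apply: leq_trans (_ : #|[set U]| <= _); first by rewrite cards1.
apply: leq_height; rewrite /below sub1set UR /=; apply/andP; split; apply/forall_inP => A /set1P ->.
  by apply/forall_inP => B /set1P ->; rewrite subxx.
exact: subxx.
Qed.
End Height.

(** * The elimination loop on a fixed hidden instance *)

Section Hidden.
Variables (S : csp) (n m : nat).
Hypothesis m_gt0 : 0 < m.
Local Notation US := (Ucsp (Ecsp S)).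
Local Notation l := (len S n).
Local Notation q := (arity S n).

Definition union_index (L : basics S n) : 'I_(nrel US n) :=
  enum_rank_in (eq_ind _ (fun A : {set {set asg S n}} => basics_union L \in A)
    (basics_union_mem L) _ (type_U (Ecsp S) n)) (basics_union L).

Lemma rel_union_index L : Defs.rel (union_index L) = basics_union L.
Proof.
have h : basics_union L \in union_closure (ctype (Ecsp S) n).
  by rewrite -(type_U (Ecsp S) n) basics_union_mem.
by rewrite /= /union_index enum_rankK_in.
Qed.

Definition current (Ls : 'I_m -> basics S n) : instance US n m :=
  [tuple (union_index (Ls i), id_scope S n) | i < m].

Lemma sat_current Ls (a : asg S n) :
  sat (current Ls) a = (a \in adm S n) && [forall i, has (fun kt => sat1 kt a) (Ls i)].
Proof.
rewrite /sat; case: (boolP (a \in _)) => //= adm_a; apply: eq_forallb => i.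
rewrite tnth_mktuple /sat1 /= -[enum_val _]/(Defs.rel (union_index (Ls i))).
by rewrite rel_union_index project_id in_basics_union adm_a.
Qed.

Definition hdr := std_header S n ++ [:: m].

Definition blocks Ls (i : 'I_m) : seq (seq nat) * seq nat :=
  (map (@enc_pair S n) (Ls i), iota 0 l).

Definition current_word Ls := encs hdr [seq blocks Ls i | i <- enum 'I_m].

Lemma presents_current Ls : (forall i, uniq (Ls i)) ->
  presents (UE_pres S) (current Ls) (current_word Ls).
Proof.
move=> u; exists (fun i => basics_word (Ls i)).
  move=> i; rewrite tnth_mktuple; exists (Ls i).
  by rewrite rel_union_index.
rewrite /current_word /encs /hdr -catA; congr (_ ++ _ :: flatten _).
rewrite -map_comp; apply: eq_map => i.
by rewrite tnth_mktuple /= /enc /basics_word /= size_map -(word_id S n).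
Qed.

Lemma size_enc_pair (kt : constraint S n) : size (enc_pair kt) = q.+1.
Proof. by rewrite /= size_word. Qed.

Lemma size_current_word Ls :
  size (current_word Ls) = 6 + \sum_(i < m) (size (Ls i) * q.+1 + l).+1.
Proof.
rewrite /current_word /encs size_cat; congr (_ + _).
rewrite -map_comp size_flatten /shape -map_comp sumnE big_map big_enum /=.
apply: eq_bigr => i _; rewrite /enc /= size_cat size_iota; congr (_ + _).+1.
elim: (Ls i) => //= kt L IH; by rewrite size_cat size_word IH mulSn.
Qed.

Lemma len_current_word Ls (j : 'I_m) : size (Ls j) * q.+1 + l <= size (current_word Ls).
Proof. by rewrite size_current_word (bigD1 j) //=; lia. Qed.

Variables (P D : prog) (T M : nat).
Hypothesis run_P : forall (C : instance US n m) x,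
  presents (UE_pres S) C x -> runs_in no_oracle P x T (solved C).
Hypothesis run_D : forall (k : 'I_(nrel S n)) (u : tup S n),
  runs_in no_oracle D (std_header S n ++ [:: val k] ++ word u) M
    (fun st => (reg st 0 != 0) = (u \in Defs.rel k)).

(** This is what pays for copying: a time bound is also a bound for the input. [runs_in] asserts
    something only about initial states, so one that contains [x] is exhibited. *)
Lemma runs_in_size O p x t post : runs_in O p x t post -> size x <= t.
Proof.
move=> /(_ (State (fun=> 0) (fun _ i => nth 0 x i) [::])) [|k [st' [_ le_t _]]].
  by split=> //; rewrite /read /= mkseq_nth.
exact: leq_trans (leq_addr _ _) le_t.
Qed.

Lemma current_word_size Ls : (forall i, uniq (Ls i)) -> size (current_word Ls) <= T.
Proof. by move=> u; apply: runs_in_size (run_P (presents_current u)). Qed.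

Variables (C0 : instance S n m) (O : oracle).
Hypothesis rev : revealing C0 O.

(** Every hidden constraint is still on its list, so a negative answer for the current instance
    transfers to the hidden one; [uniq] keeps the lists presentable. *)
Definition good (Ls : 'I_m -> basics S n) :=
  forall i, uniq (Ls i) /\ tnth C0 i \in Ls i.

Lemma sat_good Ls a : good Ls -> sat C0 a -> sat (current Ls) a.
Proof.
move=> g; rewrite sat_current /sat => /andP[-> /forallP h] /=.
by apply/forallP => i; apply/hasP; exists (tnth C0 i); [case: (g i) | apply: h].
Qed.

Definition refine (Ls : 'I_m -> basics S n) (j : 'I_m) a i :=
  if i == j then [seq kt <- Ls i | ~~ sat1 kt a] else Ls i.

(** Only pairs satisfied by [a] are deleted, while the hidden j-th constraint is violated by [a]. *)
Lemma refine_good Ls j a : good Ls -> ~~ sat1 (tnth C0 j) a -> good (refine Ls j a).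
Proof.
move=> g ns i; have [u t] := g i; rewrite /refine.
case: eqP => // e; split; first exact: filter_uniq.
by rewrite mem_filter t e ns.
Qed.

Definition potential (Ls : 'I_m -> basics S n) :=
  \sum_i height (ctype US n) (basics_union (Ls i)).

(** The inclusion is proper because of [a] itself: as a solution it lies in the j-th union, but it
    satisfies no pair that is kept. *)
Lemma potential_refine Ls j a : sat (current Ls) a -> potential (refine Ls j a) < potential Ls.
Proof.
rewrite sat_current => /andP[adm_a /forallP h].
rewrite /potential (bigD1 j) //= [X in _ < X](bigD1 j) //= /refine eqxx.
rewrite (eq_bigr (fun i => height (ctype US n) (basics_union (Ls i)))) => [|i /negbTE -> //].
rewrite ltn_add2r; apply: height_lt; first exact: basics_union_mem.
apply/andP; split.
  apply/subsetP => b; rewrite !in_basics_union => /andP[-> /hasP[kt]] /=.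
  by rewrite mem_filter => /andP[_ ktL] hb; apply/hasP; exists kt.
apply/subsetPn; exists a; rewrite in_basics_union adm_a ?h //=.
by apply/hasPn => kt; rewrite mem_filter => /andP[].
Qed.

(** The candidate is moved to array 1, where it serves as the query and, if accepted, already is the
    output. Register 29 is the flag of the outer loop. *)
Definition Iter :=
  Solve P ;;
  If 40
    ((Const 22 0 ;; Const 28 0 ;; Mov 23 5) ;;
     (Copy 42 22 1 28 23 ;;
      (Query 24 1 5 ;; If 24 (Filter D) (Const 0 1 ;; Const 29 0))))
    (Const 0 0 ;; Const 29 0).

Definition inv Ls st :=
  [/\ reg st 5 = l, reg st 6 = q, reg st 8 = m, reg st 9 = q.+1 &
      out st 11 17 (current_word Ls)].

Definition bound := 200 * (T + nrel S n * #|{: scopes S n}| * M + 1).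

Lemma size_basics (L : basics S n) : uniq L -> size L <= nrel S n * #|{: scopes S n}|.
Proof.
move=> /card_uniqP <-.
have -> : nrel S n * #|{: scopes S n}| = #|{: constraint S n}| by rewrite card_prod card_ord.
exact: max_card.
Qed.

Lemma wp_query st c x a y v Q :
  O (hist st) (read st a (reg st y)) = Some v ->
  Q (set_hist (set_reg st x v) (read st a (reg st y) :: hist st)) -> 0 < c ->
  wp O (Query x a y) st c Q.
Proof. by move=> hO q0 c0; exists 1; eexists; split; [apply: ExQuery hO | |]. Qed.

Lemma word_project (a : asg S n) (t : scopes S n) :
  word (project a t) = [seq nth 0 (word a) i | i <- word (val t)].
Proof.
apply: (@eq_from_nth _ 0) => [|i]; rewrite size_word ?size_map ?size_tuple // => lti.
rewrite (nth_map 0) ?size_word // (nth_word _ (Ordinal lti)) (nth_word (val t) (Ordinal lti)).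
by rewrite nth_word tnth_mktuple.
Qed.

Lemma iter_spec Ls st : good Ls -> inv Ls st ->
  wp O Iter st bound (fun st' =>
    (reg st' 29 = 0 /\ solved C0 st') \/
    (exists Ls', [/\ good Ls', inv Ls' st', reg st' 29 = reg st 29 & potential Ls' < potential
      Ls])).
Proof.
move=> g [e5 e6 e8 e9 oY].
have u i : uniq (Ls i) by case: (g i).
have sT := current_word_size u.
have nq : query_free (Solve P) by rewrite /= query_free_relocate.
apply: (@wp_seqf _ _ _ _ (30 * T + 20) (bound - (30 * T + 20)) _ _ _ nq (solve_spec O oY (run_P
  (presents_current u)) sT)); last first.
  by rewrite /bound; lia.
move=> st1 _ [sm1 oX1 oY1 [s ag sol]].
have e40 : reg st1 40 = reg s 0 by apply: (ag.1 0).
have -> : bound - (30 * T + 20) = (170 * T + 200 * (nrel S n * #|{: scopes S n}| * M) + 179).+1.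
  by rewrite /bound; lia.
apply: wp_if => h40; last first.
  apply: wp_straight => //; first by rewrite /=; lia.
  left; split=> //; left; split=> // a.
  rewrite h40 in e40; case: sol => -[e0 h].
    by apply: contra (h a); apply: sat_good.
  by rewrite -e40 in e0.
case: sol => -[e0 h]; first by rewrite e40 e0 in h40.
have {h} [a sat_a ra] : exists2 a : asg S n, sat (current Ls) a & read s 1 l = word a := h.
have sa : size (word a) = l by apply: size_word.
have adm_a : a \in adm S n by move: sat_a; rewrite sat_current => /andP[].
have lT : l <= T.
  apply: leq_trans sT; apply: leq_trans (len_current_word Ls (Ordinal m_gt0)).
  exact: leq_addl.
apply: (@wp_seqf _ _ _ _ 4 (160 * T + 200 * (nrel S n * #|{: scopes S n}| * M) + 160) _ (fun st2 =>
  [/\ reg st2 22 = 0, reg st2 23 = size (word a) & out st2 1 28 [::]])) => //; last by lia.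
  by apply: wp_straight => //=; rewrite (same_reg sm1) // e5 addn0 size_word.
move=> st2 sm2 [e22 e23 o1].
have ha2 : holds st2 42 (reg st2 22) (word a).
  rewrite e22; apply/holds_read; rewrite size_word -ra.
  apply: eq_mkseq => i; rewrite (same_arr _ sm2) //; exact: (ag.2 1).
apply: (wp_seqf (c2 := 150 * T + 200 * (nrel S n * #|{: scopes S n}| * M) + 159) _ (copy_spec _
  (B := 1) _ _ e23 ha2 o1)) => //; last first.
  by rewrite sa; lia.
move=> st3 sm3 [_ _ [_ ha3]].
have r3 r : r \in [:: 5; 6; 8; 9; 29] -> reg st3 r = reg st r.
  by rewrite !inE => /or4P[|||/orP[|]] /eqP ->; rewrite (same_reg sm3) // (same_reg sm2) //
    (same_reg sm1).
have a3 b i : b \in [:: 10; 11] -> arr st3 b i = arr st1 b i.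
  by rewrite !inE => /orP[] /eqP ->; rewrite (same_arr _ sm3) // (same_arr _ sm2).
have rd3 : read st3 1 (reg st3 5) = word a.
  by rewrite r3 // e5 -[in LHS]sa; apply/holds_read.
have oX3 : out st3 10 10 (current_word Ls).
  case: oX1 => o1' o2; split; first by rewrite (same_reg sm3) // (same_reg sm2).
  by apply: holds_ext o2 => i; rewrite a3.
apply: (wp_seq (c1 := 1) (c2 := 150 * T + 200 * (nrel S n * #|{: scopes S n}| * M) + 158)); last
  by lia.
have := rev.1 (hist st3) a adm_a; case: ifP => [sat0 hO | nsat [j nsj hO]].
  apply: wp_query; first by rewrite rd3; exact: hO.
    rewrite addnS; apply: wp_if => //= _; apply: wp_straight => //; first by rewrite /=; lia.
    left; split=> //; right; split=> //; exists a => //.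
    by rewrite /read /= -/(read st3 1 l) -[in LHS]sa; apply/holds_read.
  by [].
apply: wp_query; first by rewrite rd3; exact: hO.
  set st4 := set_hist _ _.
  rewrite addnS; apply: wp_if => // _.
  (* [filter_spec] speaks of words, so satisfaction is carried over from pairs; it is well defined
     since [enc_pair] is injective. *)
  pose b (x : seq nat) := has (fun kt => (enc_pair kt == x) && sat1 kt a) (Ls j).
  have bE kt : kt \in Ls j -> b (enc_pair kt) = sat1 kt a.
    move=> ktL; apply/hasP/idP => [[kt' _ /andP[/eqP/enc_pair_inj -> //]]|h].
    by exists kt; rewrite ?eqxx.
  (* The decider reads five parameters, one relation index and q values. *)
  have qM : q + 6 <= M.
    have := runs_in_size (@run_D (tnth C0 j).1 (project a (tnth C0 j).2)).
    by rewrite !size_cat /= size_word; lia.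
  have := @filter_spec O D st4 hdr m (blocks Ls) q l M b j.
  rewrite /= !r3 // e5 e6 e8 e9; case: oX3 => _ hX3 /(_ erefl hX3 erefl erefl erefl erefl) h.
  have {}h := h (fun i => size_iota 0 l) _ qM erefl _.
  have [i|x /mapP[kt ktL ->]|k [st5 [ex lek o5]]] := h _ _.
  - by apply/allP => x /mapP[kt _ ->]; rewrite size_enc_pair.
  - rewrite bE //; have := @run_D kt.1 (project a kt.2).
    rewrite word_project; congr (runs_in _ _ (_ ++ _ :: _) _ _).
    apply/eq_in_map => i /mapP[v _ ->].
    by rewrite -[arr st3 1 _]/(arr st3 1 (0 + val v)) ha3 //= sa.
  exists k, st5; split=> //.
    apply: leq_trans lek _.
    have sX : 6 + size (flatten [seq enc i | i <- [seq blocks Ls i | i <- enum 'I_m]]) <= T by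
      exact: sT.
    have sL : size (Ls j) * M <= nrel S n * #|{: scopes S n}| * M.
      by rewrite leq_mul2r size_basics ?orbT.
    rewrite size_map mulnCA; move: sX sL.
    by move: (size (flatten _)) (size _ * M) (_ * _ * M) => X L G; lia.
  right; exists (refine Ls j a).
  have sm5 := same_sub (exec_same (query_free_Filter D) ex) (@WFilterP D) (fun b h => h).
  split.
  - exact: refine_good.
  - split; try by rewrite (same_reg sm5) //= r3.
    rewrite /current_word; congr (out _ _ _ (encs _ _)): o5; apply: eq_map => i.
    rewrite /blocks /refine; case: eqP => [->|_] /=; last by rewrite filter_predT.
    rewrite filter_map; congr (map _ _, _); apply: eq_in_filter => kt ktL /=.
    by rewrite bE.
  - by rewrite (same_reg sm5) //= r3.
  - exact: potential_refine.
by [].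
Qed.

(** A union, being a relation of the union problem, is a chain of one member inside itself, even
    when it is empty. *)
Lemma potential_gt0 Ls : 0 < potential Ls.
Proof.
rewrite /potential (bigD1 (Ordinal m_gt0)) //= addn_gt0 height_gt0 //.
exact: basics_union_mem.
Qed.

Lemma potential_dim Ls : potential Ls <= m * dim (ctype US n).
Proof.
rewrite -[X in X * _](card_ord m) -sum_nat_const.
by apply: leq_sum => i _; apply: height_dim.
Qed.

(** Induction on a bound for the potential. Its value is never 0, so the base case is void and at
    most [p] rounds are run, the final one included. *)
Lemma loop_spec p Ls st : potential Ls <= p -> good Ls -> inv Ls st -> reg st 29 = 1 ->
  wp O (While 29 Iter) st (p * bound.+1).+1 (solved C0).
Proof.
elim: p Ls st => [|p IH] Ls st; first by rewrite leqNgt potential_gt0.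
move=> le_p g i e29.
have [k1 [st1 [ex1 le1 [[e29' sol]|[Ls' [g' i' e29' lt]]]]]] := iter_spec g i.
  exists (k1 + 1).+1, st1; split=> //; last by rewrite mulSn; lia.
  by apply: ExWhileT ex1 _; [rewrite e29 | apply: ExWhileF].
have [|k2 [st2 [ex2 le2 q2]]] := IH Ls' st1 _ g' i' (etrans e29' e29).
  by rewrite -ltnS (leq_trans lt le_p).
exists (k1 + k2).+1, st2; split=> //; last by rewrite mulSn; lia.
by apply: ExWhileT ex1 ex2; rewrite e29.
Qed.

(** Passes from words of numbers to typed pairs: the enumeration is the image of a duplicate-free
    list of all pairs. *)
Lemma pair_words_basics : exists L : basics S n,
  [/\ map (@enc_pair S n) L = pair_words l (nrel S n) q, uniq L & forall kt, kt \in L].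
Proof.
have lift ws : {in ws, forall x, exists kt, @enc_pair S n kt = x} ->
    exists L, map (@enc_pair S n) L = ws.
  elim: ws => [|x ws IH] h; first by exists [::].
  have [kt <-] := h x (mem_head _ _); have [|L <-] := IH; last by exists (kt :: L).
  by move=> y yws; apply: h; rewrite inE yws orbT.
have [x xl|L eL] := lift (pair_words l (nrel S n) q).
  have hk := pair_words_head xl; have := allP (all_pair_words _ _ _) x xl.
  case: x hk xl => // k ts /= ks _ /and3P[/eqP[sz] u /allP lts].
  pose t := pmap insub ts : seq 'I_l.
  have et : map val t = ts.
    rewrite /t pmap_filter; last exact: insubK.
    by apply/all_filterP/allP => v /lts vl; rewrite insubT.
  have st : size t == q by rewrite -(size_map val) et sz.
  have ut : uniq (Tuple st) by rewrite /= -(map_inj_uniq val_inj) et.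
  by exists (Ordinal ks, exist _ (Tuple st) ut); rewrite /enc_pair /word /= et.
exists L; split=> //; first by rewrite -(map_inj_uniq (@enc_pair_inj S n)) eL uniq_pair_words.
move=> kt; rewrite -(mem_map (@enc_pair_inj S n)) eL mem_pair_words ?size_word ?ltn_ord //.
  by rewrite /word map_inj_uniq ?(valP kt.2) //; apply: val_inj.
by apply/allP => v /mapP[i _ ->]; apply: ltn_ord.
Qed.

Definition ProgA := Params ;; (Levels ;; (Build ;; (Const 29 1 ;; While 29 Iter))).

Lemma progA_spec st : initial hdr st ->
  wp O ProgA st (800 * T + m * dim (ctype US n) * bound.+1) (solved C0).
Proof.
case=> hr _; have hh : holds st 0 0 hdr by apply/holds_read.
(* The mere existence of a constraint shows that there is a relation and that q distinct variables
   exist, as the cost estimate of the enumeration requires. *)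
have c0 := tnth C0 (Ordinal m_gt0).
have s0 : 0 < nrel S n by apply: leq_ltn_trans (ltn_ord c0.1).
have ql : q <= l.
  have /card_uniqP := valP c0.2; rewrite size_tuple => <-.
  by rewrite -[X in _ <= X](card_ord l) max_card.
have [L [eL uL cL]] := pair_words_basics; pose Ls (_ : 'I_m) := L.
have g : good Ls by move=> i; split.
have sT : size (current_word Ls) <= T by apply: current_word_size.
have sL := len_current_word Ls (Ordinal m_gt0).
have sN : size L = size (pair_words l (nrel S n) q) by rewrite -eL size_map.
have T6 : 6 <= T by apply: leq_trans sT; rewrite size_cat leq_addr.
pose K := m * dim (ctype US n) * bound.+1.
apply: (@wp_seqf _ _ _ _ 14 (700 * T + 2 + K) _ (fun st1 =>
  [/\ reg st1 5 = l, reg st1 6 = q, reg st1 7 = nrel S n, reg st1 8 = m & reg st1 9 = q.+1])) =>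
    //; last by rewrite -/K; lia.
  apply: wp_straight => //=.
  by rewrite !(hh 2, hh 3, hh 4, hh 5) //= addn1.
move=> st1 sm1 [e5 e6 e7 e8 e9].
(* The listing consists of [size L * q.+1] cells and is part of an input of the union solver, so its
   length is at most T. *)
apply: (wp_seqf (c2 := 100 * T + 2 + K) _ (levels_spec O e5 e6 e7 s0 ql)) => //; last first.
  have h : size L * q.+1 <= T by apply: leq_trans sT; apply: leq_trans sL; apply: leq_addr.
  by rewrite -sN [q.+1 * _]mulnC; move: (size L * q.+1) h K => X h K; lia.
move=> st2 sm2 [oX e14].
have hh2 : holds st2 0 0 hdr.
  by apply: holds_ext hh => i; rewrite (same_arr _ sm2) // (same_arr _ sm1).
have e5' : reg st2 5 = l by rewrite (same_reg sm2).
have e8' : reg st2 8 = m by rewrite (same_reg sm2).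
have eW : encs hdr (nseq m (pair_words l (nrel S n) q, iota 0 l)) = current_word Ls.
  rewrite /current_word /blocks /Ls eL; congr encs.
  by rewrite -[in LHS](size_enum_ord m); elim: (enum _) => //= i xs ->.
have := @build_spec O _ _ _ hdr _ erefl hh2 e5' e8' oX e14; rewrite eW => hB.
apply: (wp_seqf (c2 := 2 + K) _ hB) => //; last by lia.
move=> st3 sm3 oY.
apply: (@wp_seqf _ _ _ _ 1 K.+1 _ (fun st4 => inv Ls st4 /\ reg st4 29 = 1)) => //.
  apply: wp_straight => //; split=> //; split=> //=.
  - by rewrite (same_reg sm3).
  - by rewrite (same_reg sm3) // (same_reg sm2).
  - by rewrite (same_reg sm3).
  - by rewrite (same_reg sm3) // (same_reg sm2).
by move=> st4 _ [i4 e29]; apply: loop_spec e29 => //; apply: potential_dim.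
Qed.
End Hidden.

Lemma dim_gt0 S n : 0 < dim (ctype (Ucsp (Ecsp S)) n).
Proof.
apply: leq_trans (height_dim _ (basics_union ([::] : basics S n))).
by apply: height_gt0; apply: basics_union_mem.
Qed.

Lemma hidden_of_union (S : csp) (T : nat -> nat -> nat)
    (comp : forall n, 'I_(nrel S n) -> nat) :
  decidable_in (std_pres S) comp -> solvable (UE_pres S) T ->
  hidden_solvable_O S (fun n m =>
    (T n m + nrel S n * #|{: scopes S n}| * max_comp comp n)
      * m * dim (ctype (Ucsp (Ecsp S)) n)).
Proof.
move=> [D hD] [posT [P hP]].
set g := fun n m => _.
exists (fun n m => 2000 * g n m); first by exists 2000.
split=> [n m n0 m0|].
  by rewrite !muln_gt0 /= addn_gt0 posT // m0 dim_gt0.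
exists (ProgA P D) => n m C O n0 m0 rev st ist.
have runP (C' : instance (Ucsp (Ecsp S)) n m) x : presents (UE_pres S) C' x -> runs_in no_oracle
  P x (T n m) (solved C').
  by move=> pr; apply: hP.
have runD (k : 'I_(nrel S n)) (u : tup S n) :
    runs_in no_oracle D (std_header S n ++ [:: val k] ++ word u) (max_comp comp n)
      (fun st => (reg st 0 != 0) = (u \in Defs.rel k)).
  apply: (runs_in_mono (hD n k [:: val k] u n0 erefl)).
  exact: (@leq_bigmax _ (fun k => comp n k)).
have [k [st' [ex lek sol]]] := progA_spec m0 runP runD rev ist.
exists k, st'; split=> //; apply: leq_trans (leq_add (leqnn _) lek) _.
(* Positive T, m and dim absorb the additive costs, namely the header, the set-up and the loop
   tests, into the product. *)
have d0 := dim_gt0 S n; have T0 := posT n m n0 m0.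
rewrite /bound /g /=; move: (dim _) d0 (T n m) T0 (_ * _ * max_comp _ _) => d d0 t t0 G.
have : (t + G) * 1 <= (t + G) * (m * d) by rewrite leq_mul2l muln_gt0 m0 d0 orbT.
by nia.
Qed.

(** * Solving the union problem through a hidden problem *)

Lemma exec_hist O p st k st' : exec O p st k st' -> {subset hist st <= hist st'}.
Proof.
elim=> {p st k st'} /=; try by move=> *; exact: (fun _ h => h).
- by move=> st x a y v _ z zs; rewrite inE zs orbT.
- by move=> p1 p2 st k1 st1 k2 st2 _ s1 _ s2 z zs; apply: s2; apply: s1.
- by move=> x p st k1 st1 k2 st2 _ _ s1 _ s2 z zs; apply: s2; apply: s1.
Qed.

(** Histories only grow, so agreement on the final history covers the queries of every subrun, and
    by determinism the second run repeats the first. This carries a negative outcome from one hidden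
    instance to another. *)
Lemma exec_det O O' p st k st' : exec O p st k st' ->
  (forall h x, x \in hist st' -> O h x = O' h x) ->
  forall k2 st2, exec O' p st k2 st2 -> st2 = st'.
Proof.
elim=> {p st k st'}.
- by move=> st _ k2 st2 ex; inversion ex.
- by move=> st x v _ k2 st2 ex; inversion ex.
- by move=> st x y z _ k2 st2 ex; inversion ex.
- by move=> st x y z _ k2 st2 ex; inversion ex.
- by move=> st x a y _ k2 st2 ex; inversion ex.
- by move=> st x a y _ k2 st2 ex; inversion ex.
- move=> st x a y v hO ag k2 st2 ex; inversion ex as [| | | | | |? ? ? ? v' hO'| | | | |]; subst.
  by move: hO'; rewrite -ag ?mem_head // hO => -[->].
- move=> p1 p2 st k1 st1 k2 st2 ex1 h1 ex2 h2 ag k3 st3 ex.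
  inversion ex as [| | | | | | |? ? ? ? st4 ? ? ex3 ex4| | | |]; subst.
  have e : st4 = st1.
    by apply: h1 ex3 => h x xs; apply: ag; apply: exec_hist ex2 _ xs.
  by rewrite e in ex4; apply: h2 ex4.
- move=> x p1 p2 st k st' nz _ h ag k2 st2 ex.
  inversion ex as [| | | | | | | |? ? ? ? ? ? _ ex'|? ? ? ? ? ? z' _| |]; subst.
    exact: (h ag _ _ ex').
  by rewrite z' in nz.
- move=> x p1 p2 st k st' z _ h ag k2 st2 ex.
  inversion ex as [| | | | | | | |? ? ? ? ? ? nz' _|? ? ? ? ? ? _ ex'| |]; subst.
    by rewrite z in nz'.
  exact: (h ag _ _ ex').
- move=> x p st z ag k2 st2 ex.
  inversion ex as [| | | | | | | | | | |? ? ? ? ? ? ? nz' _ _]; subst => //.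
  by rewrite z in nz'.
- move=> x p st k1 st1 k2 st2 nz ex1 h1 ex2 h2 ag k3 st3 ex.
  inversion ex as [| | | | | | | | | |? ? ? z'|? ? ? ? st4 ? ? ? ex3 ex4]; subst.
    by rewrite z' in nz.
  have e : st4 = st1.
    by apply: h1 ex3 => h y ys; apply: ag; apply: exec_hist ex2 _ ys.
  by rewrite e in ex4; apply: h2 ex4.
Qed.

(** * Checking an assignment against all lists *)

Definition CheckBlock D A a :=
  (Const 28 0 ;; Const 22 0 ;; Const 23 5 ;; Inc 25) ;;
  (Copy A 22 41 28 23 ;;
   ((Fetch 12 A 11 ;; Const 23 1) ;;
    (While 12 (Add 23 23 9 ;; Dec 12) ;;
     (Copy A 11 41 28 23 ;;
      (Mov 23 5 ;;
       (Gather A 11 a 41 28 23 ;;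
        (relocate decider_cell D ;;
         (If 41 Skip (If 24 Skip (Mov 24 25)) ;; Dec 19)))))))).

Definition Check D A a :=
  (Const 11 6 ;; Const 24 0 ;; Const 25 0 ;; Mov 19 8) ;; While 19 (CheckBlock D A a).

(** Parity matters here: a check is run in the middle of the simulated solver, whose cells are the
    even ones from 40 on and must be preserved. *)
Definition WCheck : pred nat := fun r =>
  (r \in [:: 1; 11; 12; 19; 22; 23; 24; 25; 28]) || (40 <= r) && odd r.
Definition ACheck : pred nat := fun r => (40 <= r) && odd r.

Lemma writes_reg_decider_odd D r : writes_reg (relocate decider_cell D) r -> (40 <= r) && odd r.
Proof. by case/writes_reg_relocate=> x ->; rewrite /decider_cell oddD odd_double andbT; lia. Qed.

Lemma writes_arr_decider_odd D r : writes_arr (relocate decider_cell D) r -> (40 <= r) && odd r.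
Proof. by case/writes_arr_relocate=> x ->; rewrite /decider_cell oddD odd_double andbT; lia. Qed.

Lemma WCheckP D A a : subpred (writes_reg (Check D A a)) WCheck.
Proof.
move=> r /=; repeat (case/orP); try (by move/eqP=> ->); try by [].
all: try by move/writes_reg_decider_odd; rewrite /WCheck => ->; rewrite orbT.
Qed.

Lemma ACheckP D A a : subpred (writes_arr (Check D A a)) ACheck.
Proof.
move=> r /=; repeat (case/orP); try (by move/eqP=> ->); try by [].
all: by move/writes_arr_decider_odd.
Qed.

Lemma WCheckBlockP D A a : subpred (writes_reg (CheckBlock D A a)) WCheck.
Proof.
move=> r /=; repeat (case/orP); try (by move/eqP=> ->); try by [].
all: try by move/writes_reg_decider_odd; rewrite /WCheck => ->; rewrite orbT.
Qed.

Lemma ACheckBlockP D A a : subpred (writes_arr (CheckBlock D A a)) ACheck.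
Proof.
move=> r /=; repeat (case/orP); try (by move/eqP=> ->); try by [].
all: by move/writes_arr_decider_odd.
Qed.

Lemma query_free_CheckBlock D A a : query_free (CheckBlock D A a). Proof. by rewrite /=
  query_free_relocate. Qed.
Lemma query_free_Check D A a : query_free (Check D A a). Proof. by rewrite /=
  query_free_relocate. Qed.

(** The machine has no multiplication, so the length of the list is accumulated by one addition of q
    + 1 per pair, starting from 1 for the length cell. Register 24 is written only while it is 0,
    which makes it report the first violation. The input of the decider contains the list and the
    projected values, so [c] also pays for these operations. *)
Lemma check_block_spec O D st (A a : nat) hdr ws sc q l m c ok v :
  A != 41 -> a != 41 -> size hdr = 5 -> holds st A 0 hdr ->
  holds st A (reg st 11) (enc (ws, sc)) -> reg st 5 = l -> size sc = l ->
  reg st 9 = q.+1 -> all (fun x => size x == q.+1) ws ->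
  reg st 24 = v -> reg st 19 = m.+1 ->
  runs_in no_oracle D (hdr ++ (size ws :: flatten ws) ++ [seq arr st a i | i <- sc]) c
    (fun s => (reg s 0 != 0) = ok) ->
  wp O (CheckBlock D A a) st (40 * c) (fun st' =>
    [/\ reg st' 11 = reg st 11 + size (enc (ws, sc)),
        reg st' 24 = if ok then v else if v == 0 then (reg st 25).+1 else v,
        reg st' 25 = (reg st 25).+1 & reg st' 19 = m]).
Proof.
move=> nA na sh hh hw e5 ssc e9 sws e24 e19 run.
have A41 : (41 == A) = false by rewrite eq_sym; apply/negbTE.
have a41 : (41 == a) = false by rewrite eq_sym; apply/negbTE.
have nA' : (A == 41) = false by apply/negbTE.
have na' : (a == 41) = false by apply/negbTE.
have sc_c := runs_in_size run.
rewrite !size_cat /= size_map sh ssc (size_flatten_words sws) in sc_c.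
have cws : size ws <= size ws * q.+1 by rewrite leq_pmulr.
move: hw; rewrite /enc /= -cat_cons => /holds_cat[hw hsc].
have /holds_cons[hc _] := hw.
apply: (@wp_seqf _ _ _ _ 5 (40 * c - 5) _ (fun st1 =>
  [/\ reg st1 22 = 0, reg st1 23 = size hdr, reg st1 25 = (reg st 25).+1 & out st1 41 28 [::]]))
    => //; last by lia.
  by apply: wp_straight => //=; rewrite sh addn1.
move=> st1 sm1 [e22 e23 e25 oD].
have a1 b i : arr st1 b i = arr st b i by rewrite (same_arr _ sm1).
have hh1 : holds st1 A (reg st1 22) hdr by rewrite e22; apply: holds_ext hh.
apply: (wp_seqf (c2 := 40 * c - 51) _ (copy_spec _ (B := 41) _ _ e23 hh1 oD)) => //; last by
  rewrite sh; lia.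
move=> st2 sm2 [_ _ oD2].
have a2 b i : b != 41 -> arr st2 b i = arr st b i.
  by move=> nb; rewrite (same_arr _ sm2) //= !orbF.
apply: (@wp_seqf _ _ _ _ 2 (40 * c - 53) _ (fun st3 =>
  [/\ reg st3 12 = size ws, reg st3 23 = 1 & out st3 41 28 hdr])) => //; last by lia.
  by apply: wp_straight => //=; split=> //=; rewrite (same_reg sm2) // (same_reg sm1) // a2.
move=> st3 sm3 [e12 e23' oD3].
pose Inv (done todo : seq (seq nat)) st' :=
  [/\ reg st' 12 = size todo, reg st' 23 = (size (flatten done)).+1 & out st' 41 28 hdr].
apply: (@wp_seqf _ _ _ _ (4 * size ws + 1) (40 * c - 54 - 4 * size ws) _ (fun st4 =>
    reg st4 23 = size (size ws :: flatten ws) /\ out st4 41 28 hdr)) => //; last by lia.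
  apply: (wp_loop (xs := ws) (Inv := Inv) (cost := fun=> 3)) => //.
  - by move=> ? ? ? [].
  - move=> done x todo st4 eq_ws sm4 [e12' e23'' oD4].
    apply: wp_straight => //; split=> //=; first by rewrite e12' subn1.
    rewrite e23'' (same_reg sm4) // (same_reg sm3) // (same_reg sm2) // (same_reg sm1) // e9.
    have xw : x \in ws by rewrite -eq_ws mem_cat inE eqxx orbT.
    by rewrite flatten_rcons size_cat addSn (eqP (allP sws _ xw)).
  - by rewrite sum_const_cost; lia.
  by move=> st' _ [].
move=> st4 sm4 [e23'' oD4].
have hw4 : holds st4 A (reg st4 11) (size ws :: flatten ws).
  rewrite (same_reg sm4) // (same_reg sm3) // (same_reg sm2) // (same_reg sm1) //.
  by apply: holds_ext hw => i; rewrite (same_arr _ sm4) // (same_arr _ sm3) // a2.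
apply: (wp_seqf (c2 := 12 * l + 20 + c) _ (copy_spec _ (B := 41) _ _ e23'' hw4 oD4)) => //; last
  first.
  by rewrite /= (size_flatten_words sws); lia.
move=> st5 sm5 [e11 _ oD5].
have a5 b i : b != 41 -> arr st5 b i = arr st b i.
  by move=> nb; rewrite (same_arr _ sm5) //= ?orbF // (same_arr _ sm4) // (same_arr _ sm3) // a2.
apply: (@wp_seqf _ _ _ _ 2 (12 * l + 18 + c) _ (fun st6 =>
  reg st6 23 = size sc /\ out st6 41 28 (hdr ++ size ws :: flatten ws))) => //; last by lia.
  apply: wp_straight => //=; split=> //=.
  by rewrite (same_reg sm5) // (same_reg sm4) // (same_reg sm3) // (same_reg sm2) // (same_reg
    sm1) // e5 addn0.
move=> st6 sm6 [e23_6 oD6].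
have e11_6 : reg st6 11 = reg st 11 + size (size ws :: flatten ws).
  rewrite (same_reg sm6) // e11; congr (_ + _).
  by rewrite (same_reg sm4) // (same_reg sm3) // (same_reg sm2) // (same_reg sm1).
have hsc6 : holds st6 A (reg st6 11) sc.
  by rewrite e11_6; apply: holds_ext hsc => i; rewrite (same_arr _ sm6) // a5.
apply: (wp_seqf (c2 := 10 + c) _ (gather_spec _ (G := a) (B := 41) _ _ _ e23_6 hsc6 oD6)) => //;
  last by lia.
move=> st7 sm7 [e11_7 _ [_ oD7]].
have in7 : holds st7 (decider_cell 0) 0 (hdr ++ (size ws :: flatten ws) ++ [seq arr st a i | i <-
  sc]).
  rewrite catA; congr (holds _ _ _ (_ ++ _)): oD7; apply: eq_map => i.
  by rewrite (same_arr _ sm6) // a5.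
have r7 r : r \in [:: 5; 9; 24; 19] -> reg st7 r = reg st r.
  by rewrite !inE => /or4P[] /eqP ->; rewrite (same_reg sm7) // (same_reg sm6) // (same_reg sm5)
    // (same_reg sm4) // (same_reg sm3) // (same_reg sm2) // (same_reg sm1).
have e25_7 : reg st7 25 = (reg st 25).+1.
  by rewrite (same_reg sm7) // (same_reg sm6) // (same_reg sm5) // (same_reg sm4) // (same_reg
    sm3) // (same_reg sm2).
apply: (wp_seqf (c2 := 10) _ (call_spec O decider_cell_inj run in7)) => //; first exact:
  query_free_relocate; last by lia.
move=> st8 sm8 [s ag es].
have {}sm8 : same ACheck ACheck st7 st8.
  by apply: same_sub sm8 _ _ => r; [apply: writes_reg_decider_odd | apply: writes_arr_decider_odd].
have e41 : reg st8 41 = reg s 0 by apply: (ag.1 0).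
have e24_8 : reg st8 24 = v by rewrite (same_reg sm8) // r7.
have e25_8 : reg st8 25 = (reg st 25).+1 by rewrite (same_reg sm8).
apply: (@wp_seqf _ _ _ _ 4 2 _ (fun st9 =>
   reg st9 24 = if ok then v else if v == 0 then (reg st 25).+1 else v)) => //.
  apply: wp_if => h41; first by apply: wp_straight => //=; rewrite -es -e41 h41.
  rewrite -es -e41 h41 /= -e24_8; apply: wp_if => h24.
    by apply: wp_straight => //=; rewrite (negbTE h24).
  by apply: wp_straight => //=; rewrite h24 /= addn0.
move=> st9 sm9 e24_9; apply: wp_straight => //; split=> //=.
- rewrite (same_reg sm9) // (same_reg sm8) // e11_7 e11_6 /= size_cat; lia.
- by rewrite (same_reg sm9).
- by rewrite (same_reg sm9) // (same_reg sm8) // r7 // e19 subn1.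
Qed.

(** The convention of oracle answers: the default 0 of [head] means that nothing is violated, and
    indices are shifted by one. *)
Definition first_bad m (ok : 'I_m -> bool) (s : seq 'I_m) :=
  head 0 [seq (val i).+1 | i <- s & ~~ ok i].

Lemma first_bad_rcons m (ok : 'I_m -> bool) s i :
  first_bad ok (rcons s i) =
    if ok i then first_bad ok s else
    if first_bad ok s == 0 then i.+1 else first_bad ok s.
Proof.
rewrite /first_bad filter_rcons; case: (ok i) => //=.
by rewrite map_rcons; case: (filter _ _).
Qed.

Lemma first_badP m (ok : 'I_m -> bool) :
  (first_bad ok (enum 'I_m) = 0 /\ forall i, ok i) \/
  (exists2 i, ~~ ok i & first_bad ok (enum 'I_m) = (val i).+1).
Proof.
rewrite /first_bad; case E: [seq i <- enum 'I_m | ~~ ok i] => [|i s] /=.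
  left; split=> // i; apply/negPn/negP => nok.
  by have := mem_filter (fun i => ~~ ok i) i (enum 'I_m); rewrite E nok mem_enum.
right; exists i => //.
by have := mem_head i s; rewrite -E mem_filter => /andP[].
Qed.

Lemma check_spec O D st (A a : nat) hdr m (F : 'I_m -> seq (seq nat) * seq nat) q l c ok :
  ~~ ACheck A -> ~~ ACheck a -> size hdr = 6 ->
  holds st A 0 (encs hdr [seq F i | i <- enum 'I_m]) ->
  reg st 5 = l -> reg st 8 = m -> reg st 9 = q.+1 ->
  (forall i, size (F i).2 = l) ->
  (forall i, all (fun x => size x == q.+1) (F i).1) ->
  (forall i, runs_in no_oracle D (take 5 hdr ++
     (size (F i).1 :: flatten (F i).1) ++ [seq arr st a v | v <- (F i).2]) c
    (fun s => (reg s 0 != 0) = ok i)) ->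
  wp O (Check D A a) st (m * (40 * c + 1) + 10) (fun st' =>
    reg st' 24 = first_bad ok (enum 'I_m)).
Proof.
move=> nA na sh hX e5 e8 e9 sF2 sF1 run.
have /holds_cat[hh hbl] : holds st A 0 (encs hdr [seq F i | i <- enum 'I_m]) by [].
have hh5 : holds st A 0 (take 5 hdr).
  by move: hh; rewrite -{1}(cat_take_drop 5 hdr) holds_cat => -[].
have sh5 : size (take 5 hdr) = 5 by rewrite size_take sh.
apply: (@wp_seqf _ _ _ _ 5 (m * (40 * c + 1) + 5) _ (fun st1 =>
  [/\ reg st1 11 = 6, reg st1 24 = 0, reg st1 25 = 0 & reg st1 19 = m])) => //; last by lia.
  by apply: wp_straight => //=; rewrite e8 addn0.
move=> st1 sm1 [e11 e24 e25 e19].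
pose enF done := flatten [seq enc (F i) | i <- done].
pose Inv (done todo : seq 'I_m) st' :=
  [/\ reg st' 19 = size todo, reg st' 25 = size done,
      reg st' 11 = 6 + size (enF done) & reg st' 24 = first_bad ok done].
apply: (wp_loop (xs := enum 'I_m) (Inv := Inv) (cost := fun i => 40 * c)).
- exact: query_free_CheckBlock.
- by move=> ? ? ? [].
- move=> done i todo st4 eq_e /(fun h => same_sub h (@WCheckBlockP D A a) (@ACheckBlockP D A a))
  sm4 [e19' e25' e11d e24'].
  have a4 b k : ~~ ACheck b -> arr st4 b k = arr st b k.
    by move=> nb; rewrite (same_arr _ sm4) // (same_arr _ sm1).
  have r4 r : r \in [:: 5; 8; 9] -> reg st4 r = reg st r.
    by rewrite !inE => /or3P[] /eqP ->; rewrite (same_reg sm4) // (same_reg sm1).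
  have hw4 : holds st4 A (reg st4 11) (enc ((F i).1, (F i).2)).
    have : holds st A 6 (enF (enum 'I_m)).
      by move: hbl; rewrite sh -map_comp.
    rewrite e11d -eq_e /enF map_cat map_cons flatten_split !holds_cat => -[_ [h _]].
    by rewrite -surjective_pairing; apply: holds_ext h => k; rewrite a4.
  have hh4 : holds st4 A 0 (take 5 hdr) by apply: holds_ext hh5 => k; rewrite a4.
  have ei := enum_split eq_e.
  have A41 : A != 41 by apply: contra nA => /eqP ->.
  have a41 : a != 41 by apply: contra na => /eqP ->.
  have run' : runs_in no_oracle D (take 5 hdr ++
     (size (F i).1 :: flatten (F i).1) ++ [seq arr st4 a v | v <- (F i).2]) c
    (fun s => (reg s 0 != 0) = ok i).
    have := run i; congr (runs_in _ _ (_ ++ _ ++ _) _ _).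
    by apply: eq_map => v; rewrite a4.
  have h := check_block_spec O A41 a41 sh5 hh4 hw4 (etrans (r4 5 isT) e5) (sF2 i)
    (etrans (r4 9 isT) e9) (sF1 i) e24' e19' run'.
  apply: wp_mono h (leqnn _) _ => st5 [e11_5 e24_5 e25_5 e19_5]; split=> //.
  + by rewrite e25_5 e25' size_rcons.
  + by rewrite e11_5 e11d /enF map_rcons flatten_rcons size_cat -surjective_pairing addnA.
  + by rewrite e24_5 e25' ei first_bad_rcons.
- by split; rewrite ?size_enum_ord.
- by rewrite sum_const_cost size_enum_ord; lia.
by move=> st' _ [].
Qed.

(** * Truncating every list to its first pair *)

Definition TruncBlock :=
  (Fetch 12 0 11 ;; Inc 11) ;;
  (If 12
    ((Const 1 1 ;; Store 10 10 1 ;; Inc 10 ;; Mov 23 9) ;;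
     (Copy 0 11 10 10 23 ;; (Dec 12 ;; While 12 (Add 11 11 9 ;; Dec 12))))
    (Const 1 0 ;; Store 10 10 1 ;; Inc 10 ;; Const 30 1) ;;
   (Mov 23 5 ;; (Copy 0 11 10 10 23 ;; Dec 19))).

(** A list of length at most one is still a name of a relation of the union problem, so the decider
    for unions can evaluate the constraints of H on the truncated instance. Register 30 records
    whether some list was empty. *)
Definition Trunc :=
  (Const 11 0 ;; Const 10 0 ;; Const 23 6 ;; Const 30 0) ;;
  (Copy 0 11 10 10 23 ;; (Mov 19 8 ;; While 19 TruncBlock)).

Lemma trunc_block_spec O st ws sc q l m ys :
  holds st 0 (reg st 11) (enc (ws, sc)) -> reg st 5 = l -> size sc = l ->
  reg st 9 = q.+1 -> all (fun x => size x == q.+1) ws -> reg st 19 = m.+1 ->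
  out st 10 10 ys ->
  wp O TruncBlock st (35 * size (enc (ws, sc))) (fun st' =>
    [/\ reg st' 11 = reg st 11 + size (enc (ws, sc)),
        out st' 10 10 (ys ++ enc (take 1 ws, sc)),
        reg st' 30 = if ws is [::] then 1 else reg st 30 & reg st' 19 = m]).
Proof.
move=> /holds_cons[hc /holds_cat[hws hsc]] e5 ssc e9 sws e19 oX.
rewrite /= in hc hws hsc.
have sE : size (enc (ws, sc)) = (size ws * q.+1 + l).+1.
  by rewrite /enc /= size_cat (size_flatten_words sws) ssc.
rewrite sE.
apply: (@wp_seqf _ _ _ _ 3 (35 * (size ws * q.+1 + l) + 32) _ (fun st1 =>
  [/\ reg st1 12 = size ws, reg st1 11 = (reg st 11).+1 & out st1 10 10 ys])) => //; last by lia.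
  by apply: wp_straight => //=; rewrite addn1.
move=> st1 sm1 [e12 e11 oX1].
apply: (@wp_seqf _ _ _ _ (20 * (size ws * q.+1) + 10) (10 * l + 10) _ (fun st2 =>
  [/\ reg st2 11 = (reg st 11).+1 + size (flatten ws),
      out st2 10 10 (ys ++ size (take 1 ws) :: flatten (take 1 ws)) &
      reg st2 30 = if ws is [::] then 1 else reg st 30])) => //; last by lia.
- rewrite addnS; apply: wp_if => h12; last first.
    have -> : ws = [::] by apply: size0nil; rewrite -e12.
    apply: wp_straight => //.
    split=> //=; first by rewrite addn0.
    by rewrite cats1; apply: (out_push oX1) => /=; rewrite ?addn1.
  case: ws {hsc} hc hws sws sE e12 => [|x ws] hc hws /=; first by move=> _ _ e12; rewrite e12 in
    h12.
  move=> /andP[/eqP sx sws] sE e12.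
  rewrite take0 /= cats0.
  apply: (@wp_seqf _ _ _ _ 6 (20 * (size ws).+1 * q.+1 + 3) _ (fun st2 =>
   [/\ reg st2 23 = size x & out st2 10 10 (rcons ys 1)])) => //; last by lia.
    apply: wp_straight => //=; split=> /=; first by rewrite (same_reg sm1) // e9 sx addn0.
    by apply: (out_push oX1) => /=; rewrite ?addn1.
  move=> st2 sm2 [e23 oX2].
  have /holds_cat[hx _] := hws.
  have hx2 : holds st2 0 (reg st2 11) x.
    rewrite (same_reg sm2) // e11; apply: holds_ext hx => i.
    by rewrite (same_arr _ sm2) // (same_arr _ sm1).
  apply: (wp_seqf (c2 := 11 * (size ws).+1 * q.+1 + 2) _ (copy_spec _ (B := 10) _ _ e23 hx2 oX2))
    => //; last by rewrite sx; nia.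
  move=> st3 sm3 [e11' _ oX3].
  apply: (@wp_seqf _ _ _ _ 2 (11 * (size ws).+1 * q.+1) _ (fun st4 =>
    reg st4 12 = size ws)) => //; last by lia.
    by apply: wp_straight => //=; rewrite (same_reg sm3) // (same_reg sm2) // e12 /= subn1.
  move=> st4 sm4 e12'.
  pose Inv (done todo : seq (seq nat)) st' := reg st' 12 = size todo /\
    reg st' 11 = (reg st 11).+1 + size x + size (flatten done).
  apply: (wp_loop (xs := ws) (Inv := Inv) (cost := fun=> 3)) => //.
  + by move=> ? ? ? [].
  + move=> done y todo st5 eq_ws sm5 [e12'' e11''].
    have yw : y \in ws by rewrite -eq_ws mem_cat inE eqxx orbT.
    apply: wp_straight => //; split=> /=; first by rewrite e12'' /= subn1.
    rewrite e11'' (same_reg sm5) // (same_reg sm4) // (same_reg sm3) // (same_reg sm2) //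
      (same_reg sm1) // e9.
    by rewrite flatten_rcons size_cat (eqP (allP sws _ yw)) addnA.
  + split=> //; rewrite (same_reg sm4) // e11' (same_reg sm2) // e11.
    by rewrite addn0.
  + by rewrite sum_const_cost; nia.
  move=> st' sm' [_ e]; split.
  + by rewrite e size_cat addnA.
  + case: oX3 => o1 o2; split; first by rewrite (same_reg sm') // (same_reg sm4) // o1 cat_rcons.
    by rewrite -cat_rcons; apply: holds_ext o2 => i; rewrite (same_arr _ sm') // (same_arr _ sm4).
  by rewrite (same_reg sm') // (same_reg sm4) // (same_reg sm3) // (same_reg sm2) // (same_reg sm1).
move=> st2 sm2 [e11' oX2 e30].
apply: (@wp_seqf _ _ _ _ 2 (10 * l + 8) _ (fun st3 => reg st3 23 = size sc)) => //; last by lia.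
  by apply: wp_straight => //=; rewrite (same_reg sm2) // (same_reg sm1) // ssc e5 addn0.
move=> st3 sm3 e23.
have oX3 : out st3 10 10 (ys ++ size (take 1 ws) :: flatten (take 1 ws)).
  case: oX2 => o1 o2; split; first by rewrite (same_reg sm3).
  by apply: holds_ext o2 => i; rewrite (same_arr _ sm3).
have hsc3 : holds st3 0 (reg st3 11) sc.
  rewrite (same_reg sm3) // e11'; apply: holds_ext hsc => i.
  by rewrite (same_arr _ sm3) // (same_arr _ sm2) // (same_arr _ sm1).
apply: (wp_seqf (c2 := 2) _ (copy_spec _ (B := 10) _ _ e23 hsc3 oX3)) => //; last by lia.
move=> st4 sm4 [e11'' _ oX4]; apply: wp_straight => //; split=> //=.
- by rewrite e11'' (same_reg sm3) // e11' (size_flatten_words sws) ssc; lia.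
- by rewrite /enc /= -cat_cons catA.
- by rewrite (same_reg sm4) // (same_reg sm3).
by rewrite (same_reg sm4) // (same_reg sm3) // (same_reg sm2) // (same_reg sm1) // e19 subn1.
Qed.

Lemma trunc_spec O st hdr m (F : 'I_m -> seq (seq nat) * seq nat) q l :
  let X := encs hdr [seq F i | i <- enum 'I_m] in
  size hdr = 6 -> holds st 0 0 X ->
  reg st 5 = l -> reg st 8 = m -> reg st 9 = q.+1 ->
  (forall i, size (F i).2 = l) ->
  (forall i, all (fun x => size x == q.+1) (F i).1) ->
  wp O Trunc st (40 * size X + 10) (fun st' =>
    out st' 10 10 (encs hdr [seq (take 1 (F i).1, (F i).2) | i <- enum 'I_m]) /\
    (reg st' 30 != 0) = [exists i, nilp (F i).1]).
Proof.
move=> X sh hX e5 e8 e9 sF2 sF1.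
have /holds_cat[hh hbl] : holds st 0 0 X by [].
set S := size (flatten [seq enc (F i) | i <- enum 'I_m]).
have sX : size X = 6 + S by rewrite /X /encs size_cat sh -map_comp.
apply: (@wp_seqf _ _ _ _ 4 (40 * S + 100) _ (fun st1 =>
  [/\ reg st1 11 = 0, reg st1 23 = size hdr, reg st1 30 = 0 & out st1 10 10 [::]])) => //; last
    by lia.
  by apply: wp_straight => //=; rewrite sh.
move=> st1 sm1 [e11 e23 e30 oX].
have hh1 : holds st1 0 (reg st1 11) hdr.
  by rewrite e11; apply: holds_ext hh => i; rewrite (same_arr _ sm1).
apply: (wp_seqf (c2 := 40 * S + 10) _ (copy_spec _ (B := 10) _ _ e23 hh1 oX)) => //; last by
  rewrite sh; lia.
move=> st2 sm2 [e11' _ oX2].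
apply: (@wp_seqf _ _ _ _ 2 (40 * S + 8) _ (fun st3 =>
  [/\ reg st3 11 = 6, reg st3 19 = m, reg st3 30 = 0 & out st3 10 10 hdr])) => //; last by lia.
  apply: wp_straight => //=; split=> //=; first by rewrite e11' e11 sh.
    by rewrite (same_reg sm2) // (same_reg sm1) // e8 addn0.
  by rewrite (same_reg sm2).
move=> st3 sm3 [e11'' e19 e30' oX3].
pose enF done := flatten [seq enc (F i) | i <- done].
pose enF' done := flatten [seq enc (take 1 (F i).1, (F i).2) | i <- done].
pose Inv (done todo : seq 'I_m) st' :=
  [/\ reg st' 19 = size todo, reg st' 11 = 6 + size (enF done),
      (reg st' 30 != 0) = has (fun i => nilp (F i).1) done & out st' 10 10 (hdr ++ enF' done)].
apply: (wp_loop (xs := enum 'I_m) (Inv := Inv) (cost := fun i => 35 * size (enc (F i)))) => //.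
- by move=> ? ? ? [].
- move=> done i todo st4 eq_e sm4 [e19' e11d e30d oX4].
  have hw4 : holds st4 0 (reg st4 11) (enc ((F i).1, (F i).2)).
    have : holds st 0 6 (enF (enum 'I_m)).
      by move: hbl; rewrite sh -map_comp.
    rewrite e11d -eq_e /enF map_cat map_cons flatten_split !holds_cat => -[_ [h _]].
    rewrite -surjective_pairing; apply: holds_ext h => k.
    by rewrite (same_arr _ sm4) // (same_arr _ sm3) // (same_arr _ sm2) // (same_arr _ sm1).
  have r4 r : r \in [:: 5; 9] -> reg st4 r = reg st r.
    by rewrite !inE => /orP[] /eqP ->; rewrite (same_reg sm4) // (same_reg sm3) // (same_reg sm2)
      // (same_reg sm1).
  have h := trunc_block_spec O hw4 (etrans (r4 5 isT) e5) (sF2 i) (etrans (r4 9 isT) e9) (sF1 i)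
    e19' oX4.
  apply: wp_mono h _ _ => [|st5 [e11_5 oX5 e30_5 e19_5]]; first by rewrite -surjective_pairing.
  split=> //.
  + by rewrite e11_5 e11d /enF map_rcons flatten_rcons size_cat -surjective_pairing addnA.
  + by rewrite e30_5 has_rcons -e30d; case: ((F i).1) => [|x s] /=.
  + by rewrite /enF' map_rcons flatten_rcons catA.
- by split; rewrite ?size_enum_ord // ?e30' // ?cats0.
- suff h : \sum_(i <- enum 'I_m) (35 * size (enc (F i))).+1 <= 40 * S.
    by apply: leq_ltn_trans h _; lia.
  rewrite /S size_flatten /shape -map_comp sumnE big_map big_distrr.
  by apply: leq_sum => i _; rewrite /enc /=; set z := size _; lia.
move=> st' _ [_ _ e oX']; split; first by rewrite /encs -map_comp.
rewrite e; apply/hasP/existsP => [[i _ h]|[i h]]; exists i => //.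
by rewrite mem_enum.
Qed.

(* The length y of the query is ignored: an allowed query has length l. *)
Definition Ask D x a (y : nat) :=
  Check D 0 a ;;
  (If 24 Skip
    ((Const 22 0 ;; Const 28 0 ;; Mov 23 5) ;;
     (Copy a 22 1 28 23 ;; (Const 31 1 ;; Check D 10 a))) ;;
   Mov x 24).

(** A recorded solution (register 31) takes precedence over the answer of the solver, since after it
    has been found a negative answer concerns H alone. *)
Definition ProgB P D :=
  Params ;;
  (Trunc ;;
   If 30 (Const 0 0)
    ((Const 22 0 ;; Const 28 0 ;; Const 23 6) ;;
     (Copy 0 22 40 28 23 ;;
      (Const 31 0 ;;
       (translate (Ask D) solver_cell P ;;
        If 31 (Const 0 1)
         (If 40
           ((Const 22 0 ;; Const 28 0 ;; Mov 23 5) ;; (Copy 42 22 1 28 23 ;; Const 0 1))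
           (Const 0 0))))))).

Definition WAsk x : pred nat := fun r =>
  [|| r \in [:: 1; 11; 12; 19; 22; 23; 24; 25; 28; 31], (40 <= r) && odd r | r == x].
(** Array 1 with the recorded solution and the arrays of the decider are odd; arrays 0 and 10, which
    hold the full and the truncated instance, and the arrays of the solver are even. *)
Definition AAsk : pred nat := odd.

Lemma WAskP D x a y : subpred (writes_reg (Ask D x a y)) (WAsk x).
Proof.
move=> r; rewrite [writes_reg _ _]/=.
repeat (case/orP); try (by move/eqP=> ->); try by [].
all: try by move/writes_reg_decider_odd; rewrite /WAsk => ->; rewrite orbT.
by move=> e; rewrite /WAsk e !orbT.
Qed.

Lemma AAskP D x a y : subpred (writes_arr (Ask D x a y)) AAsk.
Proof.
move=> r; rewrite [writes_arr _ _]/=.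
repeat (case/orP); try (by move/eqP=> ->); try by [].
all: by move/writes_arr_decider_odd => /andP[].
Qed.

Lemma query_free_Ask D x a y : query_free (Ask D x a y). Proof. by rewrite /=
  query_free_relocate. Qed.

(** * Scopes of the union problem as permutations of the variables *)

Section Compose.
Variables (S : csp) (n : nat).
Local Notation l := (len S n).
Local Notation q := (arity S n).
Local Notation US := (Ucsp (Ecsp S)).

Lemma comp_scope_uniq (t : scopes US n) (t' : scopes S n) :
  uniq (map_tuple (tnth (val t)) (val t')).
Proof.
by rewrite /= map_inj_uniq ?(valP t') //; apply/tuple_uniqP; apply: (valP t).
Qed.

(** A given constraint may apply its union to permuted variables; a pair of that union then becomes
    a constraint of S on the composed scope. *)
Definition comp_scope (t : scopes US n) (t' : scopes S n) : scopes S n :=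
  exist _ (map_tuple (tnth (val t)) (val t')) (comp_scope_uniq t t').

Lemma project_comp (a : asg S n) (t : scopes US n) (t' : scopes S n) :
  project a (comp_scope t t') = project (project a t : asg S n) t'.
Proof. by apply: eq_from_tnth => i; rewrite !tnth_mktuple tnth_map. Qed.

(** Here the symmetry of the admissible set enters: l distinct variables out of l form a
    permutation. *)
Lemma adm_project (a : asg S n) (t : scopes US n) :
  a \in adm S n -> (project a t : asg S n) \in adm S n.
Proof.
move=> adm_a; apply: (@adm_sym S n (tnth (val t)) a) => //.
by apply/tuple_uniqP; apply: (valP t).
Qed.
End Compose.

(** * Hidden instances below a fixed instance of the union problem *)

Section Reverse.
Variables (S : csp) (n m : nat).
Hypotheses (n_gt0 : 0 < n) (m_gt0 : 0 < m).
Local Notation US := (Ucsp (Ecsp S)).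
Local Notation l := (len S n).
Local Notation q := (arity S n).

Variables (P D : prog) (T M : nat).
Hypothesis run_P : forall (H : instance S n m) O,
  revealing H O -> runs_in O P (std_header S n ++ [:: m]) T (solved H).
Hypothesis run_D : forall (k : 'I_(nrel US n)) x (u : tup US n),
  names (UE_pres S) k x ->
  runs_in no_oracle D (std_header S n ++ x ++ word u) M
    (fun st => (reg st 0 != 0) = (u \in Defs.rel k)).

Variables (C : instance US n m) (Ls : 'I_m -> basics S n).
Hypothesis uLs : forall i, uniq (Ls i).
Hypothesis rLs : forall i, basics_union (Ls i) = Defs.rel (tnth C i).1.

Local Notation sc i := (tnth C i).2.

Lemma sat1E i (a : asg S n) : a \in adm S n ->
  sat1 (tnth C i) a = has (fun kt => sat1 kt (project a (sc i) : asg S n)) (Ls i).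
Proof.
move=> adm_a; rewrite /sat1 -rLs.
have := in_basics_union (Ls i) (project a (sc i)).
by rewrite adm_project.
Qed.

Lemma run_check (L : basics S n) (t : scopes US n) (a : asg S n) :
  uniq L -> a \in adm S n ->
  runs_in no_oracle D (std_header S n ++ basics_word L ++
    [seq nth 0 (word a) v | v <- word (val t)]) M
    (fun st => (reg st 0 != 0) = has (fun kt => sat1 kt (project a t : asg S n)) L).
Proof.
move=> uL adm_a.
have nm : names (UE_pres S) (union_index L) (basics_word L).
  by exists L; rewrite rel_union_index.
have := @run_D _ _ (project a t) nm.
rewrite rel_union_index (in_basics_union L (project a t)) adm_project // andTb.
congr (runs_in _ _ (_ ++ _ ++ _) _ _).
apply: (@eq_from_nth _ 0) => [|i]; rewrite size_word ?size_map ?size_tuple // => lti.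
rewrite (nth_map 0) ?size_word // (nth_word _ (Ordinal lti)) (nth_word (val t) (Ordinal lti)).
by rewrite (nth_word a) tnth_mktuple.
Qed.

Definition okC (a : asg S n) i := sat1 (tnth C i) a.

(* A hidden instance all of whose constraints imply those of C. *)
Definition sub_instance (H : instance S n m) := forall i,
  exists2 kt, kt \in Ls i & tnth H i = (kt.1, comp_scope (sc i) kt.2).

Lemma sub_sat1 H i a : sub_instance H -> a \in adm S n ->
  sat1 (tnth H i) a -> sat1 (tnth C i) a.
Proof.
move=> /(_ i)[kt ktL e] adm_a; rewrite e sat1E // => h.
by apply/hasP; exists kt => //; move: h; rewrite /sat1 /= project_comp.
Qed.

Lemma sub_sat H (a : asg S n) : sub_instance H -> sat H a -> sat C a.
Proof.
move=> sH /andP[adm_a /forallP h]; apply/andP; split=> //; apply/forallP => i.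
exact: sub_sat1 sH adm_a (h i).
Qed.

(** One satisfied pair is chosen from every list. Together with [sub_sat], the solutions of C are
    exactly those of its sub-instances. *)
Lemma sub_exists (a : asg S n) : sat C a -> exists2 H, sub_instance H & sat H a.
Proof.
move=> /andP[adm_a /forallP h].
have [f hf] : exists f : 'I_m -> constraint S n,
    forall i, f i \in Ls i /\ sat1 (f i) (project a (sc i) : asg S n).
  apply: (@fin_all_exists _ _ (fun i kt => kt \in Ls i /\ sat1 kt (project a (sc i) : asg S n)))
    => i.
  by have := h i; rewrite sat1E // => /hasP[kt ktL hkt]; exists kt.
exists [tuple ((f i).1, comp_scope (sc i) (f i).2) | i < m].
  by move=> i; rewrite tnth_mktuple; exists (f i); case: (hf i).
apply/andP; split=> //; apply/forallP => i; rewrite tnth_mktuple /sat1 /= project_comp.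
by case: (hf i).
Qed.

(* Violations of C are reported first, so the answers do not depend on H until
   a solution of C is queried. *)
Definition answer (H : instance S n m) (a : asg S n) :=
  let v := first_bad (okC a) (enum 'I_m) in
  if v == 0 then first_bad (fun i => sat1 (tnth H i) a) (enum 'I_m) else v.

(** [pick] decodes the queried word; as words determine assignments, it has at most one
    candidate. *)
Definition oracle_of H : oracle := fun _ x =>
  if [pick a : asg S n | (a \in adm S n) && (word a == x)] is Some a
  then Some (answer H a) else None.

Lemma oracle_word H h a : a \in adm S n -> oracle_of H h (word a) = Some (answer H a).
Proof.
move=> adm_a; rewrite /oracle_of; case: pickP => [b /andP[_ /eqP/word_inj ->] //|].
by move/(_ a); rewrite adm_a eqxx.
Qed.

Lemma oracle_Some H h x v : oracle_of H h x = Some v ->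
  exists a, [/\ a \in adm S n, x = word a & v = answer H a].
Proof.
rewrite /oracle_of; case: pickP => // a /andP[adm_a /eqP ex] [<-].
by exists a.
Qed.

(** A constraint of C violated by a query is, by contraposition of [sub_sat1], violated at the same
    index in H. Giving priority to C is thus one of the choices open to an oracle for H. *)
Lemma revealing_oracle H : sub_instance H -> revealing H (oracle_of H).
Proof.
move=> sH; split=> [h a adm_a | h x nx]; last first.
  rewrite /oracle_of; case: pickP => // a /andP[adm_a /eqP ex].
  by case: (nx a adm_a).
rewrite oracle_word //; case: ifP => [/andP[_ /forallP sa]|nsa].
  rewrite /answer; case: (first_badP (okC a)) => [[-> _]|[i]].
    by case: (first_badP (fun i => sat1 (tnth H i) a)) => [[-> _]|[i]] //; rewrite sa.
  by rewrite /okC (sub_sat1 sH adm_a (sa i)).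
rewrite /answer; case: (first_badP (okC a)) => [[-> _]|[i nsi ->]]; last first.
  by exists i => //; apply: contra nsi; apply: sub_sat1 sH adm_a.
case: (first_badP (fun i => sat1 (tnth H i) a)) => [[_ all1]|[i nsi ->]]; last by exists i.
by move: nsa; rewrite /sat adm_a /= => /forallP[].
Qed.

Lemma answer_unsat H H' a : a \in adm S n -> ~~ sat C a -> answer H a = answer H' a.
Proof.
move=> adm_a ns; rewrite /answer; case: (first_badP (okC a)) => [[_ h]|[i _ ->]] //.
by case/negP: ns; rewrite /sat adm_a /=; apply/forallP.
Qed.

Definition blocksC (i : 'I_m) : seq (seq nat) * seq nat :=
  (map (@enc_pair S n) (Ls i), word (val (sc i))).
Definition blocks1 (i : 'I_m) : seq (seq nat) * seq nat :=
  (take 1 (blocksC i).1, (blocksC i).2).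

Local Notation hd := (hdr S n m).
Local Notation X := (encs hd [seq blocksC i | i <- enum 'I_m]).
Local Notation X1 := (encs hd [seq blocks1 i | i <- enum 'I_m]).

Lemma enc_basics (L : basics S n) :
  size (map (@enc_pair S n) L) :: flatten (map (@enc_pair S n) L) = basics_word L.
Proof. by rewrite size_map. Qed.

(** The history matters only as long as nothing has been recorded; after that the solution itself is
    the certificate. *)
Definition found (h : seq (seq nat)) st :=
  (reg st 31 = 0 /\ forall a : asg S n, sat C a -> word a \notin h) \/
  (reg st 31 = 1 /\ exists2 a : asg S n, sat C a & holds st 1 0 (word a)).

Definition sim_inv h st :=
  [/\ [/\ reg st 5 = l, reg st 8 = m & reg st 9 = q.+1],
      holds st 0 0 X, holds st 10 0 X1 & found h st].

Section Truncated.
Variable H : instance S n m.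
Hypothesis eH : forall i, exists kt L,
  Ls i = kt :: L /\ tnth H i = (kt.1, comp_scope (sc i) kt.2).

Lemma sub_H : sub_instance H.
Proof. by move=> i; have [kt [L [e1 e2]]] := eH i; exists kt; rewrite // e1 mem_head. Qed.

(** The time bound says something only about an actual input; a constant tuple supplies one, since
    the alphabet is nonempty for positive n. *)
Lemma size_M (L : basics S n) : uniq L -> 5 + size (basics_word L) + l <= M.
Proof.
move=> uL; pose u : tup US n := [tuple Ordinal (alph_gt0 S n_gt0) | _ < l].
have nm : names (UE_pres S) (union_index L) (basics_word L).
  by exists L; rewrite rel_union_index.
have := runs_in_size (@run_D _ _ u nm).
by rewrite !size_cat size_word addnA.
Qed.

Lemma M_ge : l + 6 <= M.
Proof. by have := size_M (uLs (Ordinal m_gt0)); rewrite /=; lia. Qed.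

Lemma map_arr st b (a : asg S n) (t : scopes US n) : holds st b 0 (word a) ->
  [seq arr st b v | v <- word (val t)] = [seq nth 0 (word a) v | v <- word (val t)].
Proof.
move=> hb; apply/eq_in_map => v /mapP[i _ ->].
by have := hb (val i); rewrite add0n => -> //; rewrite size_word; apply: ltn_ord.
Qed.

Lemma size_blocksC i : size (blocksC i).2 = l.
Proof. exact: size_word. Qed.

Lemma all_words (L : basics S n) : all (fun x => size x == q.+1) (map (@enc_pair S n) L).
Proof. by apply/allP => x /mapP[kt _ ->]; rewrite size_enc_pair. Qed.

Lemma all_blocks1 i : all (fun x => size x == q.+1) (blocks1 i).1.
Proof. by rewrite /blocks1 /= -map_take all_words. Qed.

Lemma check_full O st b (a : asg S n) :
  ~~ ACheck b -> holds st b 0 (word a) -> a \in adm S n -> holds st 0 0 X ->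
  reg st 5 = l -> reg st 8 = m -> reg st 9 = q.+1 ->
  wp O (Check D 0 b) st (m * (40 * M + 1) + 10) (fun st' =>
    reg st' 24 = first_bad (okC a) (enum 'I_m)).
Proof.
move=> nb hb adm_a hX e5 e8 e9.
apply: (@check_spec _ _ _ 0 b hd m blocksC q l M (okC a)) => // [i | i | i].
- exact: size_blocksC.
- exact: all_words.
rewrite enc_basics (map_arr (sc i) hb) /okC sat1E //.
exact: run_check.
Qed.

Lemma check_sub O st b (a : asg S n) :
  ~~ ACheck b -> holds st b 0 (word a) -> a \in adm S n -> holds st 10 0 X1 ->
  reg st 5 = l -> reg st 8 = m -> reg st 9 = q.+1 ->
  wp O (Check D 10 b) st (m * (40 * M + 1) + 10) (fun st' =>
    reg st' 24 = first_bad (fun i => sat1 (tnth H i) a) (enum 'I_m)).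
Proof.
move=> nb hb adm_a hX e5 e8 e9.
apply: (@check_spec _ _ _ 10 b hd m blocks1 q l M (fun i => sat1 (tnth H i) a)) => // [i | i | i].
- exact: size_blocksC.
- exact: all_blocks1.
have [kt [L [eL ->]]] := eH i.
rewrite /blocks1 /blocksC eL /= take0 cats0 (map_arr (sc i) hb).
have := @run_check [:: kt] (sc i) a isT adm_a; rewrite /= orbF /sat1 /= project_comp.
by rewrite /basics_word /= cats0.
Qed.

(** At most two passes over m lists, each list costing [40 * M + 1] steps, and one copy of l cells,
    where [l + 6 <= M]. *)
Lemma ask_spec O x a y h st v : sim_inv h st ->
  oracle_of H h (read st (solver_cell a) (reg st (solver_cell y))) = Some v ->
  wp O (Ask D (solver_cell x) (solver_cell a) (solver_cell y)) st (200 * m * M) (fun st' =>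
    [/\ sim_inv (read st (solver_cell a) (reg st (solver_cell y)) :: h) st', reg st' (solver_cell
      x) = v,
        forall r, r <> x -> reg st' (solver_cell r) = reg st (solver_cell r) &
        forall b i, arr st' (solver_cell b) i = arr st (solver_cell b) i]).
Proof.
set w := read _ _ _.
move=> [[e5 e8 e9] hX hX1 fnd] /oracle_Some[b [adm_b ew ev]].
have hw : holds st (solver_cell a) 0 (word b).
  by rewrite -ew; apply/holds_read; rewrite size_mkseq.
have oddP r : odd (solver_cell r) = false by rewrite /solver_cell oddD odd_double.
have geP r : 40 <= solver_cell r by rewrite /solver_cell leq_addr.
have na : ~~ ACheck (solver_cell a) by rewrite /ACheck oddP andbF.
have mM : m * 6 <= m * M by rewrite leq_mul2l (leq_trans _ M_ge) ?orbT // leq_addl.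
have lM : l + 6 <= m * M by apply: leq_trans M_ge _; rewrite leq_pmull.
have neP r c : c < 40 -> (c == solver_cell r) = false.
  by move=> c40; apply/negbTE; rewrite neq_ltn (leq_trans c40 (geP r)).
(* The stored instances, the parameters and the other cells of the solver lie in the frame; only the
   record and the answer depend on the computation. *)
suff [k [st' [ex lek [fnd' ev']]]] : wp O (Ask D (solver_cell x) (solver_cell a) (solver_cell y))
  st (200 * m * M)
    (fun st' => found (w :: h) st' /\ reg st' (solver_cell x) = v).
  have sm := same_sub (exec_same (query_free_Ask _ _ _ _) ex) (@WAskP D _ _ _) (@AAskP D _ _ _).
  exists k, st'; split=> //; split=> //.
  - split=> //; first by split; rewrite (same_reg sm) // /WAsk neP.
    + by apply: holds_ext hX => i; rewrite (same_arr _ sm).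
    + by apply: holds_ext hX1 => i; rewrite (same_arr _ sm).
  - move=> r /eqP nr; by rewrite (same_reg sm) // /WAsk oddP andbF (inj_eq solver_cell_inj)
    (negbTE nr) orbF.
  - by move=> b' i; rewrite (same_arr _ sm) // /AAsk oddP.
have w_sat (st1 : state) (a' : asg S n) : ~~ sat C b -> sat C a' -> word a' \notin h -> word a'
  \notin w :: h.
  move=> nsb sa' nh; rewrite inE negb_or nh andbT ew; apply: contra nsb => /eqP/word_inj <-.
  exact: sa'.
have satE : sat C b = [forall i, okC b i] by rewrite /sat adm_b.
apply: (wp_seqf (c2 := m * (40 * M + 1) + 9 * l + 60) _ (check_full O na hw adm_b hX e5 e8 e9)).
- exact: query_free_Check.
- move=> st1 sm1' e24.
  have sm1 := same_sub sm1' (@WCheckP D _ _) (@ACheckP D _ _).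
  apply: (@wp_seqf _ _ _ _ (m * (40 * M + 1) + 9 * l + 58) 2 _ (fun st2 =>
    found (w :: h) st2 /\ reg st2 24 = v)); last by rewrite -addnA.
  + by rewrite /= query_free_relocate.
  + rewrite addnS; apply: wp_if => h24.
      apply: wp_straight => //; first by rewrite addnS.
      have nsb : ~~ sat C b.
        rewrite satE; apply/forallPn; case: (first_badP (okC b)) => [[e0]|[i nok _]].
          by rewrite e24 e0 in h24.
        by exists i.
      split=> /=; last by rewrite ev /answer -e24 (negbTE h24).
      case: fnd => [[e31 nh]|[e31 [a' sa' ha']]]; [left|right]; split; rewrite ?(same_reg sm1) //.
        by move=> a' sa'; apply: w_sat (nh _ sa').
      by exists a' => //; apply: holds_ext ha' => i; rewrite (same_arr _ sm1).
    have sb : sat C b.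
      rewrite satE; case: (first_badP (okC b)) => [[_ all_ok]|[i _ e]]; first exact/forallP.
      by rewrite -e24 h24 in e.
    apply: (@wp_seqf _ _ _ _ 4 (m * (40 * M + 1) + 9 * l + 53) _ (fun st2 =>
      [/\ reg st2 22 = 0, reg st2 23 = size (word b) & out st2 1 28 [::]])) => //.
    * by apply: wp_straight => //=; rewrite (same_reg sm1) // e5 addn0 size_word.
    * move=> st2 sm2 [e22 e23 o1].
      have hb2 : holds st2 (solver_cell a) (reg st2 22) (word b).
        by rewrite e22; apply: holds_ext hw => i; rewrite (same_arr _ sm2) // (same_arr _ sm1).
      have na1 : solver_cell a != 1 by rewrite eq_sym neP.
      apply: (wp_seqf (c2 := m * (40 * M + 1) + 20) _ (copy_spec _ (B := 1) _ na1 e23 hb2 o1)) =>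
        //; last by rewrite size_word; lia.
      move=> st3 sm3 [_ _ [_ h1]].
      apply: (@wp_seqf _ _ _ _ 1 (m * (40 * M + 1) + 10) _ (fun st4 => reg st4 31 = 1)) => //;
        last by lia.
        by apply: wp_straight.
      move=> st4 sm4 e31.
      have a4 b' i : b' != 1 -> arr st4 b' i = arr st1 b' i.
        by move=> nb'; rewrite (same_arr _ sm4) // (same_arr _ sm3) ?(same_arr _ sm2) //= !orbF.
      have r4 r : r \in [:: 5; 8; 9] -> reg st4 r = reg st r.
        by rewrite !inE => /or3P[] /eqP ->; rewrite (same_reg sm4) // (same_reg sm3) // (same_reg
          sm2) // (same_reg sm1).
      have hw4 : holds st4 (solver_cell a) 0 (word b).
        by apply: holds_ext hw => i; rewrite a4 // (same_arr _ sm1).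
      have hX4 : holds st4 10 0 X1.
        by apply: holds_ext hX1 => i; rewrite a4 // (same_arr _ sm1).
      have := check_sub O na hw4 adm_b hX4 (etrans (r4 5 isT) e5) (etrans (r4 8 isT) e8) (etrans
        (r4 9 isT) e9).
      case=> k [st5 [ex5 lek e24_5]]; exists k, st5; split=> //.
      have sm5 := same_sub (exec_same (query_free_Check _ _ _) ex5) (@WCheckP D _ _) (@ACheckP D
        _ _).
      split; last by rewrite e24_5 ev /answer -e24 h24.
      right; split; first by rewrite (same_reg sm5).
      exists b => //; apply: holds_ext h1 => i.
      by rewrite (same_arr _ sm5) // (same_arr _ sm4).
    * by lia.
  + move=> st2 sm2 [fnd2 e24_2]; apply: wp_straight => //; split=> /=.
      by case: fnd2 => [[e31 nh]|[e31 ha]]; [left|right]; split=> //=; rewrite ifN ?neP.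
    by rewrite eqxx e24_2 addn0.
by nia.
Qed.

End Truncated.

Lemma size_X : size X <= 6 + m * M.
Proof.
rewrite size_cat leq_add2l -map_comp size_flatten /shape -map_comp sumnE big_map big_enum /=.
rewrite -[X in _ <= X * _](card_ord m) -sum_nat_const; apply: leq_sum => i _.
have := size_M (uLs i); rewrite -enc_basics /blocksC /enc /= size_cat size_word.
lia.
Qed.

Lemma no_sat_nil i a : Ls i = [::] -> ~~ sat C a.
Proof.
move=> e; apply/negP => /andP[adm_a /forallP/(_ i)].
by rewrite sat1E // e.
Qed.

(** A solution of C would solve some sub-instance H', and the run of the solver on H' from the same
    state would reach the same negative end. *)
Lemma no_sat_det H s k s' : sub_instance H -> initial hd s ->
  exec (oracle_of H) P s k s' -> reg s' 0 = 0 ->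
  (forall a : asg S n, sat C a -> word a \notin hist s') -> forall a, ~~ sat C a.
Proof.
move=> sH ini ex e0 nh a; apply/negP => sa.
have [H' sH' sa'] := sub_exists sa.
have [k2 [s2 [ex2 _ sol]]] := run_P (revealing_oracle sH') ini.
have e : s2 = s'.
  (* A word in the history either decodes to no admissible assignment, and both oracles refuse it,
     or to a non-solution of C, where [answer_unsat] applies. *)
  apply: (exec_det ex _ ex2) => h x xh; rewrite /oracle_of.
  case: pickP => // b /andP[adm_b /eqP eb]; congr Some; apply: answer_unsat => //.
  by apply: contraL xh => sb; rewrite -eb nh.
rewrite e in sol; case: sol => [[_ /(_ a)]|[]]; first by rewrite sa'.
by rewrite e0.
Qed.

Hypothesis T_gt0 : 0 < T.

Lemma progB_spec st : initial X st ->
  wp no_oracle (ProgB P D) st (600 * (T * m * M)) (solved C).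
Proof.
case=> hr _; have hX : holds st 0 0 X by apply/holds_read.
have mM : m * 6 <= m * M by rewrite leq_mul2l (leq_trans _ M_ge) ?orbT // leq_addl.
have lM : l + 6 <= m * M by apply: leq_trans M_ge _; rewrite leq_pmull.
have TmM : m * M <= T * m * M by rewrite -mulnA leq_pmull.
have sX := size_X.
have /holds_cat[hh _] : holds st 0 0 X by [].
set B := 600 * _.
apply: (@wp_seqf _ _ _ _ 14 (B - 14) _ (fun st1 =>
  [/\ reg st1 5 = l, reg st1 8 = m & reg st1 9 = q.+1])) => //; last by rewrite /B; lia.
  apply: wp_straight => //=.
  by rewrite !(hh 2, hh 3, hh 5) //= addn1.
move=> st1 sm1 [e5 e8 e9].
have hX1 : holds st1 0 0 X by apply: holds_ext hX => i; rewrite (same_arr _ sm1).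
have hT := @trunc_spec no_oracle st1 hd m blocksC q l erefl hX1 e5 e8 e9 size_blocksC (fun i =>
  all_words _).
apply: (wp_seqf (c2 := 210 * (T * m * M) + 200) _ hT) => //; last by rewrite /B; lia.
move=> st2 sm2 [[_ oX2] e30].
have hX2 : holds st2 0 0 X by apply: holds_ext hX1 => i; rewrite (same_arr _ sm2).
rewrite addnS; apply: wp_if => h30.
  apply: wp_straight => //; first by rewrite addnS.
  left; split=> //.
  move: h30; rewrite e30 => /existsP[i /nilP] /= e a.
  by apply: (@no_sat_nil i); apply: size0nil; rewrite -(size_map (@enc_pair S n)) e.
(* Register 30 is 0, so every list has a first pair and H can be formed. *)
have [f hf] : exists f : 'I_m -> constraint S n, forall i, exists L, Ls i = f i :: L.
  apply: (@fin_all_exists _ _ (fun i kt => exists L, Ls i = kt :: L)) => i.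
  case e : (Ls i) => [|kt L]; last by exists kt, L.
  by move: e30; rewrite h30 => /esym/existsP[]; exists i; rewrite /= e.
pose H : instance S n m := [tuple ((f i).1, comp_scope (sc i) (f i).2) | i < m].
have eH i : exists kt L, Ls i = kt :: L /\ tnth H i = (kt.1, comp_scope (sc i) kt.2).
  by have [L e] := hf i; exists (f i), L; rewrite tnth_mktuple.
have sH := sub_H eH.
apply: (@wp_seqf _ _ _ _ 3 (210 * (T * m * M) + 196) _ (fun st3 =>
  [/\ reg st3 22 = 0, reg st3 23 = size hd & out st3 40 28 [::]])) => //; last by lia.
  by apply: wp_straight.
move=> st3 sm3 [e22 e23 oP].
have hh3 : holds st3 0 (reg st3 22) hd.
  rewrite e22; apply: holds_ext hh => i.
  by rewrite (same_arr _ sm3) // (same_arr _ sm2) // (same_arr _ sm1).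
apply: (wp_seqf (c2 := 210 * (T * m * M) + 141) _ (copy_spec _ (B := 40) _ _ e23 hh3 oP)) => //;
  last by rewrite /=; lia.
move=> st4 sm4 [_ _ [_ hP4]].
apply: (@wp_seqf _ _ _ _ 1 (210 * (T * m * M) + 140) _ (fun st5 => reg st5 31 = 0)) => //; last
  by lia.
  by apply: wp_straight.
move=> st5 sm5 e31.
have a5 b i : b != 40 -> arr st5 b i = arr st2 b i.
  by move=> nb; rewrite (same_arr _ sm5) // (same_arr _ sm4) ?(same_arr _ sm3) //= !orbF.
have r5 r : r \in [:: 5; 8; 9] -> reg st5 r = reg st1 r.
  by rewrite !inE => /or3P[] /eqP ->; rewrite (same_reg sm5) // (same_reg sm4) // (same_reg sm3)
    // (same_reg sm2).
have j5 : sim_inv [::] st5.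
  split; first by split; rewrite r5.
  - by apply: holds_ext hX2 => i; rewrite a5.
  - by apply: holds_ext oX2 => i; rewrite a5.
  by left.
(* The simulated run starts from whatever the host holds in the cells of the solver; beyond the
   header, initial contents are arbitrary. *)
pose s := State (fun r => reg st5 (solver_cell r)) (fun b i => arr st5 (solver_cell b) i) [::].
have ini : initial hd s.
  split=> //; apply/holds_read => i li.
  by have := hP4 i li; rewrite -(same_arr _ sm5).
have [k [s' [ex lek sol]]] := run_P (revealing_oracle sH) ini.
have neP r c : c < 40 -> c <> solver_cell r.
  by move=> c40 e; move: c40; rewrite e /solver_cell ltnNge leq_addr.
have Jst h stA stB : sim_inv h stA -> (forall r, (forall x, r <> solver_cell x) -> reg stB r =
  reg stA r) ->
     (forall b, (forall x, b <> solver_cell x) -> forall i, arr stB b i = arr stA b i) ->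
     hist stB = hist stA -> sim_inv h stB.
  move=> [[e5' e8' e9'] hA hB fnd] er ea _; split.
  - by split; rewrite er // => x; apply: neP.
  - by apply: holds_ext hA => i; rewrite ea // => x; apply: neP.
  - by apply: holds_ext hB => i; rewrite ea // => x; apply: neP.
  case: fnd => [[e nh]|[e [a sa ha]]].
    by left; split=> //; rewrite er // => x; apply: neP.
  right; split; first by rewrite er // => x; apply: neP.
  exists a => //; apply: holds_ext ha => i; rewrite ea // => x; exact: neP.
have c0 : 0 < 200 * m * M by nia.
have := @wp_translate no_oracle (oracle_of H) solver_cell (Ask D) sim_inv (200 * m * M) P s k s'
  solver_cell_inj c0 Jst
  (fun x a y h st v j e => @ask_spec H eH no_oracle x a y h st v j e) ex st5 (conj (fun=> erefl)
    (fun _ _ => erefl)) j5.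
move=> hsim; apply: (wp_seq (c1 := k * (200 * m * M)) (c2 := 9 * l + 40)); last first.
  have : k * (200 * m * M) <= T * (200 * m * M).
    by rewrite leq_mul2r (leq_trans _ lek) ?orbT // leq_addl.
  have -> : T * (200 * m * M) = 200 * (T * m * M) by nia.
  by nia.
apply: wp_mono hsim (leqnn _) _ => st6 [ag [[e5' _ _] _ _ fnd]].
rewrite addnS; apply: wp_if => h31.
  apply: wp_straight => //; first by rewrite addnS.
  case: fnd => [[e _]|[_ [a sa ha]]]; first by rewrite e in h31.
  right; split=> //; exists a => //.
  have := (holds_read _ _ _).1 ha; rewrite size_word; exact.
case: fnd => [[_ nh]|[e _]]; last by rewrite e in h31.
have e40 : reg st6 40 = reg s' 0 by apply: (ag.1 0).
rewrite addnS; apply: wp_if => h40; last first.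
  apply: wp_straight => //; first by rewrite addnS.
  by left; split=> //; apply: (no_sat_det sH ini ex) => //; rewrite -e40.
case: sol => [[e0 _]|[_ [a sa ra]]]; first by rewrite e40 e0 in h40.
apply: (@wp_seqf _ _ _ _ 4 (9 * l + 34) _ (fun st7 =>
  [/\ reg st7 22 = 0, reg st7 23 = size (word a) & out st7 1 28 [::]])) => //; last by lia.
  by apply: wp_straight => //=; rewrite e5' addn0 size_word.
move=> st7 sm7 [e22' e23' o1].
have ha7 : holds st7 42 (reg st7 22) (word a).
  rewrite e22'; apply/holds_read; rewrite size_word -ra.
  by apply: eq_mkseq => i; rewrite (same_arr _ sm7) //; apply: (ag.2 1).
apply: (wp_seqf (c2 := 1) _ (copy_spec _ (B := 1) _ _ e23' ha7 o1)) => //; last by rewrite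
  size_word; lia.
move=> st8 sm8 [_ _ [_ h1]]; apply: wp_straight => //; right; split=> //; exists a.
  exact: sub_sat sH sa.
have := (holds_read _ _ _).1 h1; rewrite size_word; exact.
Qed.
End Reverse.

(** The empty union is always a relation of the union problem, so the maximum ranges over a nonempty
    set, and its decider reads a nonempty input. *)
Lemma max_comp_gt0 (S : csp) (comp : forall n, 'I_(nrel (Ucsp (Ecsp S)) n) -> nat) n :
  decidable_in (UE_pres S) comp -> 0 < n -> 0 < max_comp comp n.
Proof.
move=> [D hD] n0; set k := union_index ([::] : basics S n).
pose u : tup (Ucsp (Ecsp S)) n := [tuple Ordinal (alph_gt0 S n0) | _ < len S n].
have nm : names (UE_pres S) k (basics_word ([::] : basics S n)).
  by exists [::]; rewrite rel_union_index.
have := runs_in_size (hD n k _ u n0 nm); rewrite /= => h.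
by apply: leq_trans (@leq_bigmax _ (fun k => comp n k) k); apply: leq_trans h.
Qed.

Lemma union_of_hidden (S : csp) (T : nat -> nat -> nat)
    (comp : forall n, 'I_(nrel (Ucsp (Ecsp S)) n) -> nat) :
  decidable_in (UE_pres S) comp -> hidden_solvable S T ->
  solvable_O (UE_pres S) (fun n m => T n m * m * max_comp comp n).
Proof.
move=> decD [posT [P hP]]; have [D hD] := decD.
exists (fun n m => 1000 * (T n m * m * max_comp comp n)); first by exists 1000.
split=> [n m n0 m0|]; first by rewrite !muln_gt0 /= posT // m0 max_comp_gt0.
exists (ProgB P D) => n m C x n0 m0 [ws hws ex].
have runP (H : instance S n m) O : revealing H O ->
    runs_in O P (std_header S n ++ [:: m]) (T n m) (solved H) by move=> rev; apply: hP.
have runD (k : 'I_(nrel (Ucsp (Ecsp S)) n)) y (u : tup (Ucsp (Ecsp S)) n) :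
    names (UE_pres S) k y ->
    runs_in no_oracle D (std_header S n ++ y ++ word u) (max_comp comp n)
      (fun st => (reg st 0 != 0) = (u \in Defs.rel k)).
  move=> nm; apply: (runs_in_mono (hD n k y u n0 nm)).
  exact: (@leq_bigmax _ (fun k => comp n k)).
(* Names are given only by existence of a list; finite choice fixes the lists of all m constraints
   at once. *)
have [Ls hLs] := fin_all_exists hws.
have uLs i : uniq (Ls i) by case: (hLs i).
have rLs i : basics_union (Ls i) = Defs.rel (tnth C i).1 by case: (hLs i).
have eX : x = encs (hdr S n m) [seq blocksC C Ls i | i <- enum 'I_m].
  rewrite ex /encs /hdr -catA; congr (_ ++ _ :: flatten _); rewrite -map_comp.
  apply: eq_map => i /=; rewrite /enc /blocksC /= -cat_cons enc_basics.
  by have [_ _ ->] := hLs i.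
move=> st ist; rewrite eX in ist *.
have [k [st' [ex' lek sol]]] := progB_spec n0 m0 runP runD uLs rLs (posT n m n0 m0) ist.
exists k, st'; split=> //.
have hS := size_X n0 m0 runD C uLs.
have hM := M_ge n0 m0 runD uLs.
have T0 := posT n m n0 m0.
have h1 : m * 6 <= m * max_comp comp n by rewrite leq_mul2l (leq_trans _ hM) ?orbT // leq_addl.
have h2 : m * max_comp comp n <= T n m * m * max_comp comp n by rewrite -mulnA leq_pmull.
by move: hS lek h1 h2; move: (size _) (T n m * m * _) (m * max_comp _ _) => A B M; lia.
Qed.

Theorem theorem3 (S : csp) :
  (forall (T : nat -> nat -> nat) (comp : forall n, 'I_(nrel S n) -> nat),
     decidable_in (std_pres S) comp ->
     solvable (UE_pres S) T ->
     hidden_solvable_O S (fun n m =>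
       (T n m + nrel S n * #|{: scopes S n}| * max_comp comp n)
         * m * dim (ctype (Ucsp (Ecsp S)) n)))
  /\
  (forall (T : nat -> nat -> nat) (comp : forall n, 'I_(nrel (Ucsp (Ecsp S)) n) -> nat),
     decidable_in (UE_pres S) comp ->
     hidden_solvable S T ->
     solvable_O (UE_pres S) (fun n m => T n m * m * max_comp comp n)).
Proof.
split=> T comp; first exact: hidden_of_union.
exact: union_of_hidden.
Qed.
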